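(* Let $d\ge 3$ and let $K\subset\mathbb{R}^d$ be a non-empty compact set. If $\int_{(0,\infty)} \big(P(\tilde{K}_t)\big)^{-1}\,dt<\infty$, then \[ \operatorname{cap}(K)\le \Big(\int_{(0,\infty)} \big(P(\tilde{K}_t)\big)^{-1}\,dt\Big)^{-1}, \] with equality if $K$ is a closed ball.
   Context: For a compact $K\subset\mathbb{R}^d$, $d\ge3$, the Newtonian capacity is $\operatorname{cap}(K)=\inf\{\int_{\mathbb{R}^d}|Du|^2:\ u\ge \mathbf 1_K,\ u\in D^1(\mathbb{R}^d)\cap C^0(\mathbb{R}^d)\}$, where $D^1(\mathbb{R}^d)$ is the set of $f\in L^1_{\rm loc}(\mathbb{R}^d)$ with $Df\in L^2(\mathbb{R}^d)$ that vanish at infinity, i.e. $|\{|f|>\varepsilon\}|<\infty$ for all $\varepsilon>0$ ($|\cdot|$ is Lebesgue measure). For a non-empty compact set $A$ and $r>0$, $A_r=\{x\in\mathbb{R}^d: \min_{y\in A}|x-y|\le r\}$ is its closed $r$-parallel set. $U_K$ denotes the unique unbounded connected component of $\mathbb{R}^d\setminus K$, and $\tilde K=\mathbb{R}^d\setminus U_K$ (i.e. $K$ with its ''holes'' filled in). $P(\cdot)$ denotes perimeter; for all but countably many $t>0$, $P(\tilde K_t)=\mathcal H^{d-1}(\partial \tilde K_t)$, and $t\mapsto P(\tilde K_t)^{-1}$ is measurable. *)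

(* Defs.v *)
From HB Require Import structures.
From mathcomp Require Import all_boot all_order all_algebra.
From mathcomp Require Import all_classical all_reals all_analysis.
Set Implicit Arguments. Unset Strict Implicit. Unset Printing Implicit Defensive.
Import Order.TTheory GRing.Theory Num.Theory.
Import numFieldNormedType.Exports.
Local Open Scope classical_set_scope.
Local Open Scope ring_scope.

Section Defs.
Variables (R : realType) (d : nat).
Local Notation V := 'rV[R]_d.

(* Euclidean norm on R^d (the library norm on 'rV is the sup norm). *)
Definition enorm (x : V) : R := Num.sqrt (\sum_(i < d) x ord0 i ^+ 2).

Definition cball (c : V) (r : R) : set V := [set x | enorm (x - c) <= r].

Definition borelRd := g_sigma_algebraType (@open V).

(* mu is Lebesgue measure on the Borel sets of R^d: it gives every closed
   box its volume (this characterizes Lebesgue measure uniquely). *)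
Definition is_lebesgue_Rd (mu : {measure set borelRd -> \bar R}) : Prop :=
  forall a b : V, (forall i, a ord0 i <= b ord0 i) ->
    mu [set x : V | forall i, a ord0 i <= x ord0 i <= b ord0 i]
    = (\prod_(i < d) (b ord0 i - a ord0 i))%:E.

Definition evec (i : 'I_d) : V := delta_mx ord0 i.
Definition partial (i : 'I_d) (f : V -> R) (x : V) : R := 'D_(evec i) f x.

Definition C1 (f : V -> R) : Prop :=
  (forall i x, derivable f x (evec i)) /\ (forall i, continuous (partial i f)).

Definition compact_support {W : zmodType} (f : V -> W) : Prop :=
  exists C : set V, compact C /\ (forall x, ~ C x -> f x = 0).

Definition test_fun (phi : V -> R) : Prop := C1 phi /\ compact_support phi.

Definition test_field (phi : V -> V) : Prop :=
  (forall j, C1 (fun x => phi x ord0 j)) /\ compact_support phi.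

Definition div (phi : V -> V) (x : V) : R :=
  \sum_(i < d) partial i (fun y => phi y ord0 i) x.

Variable mu : {measure set borelRd -> \bar R}.

Definition perimeter (E : set V) : \bar R :=
  ereal_sup [set (\int[mu]_(x in (E : set borelRd)) (div phi x)%:E)%E
            | phi in [set phi | test_field phi /\ forall x, enorm (phi x) <= 1]].

Definition loc_integrable (f : V -> R) : Prop :=
  forall C : set V, compact C -> mu.-integrable (C : set borelRd) (fun x => (f x)%:E).

Definition weak_gradient (f : V -> R) (g : 'I_d -> V -> R) : Prop :=
  (forall i, loc_integrable (g i)) /\
  forall (phi : V -> R) (i : 'I_d), test_fun phi ->
    (\int[mu]_x (f x * partial i phi x)%:E
     = - \int[mu]_x (g i x * phi x)%:E)%E.

Definition sqgrad (g : 'I_d -> V -> R) (x : V) : R := \sum_(i < d) g i x ^+ 2.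

Definition D1 (f : V -> R) (g : 'I_d -> V -> R) : Prop :=
  [/\ loc_integrable f, weak_gradient f g,
      (forall i, measurable_fun [set: borelRd] (g i : borelRd -> R)),
      (\int[mu]_x (sqgrad g x)%:E < +oo)%E &
      forall eps : R, 0 < eps -> (mu [set x : V | (eps < `|f x|)%R] < +oo)%E].

Definition capacity (K : set V) : \bar R :=
  ereal_inf [set (\int[mu]_x (sqgrad ug.2 x)%:E)%E
            | ug in [set ug : (V -> R) * ('I_d -> V -> R) |
                continuous ug.1 /\ (forall x, \1_K x <= ug.1 x) /\ D1 ug.1 ug.2]].

End Defs.

Section Defs2.
Variables (R : realType) (d : nat).
Local Notation V := 'rV[R]_d.

Definition parallel (A : set V) (r : R) : set V :=
  [set x | exists2 y, A y & enorm (x - y) <= r].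

Definition UK (K : set V) : set V :=
  [set x | (~` K) x /\ ~ bounded_set (connected_component (~` K) x)].
Definition Ktilde (K : set V) : set V := ~` UK K.
End Defs2.

(* Main.v *)
(** The distance function [dl] to the filled set [A], with sublevel sets [E_t], drives both parts.

    Upper bound: the one-sided difference quotients of [dl^2] bracket [2 (x - y)_i] for every
    nearest point [y] of [x], and their integral gap tends to 0 by translation invariance; hence
    almost every [x] has a unique nearest point, and there the difference quotients of [dl] converge
    to a unit vector [D dl]. Integrating by parts and exchanging integrals gives
    [int psi(dl) D dl . phi = int psi(t) (int_{E_t} div phi) dt], first for continuous [psi], then by
    a Dynkin argument for simple [psi] cut off to an interval [I = ]a, b[]. Let [h] be simple with
    [h(t) P(E_t) <= 1] on [I], and [H = int_I h]. Taking [psi = h^2] and fields of length at most 1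
    converging to [D dl] gives [int_{dl in I} h(dl)^2 <= H], so the competitor
    [H^-1 int_{t in I, t >= dl(x)} h(t) dt] has energy at most [H^-1]. The integral of [1/P] is the
    supremum of such [H].

    Balls: testing with the fields [m(|x - c|^2) |x - c|^-d (x - c)], [m] a smooth step, produces one
    constant [w] (the area of the unit sphere) with [P(B_s) <= w s^(d-1)] and
    [cap(B_r) >= (d - 2) w r^(d-2)], the latter after mollifying and truncating the potential. *)

Require Import Defs.
From HB Require Import structures.
From mathcomp Require Import all_boot all_order all_algebra.
From mathcomp Require Import all_classical all_reals all_analysis.
From mathcomp Require Import measurable_realfun ring lra.
Import Order.TTheory GRing.Theory Num.Theory.
Import numFieldNormedType.Exports.
Set Implicit Arguments. Unset Strict Implicit. Unset Printing Implicit Defensive.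
Local Open Scope classical_set_scope.
Local Open Scope ring_scope.

(** * Smooth steps on the line *)

(** A function [F(dl)] should have energy [int F'(t)^2 P(E_t) dt], and among the [F] that drop by 1
    the least such value is the inverse of [int 1/P], with [F'] proportional to [1/P]. To make this
    rigorous from above, note that a field of length at most 1 has flux at most [P(E_t)] out of
    [E_t], by definition of the perimeter, so that [h P <= 1] turns [h^2 P] into [h]. The square of
    the distance is taken because [|x|^2 - dl(x)^2] is a supremum of affine functions; this
    convexity yields bounds on the quotients from every nearest point. The interval [I] avoids 0,
    since the unit gradient is lost on the filled set, and is bounded, which bounds all supports.
    For balls, a competitor has only a weak gradient and is small at infinity only off a set of
    finite measure. Mollification makes its quotients converge everywhere; truncation bounds what
    the exceptional set contributes on a far shell. The inverse of [int dt / (w (r+t)^(d-1))] over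
    [t > 0] is [(d-2) w r^(d-2)], so the two bounds meet. *)

Section Ramp.
Variable R : realType.
Implicit Types x y z a b q : R.

(** A quadratic remainder bound gives the derivative without splitting at a kink; [pos2] satisfies
    it with [C = 1]. *)
Lemma is_derive_quadratic (f : R -> R) (x l C : R) :
  (forall y, `|f y - f x - l * (y - x)| <= C * (y - x) ^+ 2) -> is_derive x 1 f l.
Proof.
move=> H.
have C0 : 0 <= C by have := H (x + 1); rewrite (_ : x + 1 - x = 1) ?expr1n ?mulr1; [exact: le_trans|ring].
have E : (fun h : R => h^-1 *: ((f \o shift x) (h *: 1) - f x)) @ 0^' --> l.
  apply/cvgrPdist_le => e e0; near=> h.
  have h0 : h != 0 by near: h; exact: nbhs_dnbhs_neq.
  rewrite /= /GRing.scale /= mulr1.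
  rewrite (_ : l - _ = - (h^-1 * (f (h + x) - f x - l * (h + x - x)))); last by field.
  rewrite normrN normrM normfV ler_pdivrMl ?normr_gt0//.
  apply: (le_trans (H _)); rewrite addrK -[h ^+ 2]ger0_norm ?sqr_ge0// normrX.
  rewrite expr2 mulrA [leRHS]mulrC ler_wpM2r//.
  apply: (@le_trans _ _ ((C + 1) * `|h|)); first by rewrite ler_wpM2r// lerDl.
  rewrite -ler_pdivlMl ?ltr_wpDl//; near: h.
  apply: dnbhs0_le.
  by rewrite mulr_gt0// invr_gt0 ltr_wpDl.
by split; [apply/cvg_ex; eexists; exact: E|exact: cvg_lim E].
Unshelve. all: by end_near. Qed.

Definition pos2 z := Num.max 0 z ^+ 2.

Lemma pos2_is_derive z : is_derive z 1 pos2 (2 * Num.max 0 z).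
Proof.
apply: (@is_derive_quadratic _ _ _ 1) => y; rewrite mul1r ler_norml /pos2.
have sq := sqr_ge0 (y - z).
by have [h1|h1] := leP 0 z; have [h2|h2] := leP 0 y; rewrite ?expr0n /=;
  apply/andP; split; nra.
Qed.

(** Its derivative [dsstep] is the tent of height 2 over [[0, 1]] with peak at 1/2, so this is a C1
    function rising from 0 to 1. *)
Definition sstep z := 2 * pos2 z - 4 * pos2 (z - 1/2) + 2 * pos2 (z - 1).
Definition dsstep z :=
  4 * Num.max 0 z - 8 * Num.max 0 (z - 1/2) + 4 * Num.max 0 (z - 1).

Definition ramp a b q := sstep ((q - a) / (b - a)).
Definition dramp a b q := dsstep ((q - a) / (b - a)) / (b - a).

Lemma sstep_le0 z : z <= 0 -> sstep z = 0.
Proof. by move=> z0; rewrite /sstep /pos2 !(max_l _)//; nra. Qed.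

Lemma sstep_ge1 z : 1 <= z -> sstep z = 1.
Proof. by move=> z0; rewrite /sstep /pos2 !(max_r _)//; nra. Qed.

Lemma sstep_01 z : 0 <= sstep z <= 1.
Proof.
rewrite /sstep /pos2.
have [h1|h1] := leP 0 z; have [h2|h2] := leP 0 (z - 1/2); have [h3|h3] := leP 0 (z - 1);
  apply/andP; split; nra.
Qed.

Lemma dsstep_02 z : 0 <= dsstep z <= 2.
Proof.
rewrite /dsstep.
have [h1|h1] := leP 0 z; have [h2|h2] := leP 0 (z - 1/2); have [h3|h3] := leP 0 (z - 1);
  apply/andP; split; nra.
Qed.

Lemma dsstep_out z : z <= 0 \/ 1 <= z -> dsstep z = 0.
Proof.
rewrite /dsstep.
have [h1|h1] := leP 0 z; have [h2|h2] := leP 0 (z - 1/2); have [h3|h3] := leP 0 (z - 1);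
  case; lra.
Qed.

Lemma sstep_is_derive z : is_derive z 1 sstep (dsstep z).
Proof.
have dsh c : is_derive z 1 (fun y => pos2 (y - c)) (2 * Num.max 0 (z - c)).
  have d1 : is_derive z 1 (fun y : R => y - c) 1.
    by apply: is_derive_eq; rewrite subr0.
  by have := @is_derive1_comp _ pos2 (fun y => y - c) z _ _ (pos2_is_derive (z - c)) d1; rewrite mulr1.
have := dsh (1/2); have := dsh 1; have := pos2_is_derive z => h1 h2 h3.
by apply: is_derive_eq; rewrite /GRing.scale /= /dsstep; ring.
Qed.

Lemma dsstep_continuous : continuous dsstep.
Proof.
have cm c : continuous (fun z : R => Num.max 0 (z - c)).
  move=> z; apply: (@continuous_max _ _ (cst 0) (fun y => y - c)) => //; first exact: cvg_cst.
  by apply: cvgB; [exact: cvg_id|exact: cvg_cst].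
move=> z; apply: cvgD; first apply: cvgB.
- apply: cvgM; first exact: cvg_cst.
  by have := cm 0; rewrite (_ : (fun y : R => Num.max 0 (y - 0)) = Num.max 0);
    [exact|apply/funext => y; rewrite subr0].
- by apply: cvgM; [exact: cvg_cst|exact: cm].
- by apply: cvgM; [exact: cvg_cst|exact: cm].
Qed.

Lemma ramp_is_derive a b q : is_derive q 1 (ramp a b) (dramp a b q).
Proof.
have d1 : is_derive q 1 (fun y : R => (y - a) / (b - a)) ((b - a)^-1).
  by apply: is_derive_eq; rewrite /GRing.scale /=; ring.
exact: (@is_derive1_comp _ sstep (fun y => (y - a) / (b - a)) q _ _
  (sstep_is_derive ((q - a) / (b - a))) d1).
Qed.

Lemma dramp_continuous a b : continuous (dramp a b).
Proof.
move=> q; apply: cvgM; last exact: cvg_cst.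
apply: (@continuous_comp _ _ _ (fun y : R => (y - a) / (b - a)) dsstep);
  last exact: dsstep_continuous.
by apply: cvgM; [apply: cvgB; [exact: cvg_id|exact: cvg_cst]|exact: cvg_cst].
Qed.

Lemma ramp_01 a b q : 0 <= ramp a b q <= 1. Proof. exact: sstep_01. Qed.

Lemma ramp_lo a b q : a < b -> q <= a -> ramp a b q = 0.
Proof.
move=> ab qa; apply: sstep_le0; rewrite ler_pdivrMr ?subr_gt0// mul0r; lra.
Qed.

Lemma ramp_hi a b q : a < b -> b <= q -> ramp a b q = 1.
Proof.
move=> ab qa; apply: sstep_ge1; rewrite ler_pdivlMr ?subr_gt0// mul1r; lra.
Qed.

Lemma dramp_ge0 a b q : a < b -> 0 <= dramp a b q.
Proof.
move=> ab; rewrite divr_ge0//; first by have /andP[] := dsstep_02 ((q - a) / (b - a)).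
by rewrite subr_ge0 ltW.
Qed.

Lemma dramp_le a b q : a < b -> dramp a b q <= 2 / (b - a).
Proof.
move=> ab; rewrite ler_pM2r ?invr_gt0 ?subr_gt0//.
by have /andP[] := dsstep_02 ((q - a) / (b - a)).
Qed.

Lemma dramp_out a b q : a < b -> q <= a \/ b <= q -> dramp a b q = 0.
Proof.
move=> ab h; rewrite /dramp dsstep_out ?mul0r//.
rewrite ler_pdivrMr ?subr_gt0// ler_pdivlMr ?subr_gt0// mul0r mul1r; lra.
Qed.

End Ramp.

(** * Lebesgue measure and integration by parts in R^d *)

Section BorelRd.
Variables (R : realType) (d : nat).
Local Notation V := 'rV[R]_d.
Local Notation B := (borelRd R d).

Definition cbox (a b : V) : set V :=
  [set x : V | forall i, a ord0 i <= x ord0 i <= b ord0 i].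

Definition cboxes : set (set V) := [set A | exists a b, A = cbox a b].

Lemma open_measurableRd (A : set V) : open A -> measurable (A : set B).
Proof. by move=> oA; apply: sub_sigma_algebra. Qed.

Lemma closed_measurableRd (A : set V) : closed A -> measurable (A : set B).
Proof.
move=> cA; rewrite -(setCK (A : set B)); apply: measurableC.
by apply: open_measurableRd; rewrite openC.
Qed.

Lemma cbox_closed (a b : V) : closed (cbox a b).
Proof.
rewrite (_ : cbox a b = \bigcap_(i in [set: 'I_d])
  ((fun x : V => x ord0 i) @^-1` `[a ord0 i, b ord0 i]%classic)); last first.
  apply/seteqP; split=> x /=.
    by move=> h i _ /=; rewrite in_itv /=; exact: h.
  by move=> h i; have := h i I; rewrite /= in_itv.
apply: @closed_bigI => i _.
apply: preimage_closed; last exact: itv_closed.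
by move=> x _; apply: coord_continuous.
Qed.

Lemma cbox_measurable (a b : V) : measurable (cbox a b : set B).
Proof. by apply: closed_measurableRd; exact: cbox_closed. Qed.

(** Boxes with rational corners are countably many, which makes every open set a countable union of
    boxes and so a member of the sigma-algebra they generate. *)
Lemma nbhs_cbox_rat (U : set V) (x : V) : nbhs x U ->
  exists p : 'rV[rat]_d * 'rV[rat]_d,
    cbox (map_mx ratr p.1) (map_mx ratr p.2) x /\
    cbox (map_mx ratr p.1) (map_mx ratr p.2) `<=` U.
Proof.
move=> /nbhs_ballP[e /= e0 eU].
have lo (i : 'I_d) : {q : rat | ratr q \in `](x ord0 i - e), (x ord0 i)[}.
  apply/cid. have := @rat_in_itvoo R (x ord0 i - e) (x ord0 i).
  by case=> [|q hq]; [rewrite ltrBlDr ltrDl | exists q].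
have hi (i : 'I_d) : {q : rat | ratr q \in `](x ord0 i), (x ord0 i + e)[}.
  apply/cid. have := @rat_in_itvoo R (x ord0 i) (x ord0 i + e).
  by case=> [|q hq]; [rewrite ltrDl | exists q].
exists (\row_i sval (lo i), \row_i sval (hi i)); split => /=.
  move=> i; rewrite !mxE.
  have := svalP (lo i); have := svalP (hi i); rewrite !in_itv /=; lra.
move=> y hy; apply: eU; split=> // i j; rewrite (ord1 i).
rewrite /ball /= ltr_distlC.
have := hy j; rewrite !mxE.
have := svalP (lo j); have := svalP (hi j); rewrite !in_itv /=; lra.
Qed.

Lemma measurableRd_cbox : @measurable _ B = <<s cboxes >>.
Proof.
apply/seteqP; split.
  apply: smallest_sub; first exact: smallest_sigma_algebra.
  move=> U oU.
  pose F n : set V := if unpickle n is Some p then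
    if `[< cbox (map_mx ratr (p.1 : 'rV[rat]_d)) (map_mx ratr (p.2 : 'rV[rat]_d))
           `<=` U >] then cbox (map_mx ratr p.1) (map_mx ratr p.2) else set0
    else set0.
  rewrite (_ : U = \bigcup_n F n).
    apply: sigma_algebra_bigcup => n; rewrite /F.
    case: unpickle => [p|]; last exact: sigma_algebra0.
    case: asboolP => _; last exact: sigma_algebra0.
    by apply: sub_sigma_algebra; eexists; eexists.
  apply/seteqP; split=> [x Ux|x [n _]]; rewrite /F.
    have [p [px pU]] := nbhs_cbox_rat (open_nbhs_nbhs (conj oU Ux)).
    exists (pickle p) => //; rewrite pickleK; by rewrite asboolT.
  case: unpickle => // p; case: asboolP => // pU; exact: pU.
apply: smallest_sub; first exact: sigma_algebra_measurable.
by move=> _ [a [b ->]]; exact: cbox_measurable.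
Qed.

Lemma continuous_measurableRd (W : set V) (f : V -> R) : continuous f ->
  measurable_fun (W : set B) (f : B -> R).
Proof.
move=> cf; apply: (@measurable_funTS _ _ B).
apply: (measurability _ (RGenOInfty.measurableE R)).
move=> _ [_ [a ->] <-]; rewrite setTI.
apply: open_measurableRd; move/continuousP: cf; apply.
exact: interval_open.
Qed.

Lemma continuous_measurable_endo (f : V -> V) : continuous f ->
  measurable_fun [set: B] (f : B -> B).
Proof.
move=> cf; apply: (@measurability _ _ B B _ _ (@open V)) => //.
move=> _ [A oA <-]; rewrite setTI; apply: open_measurableRd.
by move/continuousP: cf; apply.
Qed.

Lemma translate_continuous (v : V) : continuous (fun x : V => x + v).
Proof. by move=> x; exact: (cvgD cvg_id (cvg_cst _)). Qed.

Lemma translate_measurable (v : V) :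
  measurable_fun [set: B] ((fun x : V => x + v) : B -> B).
Proof. apply: continuous_measurable_endo; exact: translate_continuous. Qed.

Lemma cboxes_setI : setI_closed cboxes.
Proof.
move=> _ _ [a [b ->]] [a' [b' ->]].
exists (\row_i Num.max (a ord0 i) (a' ord0 i)), (\row_i Num.min (b ord0 i) (b' ord0 i)).
apply/seteqP; split=> x /=.
  by move=> [h h'] i; rewrite !mxE ge_max le_min; move: (h i) (h' i);
    move=> /andP[-> ->] /andP[-> ->].
move=> h; split=> i; move: (h i); rewrite !mxE ge_max le_min => /andP[];
  by move=> /andP[? ?] /andP[? ?]; apply/andP.
Qed.

Definition cube (n : nat) : set V := cbox (const_mx (- n%:R)) (const_mx n%:R).

Lemma bounded_cube (x : V) (n : nat) : `|x| <= n%:R -> cube n x.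
Proof.
move=> xn i; rewrite !mxE -ler_norml; apply: le_trans xn.
by rewrite [leRHS]/Num.norm /= mx_normrE; apply: (le_bigmax _ _ (ord0, i)).
Qed.

Lemma bigcup_cube : \bigcup_n cube n = [set: V].
Proof.
apply/seteqP; split=> // x _; exists (Num.truncn `|x|).+1 => //.
by apply/bounded_cube/ltW; exact: truncnS_gt.
Qed.

Variable mu : {measure set B -> \bar R}.
Hypothesis hmu : is_lebesgue_Rd mu.

Lemma mu_cbox (a b : V) : (forall i, a ord0 i <= b ord0 i) ->
  mu (cbox a b) = (\prod_(i < d) (b ord0 i - a ord0 i))%:E.
Proof. exact: hmu. Qed.

Lemma mu_cube_lty (n : nat) : (mu (cube n) < +oo)%E.
Proof. by rewrite mu_cbox ?ltry// => i; rewrite !mxE; have := ler0n R n; lra. Qed.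

(** The translated measure and [mu] agree on closed boxes, which are stable under intersection and
    generate the Borel sets; the cubes supply the finite exhaustion that uniqueness of measures asks
    for. *)
Lemma mu_translate (v : V) (A : set B) : measurable A ->
  mu ((fun x : V => x + v) @^-1` A) = mu A.
Proof.
move=> mA.
have mt := translate_measurable v.
pose nu := measure_function_pushforward__canonical__measure_function_Measure mu mt.
rewrite -[LHS]/(nu A).
apply: (@measure_unique _ _ B _ cube measurableRd_cbox cboxes_setI _ bigcup_cube nu mu _ _ A mA).
- by move=> n; eexists; eexists.
- move=> _ [a [b ->]]; rewrite /= /pushforward /=.
  have -> : (fun x : V => x + v) @^-1` cbox a b = cbox (a - v) (b - v).
    apply/seteqP; split=> x /= h i; move: (h i); rewrite !mxE; lra.
  have [ab|] := pselect (forall i, a ord0 i <= b ord0 i).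
    rewrite !mu_cbox//; last by move=> i; rewrite !mxE; have := ab i; lra.
    by congr EFin; apply: eq_bigr => i _; rewrite !mxE; lra.
  move=> /existsNP[i ab].
  rewrite (_ : cbox (a - v) _ = set0); last first.
    by apply/seteqP; split=> // x /(_ i); rewrite !mxE; move: ab; lra.
  rewrite (_ : cbox a b = set0)//.
  by apply/seteqP; split=> // x /(_ i); move: ab; lra.
- move=> n; rewrite /= /pushforward.
  rewrite (_ : _ @^-1` _ = cbox (const_mx (- n%:R) - v) (const_mx n%:R - v)).
    by rewrite mu_cbox ?ltry// => i; rewrite !mxE; have := ler0n R n; lra.
  by apply/seteqP; split=> x /= h i; move: (h i); rewrite !mxE; lra.
Qed.

Lemma mu_sigma_finite : sigma_finite [set: B] mu.
Proof.
exists cube; first by rewrite bigcup_cube.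
by move=> n; split; [exact: cbox_measurable|exact: mu_cube_lty].
Qed.

Lemma bounded_mu_lty (A : set B) : measurable A -> bounded_set (A : set V) ->
  (mu A < +oo)%E.
Proof.
move=> mA [M [_ /(_ (`|M| + 1))]]; rewrite (le_lt_trans (ler_norm M)) ?ltrDl//.
move=> /(_ isT) AM.
apply: (@le_lt_trans _ _ (mu (cube (Num.truncn (`|M| + 1)).+1))); last first.
  exact: mu_cube_lty.
apply: le_measure; rewrite ?inE//; first exact: cbox_measurable.
by move=> x /AM /= xM; apply/bounded_cube/(le_trans xM)/ltW; exact: truncnS_gt.
Qed.

Lemma integral_translate (v : V) (f : V -> \bar R) :
  measurable_fun [set: B] (f : B -> \bar R) ->
  (\int[mu]_x f ((x : V) + v)%R = \int[mu]_x f x)%E.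
Proof.
move=> mf.
have ge0 (g : V -> \bar R) : measurable_fun [set: B] (g : B -> \bar R) ->
    (forall x, 0 <= g x)%E -> (\int[mu]_x g ((x : V) + v)%R = \int[mu]_x g x)%E.
  move=> mg g0.
  have mt := translate_measurable v.
  rewrite -[LHS](@ge0_integral_pushforward _ _ B B R _ mt mu setT g) //.
  apply: eq_measure_integral => A mA _.
  by rewrite /pushforward; exact: mu_translate.
rewrite [LHS]integralE [RHS]integralE; congr (_ - _)%E.
- transitivity (\int[mu]_x (f^\+ (x + v)%R))%E.
    by apply: eq_integral => x _; rewrite !funeposE.
  by apply: ge0; [exact: measurable_funepos|move=> x; exact: funepos_ge0].
- transitivity (\int[mu]_x (f^\- (x + v)%R))%E.
    by apply: eq_integral => x _; rewrite !funenegE.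
  by apply: ge0; [exact: measurable_funeneg|move=> x; exact: funeneg_ge0].
Qed.

(** Compact support with an explicit radius in the sup norm: bounded sequences sharing one radius
    are dominated by a multiple of an indicator, as used in [bsupp_dominated]. *)
Definition bsupp (r : R) (f : V -> R) : Prop := forall x : V, r < `|x| -> f x = 0.

Definition supball (r : R) : set V := [set x : V | `|x| <= r].

Lemma supball_measurable (r : R) : measurable (supball r : set B).
Proof.
apply: closed_measurableRd.
rewrite (_ : supball r = (fun x : V => `|x|) @^-1` `]-oo, r]%classic).
  apply: preimage_closed; last exact: lray_closed.
  by move=> x _; exact: norm_continuous.
by apply/seteqP; split=> x /=; rewrite in_itv.
Qed.

Lemma supball_lty (r : R) : (mu (supball r) < +oo)%E.
Proof.
apply: bounded_mu_lty; first exact: supball_measurable.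
by exists r; split; [exact: num_real|move=> M rM x /= /le_trans; apply; exact: ltW].
Qed.

Lemma integrable_ball_indic (M r : R) :
  mu.-integrable [set: B] (fun x => (M * \1_(supball r) x)%:E).
Proof.
have mI := supball_measurable r.
under eq_fun do rewrite EFinM.
apply: integrableZl => //.
apply/integrableP; split.
  by apply/measurable_EFinP; exact: measurable_indic.
under eq_integral do rewrite gee0_abs ?lee_fin//.
rewrite integral_indic// setIT.
exact: supball_lty.
Qed.

Lemma bsupp_le_indic (M r : R) (f : V -> R) : bsupp r f ->
  (forall x, `|x| <= r -> `|f x| <= M) ->
  forall x, `|f x| <= M * \1_(supball r) x.
Proof.
move=> sf bf x; rewrite indicE; have [xr|xr] := leP `|x| r.
  by rewrite mem_set// mulr1; exact: bf.
by rewrite sf// normr0 memNset ?mulr0//=; apply/negP; rewrite -ltNge.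
Qed.

Lemma bsupp_integrable (M r : R) (f : V -> R) : measurable_fun [set: B] (f : B -> R) ->
  bsupp r f -> (forall x, `|x| <= r -> `|f x| <= M) ->
  mu.-integrable [set: B] (fun x => (f x)%:E).
Proof.
move=> mf sf bf; apply: (le_integrable _ _ _ (integrable_ball_indic M r)) => //.
  exact/measurable_EFinP.
move=> x _; rewrite !abse_EFin lee_fin; apply: (le_trans (bsupp_le_indic sf bf x)).
exact: ler_norm.
Qed.

Lemma bsupp_dominated (M r : R) (f_ : nat -> V -> R) (f : V -> R) :
  (forall n, measurable_fun [set: B] (f_ n : B -> R)) ->
  measurable_fun [set: B] (f : B -> R) ->
  (forall n, bsupp r (f_ n)) ->
  (forall n x, `|x| <= r -> `|f_ n x| <= M) ->
  {ae mu, forall x : B, f_ n x @[n --> \oo] --> f x} ->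
  (\int[mu]_x f_ n x)%R @[n --> \oo] --> (\int[mu]_x f x)%R.
Proof.
move=> mf_ mf sf bf cf.
pose g (x : V) := (M * \1_(supball r) x)%:E.
have h1 : forall n, measurable_fun [set: B] (fun x : B => (f_ n x)%:E).
  by move=> n; exact/measurable_EFinP.
have h2 : measurable_fun [set: B] (fun x : B => (f x)%:E) by exact/measurable_EFinP.
have h3 : {ae mu, forall x : B, setT x -> (f_ n x)%:E @[n --> \oo] --> (f x)%:E}.
  apply: filterS cf => x cf _; exact: (cvg_comp _ _ cf).
have h4 : {ae mu, forall x n, setT x -> (`|(f_ n x)%:E| <= g x)%E}.
  apply: aeW => x n _; rewrite abse_EFin lee_fin.
  exact: (bsupp_le_indic (sf n) (bf n) x).
have [+ _ cI] := dominated_convergence measurableT h1 h2 h3 (integrable_ball_indic M r) h4.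
move=> fI.
apply: fine_cvg.
have fI' : ((\int[mu]_x (f x)%:E) \is a fin_num)%E by exact: integrable_fin_num.
by move: cI; rewrite -[X in _ --> X -> _]fineK.
Qed.

(** * Difference quotients and integration by parts *)

Lemma line_deriveE (f : V -> R) (x e : V) (s : R) :
  derivable (fun t : R => f (x + t *: e)) s 1 = derivable f (x + s *: e) e /\
  'D_1 (fun t : R => f (x + t *: e)) s = 'D_e f (x + s *: e).
Proof.
have E : (fun h : R => h^-1 *: (((fun t : R => f (x + t *: e)) \o shift s) (h *: 1)
    - f (x + s *: e))) =
  (fun h : R => h^-1 *: ((f \o shift (x + s *: e)) (h *: e) - f (x + s *: e))).
  apply/funext => h; congr (_ *: (_ - _)); rewrite /= /shift.
  congr f; have -> : h%:A = h :> R by rewrite /GRing.scale /= mulr1.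
  by rewrite scalerDl addrCA.
by split; [rewrite /derivable E|rewrite /derive E].
Qed.

Lemma line_is_derive (f : V -> R) (x e : V) (s : R) : derivable f (x + s *: e) e ->
  is_derive s 1 (fun t : R => f (x + t *: e)) ('D_e f (x + s *: e)).
Proof. by have [<- <-] := line_deriveE f x e s; split. Qed.

Lemma norm_evec_le1 (i : 'I_d) : `|evec R i| <= 1.
Proof.
rewrite [leLHS]/Num.norm /= mx_normrE; apply: bigmax_le => // -[j k] _ /=.
by rewrite /evec mxE; case: (_ && _); rewrite ?normr1 ?normr0.
Qed.

Lemma line_lipschitz (f : V -> R) (i : 'I_d) (M : R) (x : V) (s : R) :
  (forall y, derivable f y (evec R i)) ->
  (forall t, `|t| <= `|s| -> `|partial i f (x + t *: evec R i)| <= M) ->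
  `|f (x + s *: evec R i) - f x| <= M * `|s|.
Proof.
move=> df bf; pose g (t : R) := f (x + t *: evec R i).
have dg (t : R) : is_derive t 1 g (partial i f (x + t *: evec R i)).
  exact: line_is_derive.
have cg : continuous g.
  by move=> t; apply/differentiable_continuous/derivable1_diffP/ex_derive.
have -> : f (x + s *: evec R i) - f x = g s - g 0 by rewrite /g scale0r addr0.
have [s0|s0] := leP 0 s.
  have [c + ->] := MVT_segment s0 (fun t _ => dg t) (continuous_subspaceT cg).
  rewrite in_itv /= => /andP[c0 cs]; rewrite subr0 normrM ler_wpM2r//.
  by apply: bf; rewrite !ger0_norm.
have [c + E] := MVT_segment (ltW s0) (fun t _ => dg t) (continuous_subspaceT cg).
rewrite in_itv /= => /andP[c0 cs]; rewrite distrC E sub0r normrM normrN ler_wpM2r//.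
by apply: bf; rewrite !ler0_norm ?lerN2// ltW.
Qed.

(** [C1] speaks of axis directions only, so [y] is moved to [x] one coordinate at a time, each move
    costing at most [M * |x - y|]. *)
Lemma axis_lipschitz (f : V -> R) (M : R) : 0 <= M ->
  (forall i y, derivable f y (evec R i)) ->
  (forall i y, `|partial i f y| <= M) ->
  forall x y, `|f x - f y| <= M * d%:R * `|x - y|.
Proof.
move=> M0 df bf x y.
pose z (k : nat) : V := \row_i (if (i < k)%N then x ord0 i else y ord0 i).
have coord (i : 'I_d) : `|x ord0 i - y ord0 i| <= `|x - y|.
  rewrite [leRHS]/Num.norm /= mx_normrE.
  by have := le_bigmax 0 (fun j : 'I_1 * 'I_d => `|(x - y) j.1 j.2|) (ord0, i);
    rewrite /= !mxE.
have zk (k : nat) : (k <= d)%N -> `|f (z k) - f y| <= M * k%:R * `|x - y|.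
  elim: k => [|k IH] kd.
    rewrite (_ : z 0 = y) ?subrr ?normr0 ?mulr0 ?mul0r//.
    by apply/rowP => j; rewrite mxE.
  rewrite (_ : f (z k.+1) - f y = (f (z k.+1) - f (z k)) + (f (z k) - f y)); last by ring.
  apply: (le_trans (ler_normD _ _)).
  rewrite -natr1 mulrDr mulr1 mulrDl addrC lerD ?(IH (ltnW kd))//.
  pose i := Ordinal kd.
  have -> : z k.+1 = z k + (x ord0 i - y ord0 i) *: evec R i.
    apply/rowP => j; rewrite !mxE eqxx /= ltnS leq_eqVlt.
    have [ji|ji] := eqVneq j i; first by rewrite ji /= eqxx ltnn mulr1; ring.
    rewrite (_ : (j == k :> nat) = false) /= ?mulr0 ?addr0//.
    by apply/negbTE; move: ji; apply: contra => /eqP jk; apply/eqP/val_inj.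
  apply: (@le_trans _ _ (M * `|x ord0 i - y ord0 i|)).
    by apply: line_lipschitz => [u|t _]; [exact: df|exact: bf].
  by rewrite ler_wpM2l.
have := zk d (leqnn d); rewrite (_ : z d = x)//.
by apply/rowP => j; rewrite mxE ltn_ord.
Qed.

Lemma bsupp_partial (r : R) (f : V -> R) (i : 'I_d) : bsupp r f ->
  bsupp r (partial i f).
Proof.
move=> sf x xr; rewrite /partial -[RHS](derive_cst (0 : R) x (evec R i)).
apply: near_eq_derive.
have := cvgr_gt _ (@norm_continuous _ V x) _ xr.
by move/(_ _); apply: filterS => y /sf.
Qed.

Lemma compact_support_bsupp (f : V -> R) : compact_support f ->
  exists2 r : R, 0 <= r & bsupp r f.
Proof.
move=> [C [/compact_bounded[M [_ /(_ (`|M| + 1))]]]].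
rewrite (le_lt_trans (ler_norm M)) ?ltrDl// => /(_ isT) CM fC.
exists (`|M| + 1) => [|x xM]; first by rewrite addr_ge0.
by apply: fC => /CM /=; rewrite leNgt xM.
Qed.

Lemma supball_compact (r : R) : compact (supball r).
Proof.
apply: bounded_closed_compact.
  by exists r; split; [exact: num_real|move=> M rM x /= /le_trans; apply; exact: ltW].
rewrite (_ : supball r = (fun x : V => `|x|) @^-1` `]-oo, r]%classic).
  apply: preimage_closed; last exact: lray_closed.
  by move=> x _; exact: norm_continuous.
by apply/seteqP; split=> x /=; rewrite in_itv.
Qed.

Lemma bsupp_compact_support (r : R) (W : zmodType) (f : V -> W) :
  (forall x : V, r < `|x| -> f x = 0) -> compact_support f.
Proof.
move=> sf; exists (supball r); split; first exact: supball_compact.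
by move=> x /negP; rewrite -ltNge => /sf.
Qed.

Lemma continuous_supball_bounded (f : V -> R) (r : R) : continuous f ->
  exists2 M : R, 0 <= M & forall x, `|x| <= r -> `|f x| <= M.
Proof.
move=> cf.
have [M [_ /(_ (`|M| + 1))]] := compact_bounded
  (continuous_compact (continuous_subspaceT cf) (supball_compact (r := r))).
rewrite (le_lt_trans (ler_norm M)) ?ltrDl// => /(_ isT) CM.
exists (`|M| + 1) => [|x xr]; first by rewrite addr_ge0.
by apply: CM; exists x.
Qed.

Lemma test_fun_bounded (f : V -> R) : test_fun f ->
  exists r M : R, [/\ 0 <= r, 0 <= M, bsupp r f &
    forall i x, `|partial i f x| <= M].
Proof.
move=> [[df cf] /compact_support_bsupp[r r0 sf]].
have MP (i : 'I_d) : {M : R | 0 <= M /\ forall x, `|partial i f x| <= M}.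
  apply/cid; have [M M0 bM] := @continuous_supball_bounded _ r (cf i).
  exists M; split => // x; have [|xr] := leP `|x| r; first exact: bM.
  by rewrite (bsupp_partial _ sf)// normr0.
exists r, (\sum_i sval (MP i)); split => //.
  by apply: sumr_ge0 => i _; case: (svalP (MP i)).
move=> i x; rewrite (bigD1 i)//= (le_trans ((svalP (MP i)).2 x))// lerDl.
by apply: sumr_ge0 => j _; case: (svalP (MP j)).
Qed.

(** Continuity of [f] itself is not part of [C1]; it comes from the bounded partial derivatives. *)
Lemma test_fun_continuous (f : V -> R) : test_fun f -> continuous f.
Proof.
move=> tf; have [r [M [r0 M0 sf bM]]] := test_fun_bounded tf.
have lf := axis_lipschitz M0 tf.1.1 bM.
move=> x; apply/(@cvgrPdist_le _ _ _ (nbhs (x : V)) _ f) => e e0.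
have K0 : 0 < M * d%:R + 1 by rewrite ltr_wpDl ?mulr_ge0.
near=> y.
apply: (le_trans (lf x y)); apply: (@le_trans _ _ ((M * d%:R + 1) * `|x - y|)).
  by rewrite ler_wpM2r// lerDl.
rewrite -ler_pdivlMl//; near: y.
by apply: cvgr_dist_le; [exact: cvg_id|rewrite mulr_gt0 ?invr_gt0].
Unshelve. all: by end_near. Qed.

Lemma test_fun_measurable (f : V -> R) : test_fun f ->
  measurable_fun [set: B] (f : B -> R).
Proof. by move=> tf; apply: continuous_measurableRd; exact: test_fun_continuous. Qed.

Definition dquot (i : 'I_d) (n : nat) (f : V -> R) (x : V) : R :=
  n.+1%:R * (f (x + n.+1%:R^-1 *: evec R i) - f x).

Lemma cvg_partial (i : 'I_d) (f : V -> R) (x : V) (h : nat -> R) :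
  derivable f x (evec R i) -> (forall n, h n != 0) -> h n @[n --> \oo] --> 0 ->
  (h n)^-1 * (f (x + h n *: evec R i) - f x) @[n --> \oo] --> partial i f x.
Proof.
move=> df h0 ch.
have hd : h n @[n --> \oo] --> 0^'.
  move=> A; rewrite /dnbhs /within /= => /ch; rewrite !nbhs_simpl /=.
  by apply: filterS => n; apply; exact: h0.
have := cvg_comp _ _ hd df; apply: cvg_trans; apply: near_eq_cvg.
by near=> n; rewrite /= /shift [_ *: evec R i + _]addrC.
Unshelve. all: by end_near. Qed.

Lemma cvg_dquot (i : 'I_d) (f : V -> R) (x : V) : derivable f x (evec R i) ->
  dquot i n f x @[n --> \oo] --> partial i f x.
Proof.
move=> df; rewrite (_ : (fun n => _) = fun n : nat =>
  (n.+1%:R^-1)^-1 * (f (x + n.+1%:R^-1 *: evec R i) - f x)); last first.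
  by apply/funext => n; rewrite invrK.
by apply: cvg_partial => //; exact: cvg_harmonic.
Qed.

Lemma cvg_dquotN (i : 'I_d) (f : V -> R) (x : V) : derivable f x (evec R i) ->
  n.+1%:R * (f (x - n.+1%:R^-1 *: evec R i) - f x) @[n --> \oo] --> - partial i f x.
Proof.
move=> df; rewrite (_ : (fun n : nat => _) = fun n : nat => - ((- n.+1%:R^-1)^-1 *
    (f (x + (- n.+1%:R^-1) *: evec R i) - f x))); last first.
  by apply/funext => n; rewrite invrN invrK mulNr opprK scaleNr.
apply: cvgN; apply: cvg_partial => //.
by rewrite -oppr0; apply: cvgN; exact: cvg_harmonic.
Qed.

Lemma bsupp_Rintegral_le (M r : R) (f : V -> R) : measurable_fun [set: B] (f : B -> R) ->
  bsupp r f -> (forall x, `|x| <= r -> `|f x| <= M) ->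
  `|\int[mu]_x f x| <= M * fine (mu (supball r)).
Proof.
move=> mf sf bf; have fi := bsupp_integrable mf sf bf.
apply: (le_trans (le_normr_Rintegral measurableT fi)).
have mI : measurable (supball r : set B) by exact: supball_measurable.
have -> : M * fine (mu (supball r)) = (\int[mu]_x (M * \1_(supball r) x))%R.
  rewrite /Rintegral; under eq_integral do rewrite EFinM.
  rewrite integralZl//; last first.
    by have := integrable_ball_indic 1 r; under eq_fun do rewrite mul1r.
  rewrite integral_indic// setIT fineM//.
  by rewrite ge0_fin_numE ?measure_ge0// supball_lty.
apply: le_Rintegral => //.
- exact: (integrable_norm fi).
- exact: integrable_ball_indic.
- by move=> x _; exact: bsupp_le_indic.
Qed.

Lemma dquot_measurable (i : 'I_d) (n : nat) (f : V -> R) :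
  measurable_fun [set: B] (f : B -> R) ->
  measurable_fun [set: B] (dquot i n f : B -> R).
Proof.
move=> mf; apply: measurable_funM => //; apply: measurable_funB => //.
by apply: (@measurable_comp _ _ _ B B _ setT) => //; exact: translate_measurable.
Qed.

Lemma Rintegral_translate (v : V) (f : V -> R) :
  measurable_fun [set: B] (f : B -> R) ->
  (\int[mu]_x f (x + v) = \int[mu]_x f x)%R.
Proof.
move=> mf; rewrite /Rintegral; congr fine.
by apply: (@integral_translate v (fun x => (f x)%:E)); exact/measurable_EFinP.
Qed.

Lemma norm_step (n : nat) (i : 'I_d) : `|n.+1%:R^-1 *: evec R i| <= 1.
Proof.
rewrite normrZ ger0_norm ?invr_ge0// -[leRHS]mulr1 ler_pM ?invr_ge0//.
  by rewrite invf_le1 ?ltr0n// ler1n.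
exact: norm_evec_le1.
Qed.

(** Translation invariance moves the difference quotient from [w] to [phi], and dominated
    convergence passes to the limit on both sides. Almost everywhere convergence of the quotients of
    [w] is asked, so that the lemma covers C1 functions, truncated mollifications and functions of
    the distance alike. *)
Lemma ibp_dquot (i : 'I_d) (w D phi : V -> R) :
  measurable_fun [set: B] (w : B -> R) -> measurable_fun [set: B] (D : B -> R) ->
  (forall r, exists M : R, forall x, `|x| <= r -> `|w x| <= M) ->
  (forall r, exists M : R, forall x n, `|x| <= r -> `|dquot i n w x| <= M) ->
  {ae mu, forall x : B, dquot i n w x @[n --> \oo] --> D x} ->
  test_fun phi ->
  (\int[mu]_x (w x * partial i phi x) = - \int[mu]_x (D x * phi x))%R.
Proof.
move=> mw mD bw bq cq tphi.
have [r [K [r0 K0 sphi bphi]]] := test_fun_bounded tphi.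
have cphi := test_fun_continuous tphi.
have mphi := test_fun_measurable tphi.
have mp : measurable_fun [set: B] (partial i phi : B -> R).
  by apply: continuous_measurableRd; exact: tphi.1.2.
have [Mw hMw] := bw (r + 1).
have [Mq hMq] := bq r.
have [Mp Mp0 hMp] := continuous_supball_bounded r cphi.
have sphi' n : bsupp (r + 1) (fun x => phi (x - n.+1%:R^-1 *: evec R i)).
  move=> x xr; apply: sphi; rewrite ltNge; apply/negP => xr'.
  move: xr; rewrite ltNge => /negP; apply.
  rewrite -[x](subrK (n.+1%:R^-1 *: evec R i)) (le_trans (ler_normD _ _))//.
  by rewrite lerD// norm_step.
have ex : 0 <= Mw.
  by apply: le_trans (hMw 0 _); rewrite ?normr0 ?addr_ge0.
pose a n := (\int[mu]_x (dquot i n w x * phi x))%R.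
pose b n x := w x * (n.+1%:R * (phi (x - n.+1%:R^-1 *: evec R i) - phi x)).
have mphin n : measurable_fun [set: B] ((fun x => phi (x - n.+1%:R^-1 *: evec R i)) : B -> R).
  by apply: (@measurable_comp _ _ _ B B _ setT) => //; exact: translate_measurable.
(* Summation by parts: a shift by one step turns the forward quotient of [w] into the backward
   quotient of [phi]. *)
have aE n : a n = (\int[mu]_x b n x)%R.
  pose F x := n.+1%:R * (w x * phi (x - n.+1%:R^-1 *: evec R i)).
  pose G x := n.+1%:R * (w x * phi x).
  have mF : measurable_fun [set: B] (F : B -> R).
    by apply: measurable_funM => //; exact: measurable_funM.
  have mG : measurable_fun [set: B] (G : B -> R).
    by apply: measurable_funM => //; exact: measurable_funM.
  have sF : bsupp (r + 1) F by move=> x /sphi' E; rewrite /F E !mulr0.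
  have sG : bsupp r G by move=> x /sphi E; rewrite /G E !mulr0.
  have iF : mu.-integrable [set: B] (fun x => (F x)%:E).
    apply: (bsupp_integrable (M := n.+1%:R * (Mw * Mp)) mF sF) => x xr.
    rewrite !normrM ger0_norm// ler_pM2l// ler_pM//; first exact: hMw.
    have [|xr'] := leP `|x - n.+1%:R^-1 *: evec R i| r; first exact: hMp.
    by rewrite sphi// normr0.
  have iG : mu.-integrable [set: B] (fun x => (G x)%:E).
    apply: (bsupp_integrable (M := n.+1%:R * (Mw * Mp)) mG sG) => x xr.
    rewrite !normrM ger0_norm// ler_pM2l// ler_pM//; last exact: hMp.
    by apply: hMw; rewrite (le_trans xr)// lerDl.
  have iF' : mu.-integrable [set: B] (fun x => (F (x + n.+1%:R^-1 *: evec R i))%:E).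
    apply: (bsupp_integrable (M := n.+1%:R * (Mw * Mp)) (r := r)).
    - by apply: (@measurable_comp _ _ _ B B _ setT) => //; exact: translate_measurable.
    - by move=> x xr; rewrite /F addrK sphi// !mulr0.
    - move=> x xr; rewrite /F addrK !normrM ger0_norm// ler_pM2l// ler_pM//; last exact: hMp.
      apply: hMw; rewrite (le_trans (ler_normD _ _))// lerD//; exact: norm_step.
  transitivity (\int[mu]_x F x - \int[mu]_x G x)%R.
    rewrite -(Rintegral_translate (n.+1%:R^-1 *: evec R i) mF) -RintegralB//.
    by apply: eq_Rintegral => x _; rewrite /dquot /F /G addrK; ring.
  rewrite -RintegralB//; apply: eq_Rintegral => x _; rewrite /F /G /b; ring.
have ca : a n @[n --> \oo] --> (\int[mu]_x (D x * phi x))%R.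
  apply: (bsupp_dominated (M := Mq * Mp) (r := r)).
  - by move=> n; apply: measurable_funM => //; exact: dquot_measurable.
  - exact: measurable_funM.
  - by move=> n x /sphi ->; rewrite mulr0.
  - by move=> n x xr; rewrite normrM ler_pM//; [exact: hMq|exact: hMp].
  - by apply: filterS cq => x cx; apply: cvgM => //; exact: cvg_cst.
have cb : a n @[n --> \oo] --> (\int[mu]_x (w x * - partial i phi x))%R.
  under eq_fun do rewrite aE.
  apply: (bsupp_dominated (M := Mw * K) (r := r + 1)).
  - move=> n; apply: measurable_funM => //; apply: measurable_funM => //.
    exact: measurable_funB.
  - by apply: measurable_funM => //; exact: measurableT_comp.
  - move=> n x xr; rewrite /b sphi'// sphi ?subrr ?mulr0//.
    by apply: le_lt_trans xr; rewrite lerDl.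
  - move=> n x xr; rewrite /b normrM ler_pM//; first exact: hMw.
    rewrite normrM ger0_norm// mulrC -ler_pdivlMr// -scaleNr.
    have := @line_lipschitz phi i K x (- n.+1%:R^-1) (tphi.1.1 i) (fun t _ => bphi i _).
    by rewrite normrN (@ger0_norm _ n.+1%:R^-1).
  - apply: aeW => x; apply: cvgM; first exact: cvg_cst.
    by apply: cvg_dquotN; exact: tphi.1.1.
rewrite -(cvg_unique (@Rhausdorff R) cb ca).
under [in RHS]eq_Rintegral do rewrite mulrN -mulN1r.
rewrite RintegralZl// ?mulN1r ?opprK//.
apply: (bsupp_integrable (M := Mw * K) (r := r)).
- exact: measurable_funM.
- by move=> x xr; rewrite (bsupp_partial _ sphi)// mulr0.
- by move=> x xr; rewrite normrM ler_pM// hMw// (le_trans xr)// lerDl.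
Qed.

(** [f] has only a directional derivative at [x]; restriction to the line [x + t *: e] reduces the
    claim to the chain rule in one variable. *)
Lemma is_derive_dir_comp (F : R -> R) (f : V -> R) (x e : V) (L l : R) :
  is_derive (f x) 1 F L -> is_derive x e f l -> is_derive x e (F \o f) (L * l).
Proof.
move=> dF df; pose g (t : R) := f (x + t *: e).
have x0 : x = x + 0 *: e by rewrite scale0r addr0.
have [E1 E2] := line_deriveE f x e 0; have [E3 E4] := line_deriveE (F \o f) x e 0.
have dg : is_derive (0 : R) 1 g l.
  split; first by rewrite E1 -x0; exact: ex_derive.
  by rewrite E2 -x0; exact: derive_val.
have dF0 : is_derive (g 0) 1 F L by rewrite /g -x0.
have dFg := is_derive1_comp dF0 dg.
split; rewrite x0; first by rewrite -E3; exact: (@ex_derive _ _ _ _ _ _ _ dFg).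
by rewrite -E4; exact: (@derive_val _ _ _ _ _ _ _ dFg).
Qed.

(** Carrying the gradient as data lets the derivatives of composite functions be read off from the
    closure rules below. *)
Definition C1grad (f : V -> R) (g : 'I_d -> V -> R) : Prop :=
  [/\ continuous f, forall i x, is_derive x (evec R i) f (g i x) &
      forall i, continuous (g i)].

Lemma C1grad_partial (f : V -> R) (g : 'I_d -> V -> R) : C1grad f g ->
  forall i, partial i f = g i.
Proof. by move=> [_ df _] i; apply/funext => x; rewrite /partial derive_val. Qed.

Lemma C1grad_C1 (f : V -> R) (g : 'I_d -> V -> R) : C1grad f g -> C1 f.
Proof.
move=> fg; split=> [i x|i]; first by have [_ df _] := fg; exact: ex_derive.
by rewrite (C1grad_partial fg); have [_ _ cg] := fg; exact: cg.
Qed.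

Lemma C1grad_test (f : V -> R) (g : 'I_d -> V -> R) (r : R) : C1grad f g ->
  bsupp r f -> test_fun f.
Proof. by move=> /C1grad_C1 Cf sf; split=> //; exact: bsupp_compact_support sf. Qed.

Lemma C1grad_eq (f f' : V -> R) (g g' : 'I_d -> V -> R) : C1grad f g ->
  f =1 f' -> (forall i, g i =1 g' i) -> C1grad f' g'.
Proof. by move=> fg /funext <- gg; rewrite (_ : g' = g)//; apply/funext => i; apply/funext => x; rewrite gg. Qed.

Lemma C1grad_cst (c : R) : C1grad (fun=> c) (fun _ _ => 0).
Proof.
by split=> [|i x|i]; [exact: cst_continuous|exact: is_derive_cst|exact: cst_continuous].
Qed.

Lemma C1grad_coord (j : 'I_d) : C1grad (fun x => x ord0 j) (fun i _ => (i == j)%:R).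
Proof.
split=> [x|i x|i]; [exact: coord_continuous| |exact: cst_continuous].
have E : (fun h : R => h^-1 *: (((fun x : V => x ord0 j) \o shift x) (h *: evec R i)
   - x ord0 j)) @ 0^' --> ((i == j)%:R : R).
  apply: (@cvg_trans _ (cst ((i == j)%:R : R) @ 0^')); last exact: cvg_cst.
  apply: near_eq_cvg; near=> h; rewrite /= !mxE eqxx /= addrK eq_sym.
  by rewrite /GRing.scale /= mulrA mulVf ?mul1r//; near: h; exact: nbhs_dnbhs_neq.
by split; [apply/cvg_ex; eexists; exact: E|exact: cvg_lim E].
Unshelve. all: by end_near. Qed.

Lemma C1gradD (f f' : V -> R) (g g' : 'I_d -> V -> R) : C1grad f g -> C1grad f' g' ->
  C1grad (fun x => f x + f' x) (fun i x => g i x + g' i x).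
Proof.
move=> [cf df cg] [cf' df' cg']; split=> [x|i x|i x].
- by apply: continuousD; [exact: cf|exact: cf'].
- exact: is_deriveD.
- by apply: continuousD; [exact: cg|exact: cg'].
Qed.

Lemma C1gradM (f f' : V -> R) (g g' : 'I_d -> V -> R) : C1grad f g -> C1grad f' g' ->
  C1grad (fun x => f x * f' x) (fun i x => f x * g' i x + f' x * g i x).
Proof.
move=> [cf df cg] [cf' df' cg']; split=> [x|i x|i x].
- by apply: continuousM; [exact: cf|exact: cf'].
- exact: is_deriveM.
- apply: (@continuousD _ _ _ (fun y => f y * g' i y) (fun y => f' y * g i y) x).
    by apply: continuousM; [exact: cf|exact: cg'].
  by apply: continuousM; [exact: cf'|exact: cg].
Qed.

Lemma C1grad_sum (I : Type) (s : seq I) (f : I -> V -> R) (g : I -> 'I_d -> V -> R) :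
  (forall k, C1grad (f k) (g k)) ->
  C1grad (fun x => \sum_(k <- s) f k x) (fun i x => \sum_(k <- s) g k i x).
Proof.
move=> fg; elim: s => [|k s IH].
  by apply: (C1grad_eq (C1grad_cst 0)) => [x|i x]; rewrite big_nil.
by apply: (C1grad_eq (C1gradD (fg k) IH)) => [x|i x]; rewrite big_cons.
Qed.

Lemma C1grad_comp (F F' : R -> R) (f : V -> R) (g : 'I_d -> V -> R) : C1grad f g ->
  (forall x, is_derive (f x) 1 F (F' (f x))) ->
  (forall x, {for f x, continuous F'}) ->
  C1grad (fun x => F (f x)) (fun i x => F' (f x) * g i x).
Proof.
move=> [cf df cg] dF cF'; split=> [x|i x|i x].
- apply: continuous_comp; first exact: cf.
  by apply/differentiable_continuous/derivable1_diffP/ex_derive.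
- exact: is_derive_dir_comp.
- apply: continuousM; last exact: cg.
  by apply: continuous_comp; [exact: cf|exact: cF'].
Qed.

Lemma C1_dquot_bounded (i : 'I_d) (f : V -> R) : C1 f ->
  forall r, exists M : R, forall x n, `|x| <= r -> `|dquot i n f x| <= M.
Proof.
move=> [df cf] r; have [M M0 bM] := @continuous_supball_bounded _ (r + 1) (cf i).
exists M => x n xr; rewrite normrM ger0_norm// mulrC -ler_pdivlMr//.
rewrite (le_trans (@line_lipschitz f i M x n.+1%:R^-1 (df i) _))//; last first.
  by rewrite ger0_norm.
move=> t tn; apply: bM; rewrite (le_trans (ler_normD _ _))// lerD//.
rewrite normrZ (le_trans _ (norm_step n i))// normrZ ler_wpM2r//.
Qed.

Lemma ibp_C1 (i : 'I_d) (w phi : V -> R) (g : 'I_d -> V -> R) : C1grad w g ->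
  test_fun phi ->
  (\int[mu]_x (w x * partial i phi x) = - \int[mu]_x (g i x * phi x))%R.
Proof.
move=> wg tphi; have [cw dw cg] := wg; apply: ibp_dquot => //.
- exact: continuous_measurableRd.
- by apply: continuous_measurableRd; exact: cg.
- by move=> r; have [M _ bM] := continuous_supball_bounded r cw; exists M.
- by apply: C1_dquot_bounded; exact: C1grad_C1 wg.
- apply: aeW => x; rewrite -(C1grad_partial wg); apply: cvg_dquot.
  by apply: (C1grad_C1 wg).1.
Qed.

End BorelRd.

(** * Radial fields and the perimeter of balls *)

Section BigSum.
Variables (R : realType) (dd : measure_display) (T : measurableType dd).
Variable nu : {measure set T -> \bar R}.

Lemma integrable_bigsum (I : Type) (s : seq I) (f : I -> T -> R) :
  (forall i, nu.-integrable setT (fun x => (f i x)%:E)) ->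
  nu.-integrable setT (fun x => (\sum_(i <- s) f i x)%:E).
Proof.
move=> fi; elim: s => [|i s IH].
  by under eq_fun do rewrite big_nil; exact: integrable0.
by under eq_fun do rewrite big_cons EFinD; exact: integrableD.
Qed.

Lemma Rintegral_bigsum (I : Type) (s : seq I) (f : I -> T -> R) :
  (forall i, nu.-integrable setT (fun x => (f i x)%:E)) ->
  (\int[nu]_x (\sum_(i <- s) f i x) = \sum_(i <- s) \int[nu]_x f i x)%R.
Proof.
move=> fi; elim: s => [|i s IH].
  by under eq_Rintegral do rewrite big_nil; rewrite big_nil Rintegral_cst// mul0r.
under eq_Rintegral do rewrite big_cons.
by rewrite big_cons RintegralD ?IH//; [exact: fi|exact: (integrable_bigsum s fi)].
Qed.

End BigSum.

Section FieldIBP.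
Variables (R : realType) (d : nat).
Local Notation V := 'rV[R]_d.
Local Notation B := (borelRd R d).
Variable mu : {measure set B -> \bar R}.
Hypothesis hmu : is_lebesgue_Rd mu.

Definition locb (f : V -> R) : Prop :=
  forall r, exists M : R, forall x, `|x| <= r -> `|f x| <= M.

Lemma continuous_locb (f : V -> R) : continuous f -> locb f.
Proof. by move=> cf r; have [M _ bM] := continuous_supball_bounded r cf; exists M. Qed.

Lemma locbM (f g : V -> R) : locb f -> locb g -> locb (fun x => f x * g x).
Proof.
move=> bf bg r; have [M fM] := bf r; have [N gN] := bg r.
by exists (M * N) => x xr; rewrite normrM ler_pM// ?fM ?gN.
Qed.

Lemma bsuppMr (r : R) (f g : V -> R) : bsupp r g -> bsupp r (fun x => f x * g x).
Proof. by move=> sg x /sg ->; rewrite mulr0. Qed.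

Lemma locb_bsupp_integrable (r : R) (f : V -> R) :
  measurable_fun [set: B] (f : B -> R) -> bsupp r f -> locb f ->
  mu.-integrable [set: B] (fun x => (f x)%:E).
Proof. by move=> mf sf bf; have [M fM] := bf r; exact: (bsupp_integrable hmu mf sf fM). Qed.

Lemma continuous_bsupp_integrable (r : R) (f : V -> R) : continuous f -> bsupp r f ->
  mu.-integrable [set: B] (fun x => (f x)%:E).
Proof.
move=> cf sf; apply: (locb_bsupp_integrable _ sf); last exact: continuous_locb.
exact: continuous_measurableRd.
Qed.

Lemma ibp_field (w : V -> R) (D X : 'I_d -> V -> R) :
  measurable_fun [set: B] (w : B -> R) -> locb w ->
  (forall i, measurable_fun [set: B] (D i : B -> R)) -> (forall i, locb (D i)) ->
  (forall i phi, test_fun phi ->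
    (\int[mu]_x (w x * partial i phi x) = - \int[mu]_x (D i x * phi x))%R) ->
  (forall i, test_fun (X i)) ->
  (\int[mu]_x (w x * \sum_(i < d) partial i (X i) x) =
    - \int[mu]_x (\sum_(i < d) D i x * X i x))%R.
Proof.
move=> mw bw mD bD ibp tX.
under eq_Rintegral do rewrite mulr_sumr.
have cX i := test_fun_continuous (tX i).
have sX i : exists r, bsupp r (X i).
  by have [r [M [_ _ ? _]]] := test_fun_bounded (tX i); exists r.
rewrite !Rintegral_bigsum.
- by rewrite -sumrN; apply: eq_bigr => i _; exact: ibp.
- move=> i; have [r sr] := sX i.
  apply: (locb_bsupp_integrable (r := r)).
  + apply: measurable_funM; first exact: mD.
    by apply: continuous_measurableRd; exact: cX.
  + exact: bsuppMr.
  + by apply: locbM; [exact: bD|exact: continuous_locb].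
- move=> i; have [r sr] := sX i.
  apply: (locb_bsupp_integrable (r := r)).
  + apply: measurable_funM => //.
    by apply: continuous_measurableRd; exact: (tX i).1.2.
  + by apply: bsuppMr; exact: bsupp_partial.
  + by apply: locbM => //; apply: continuous_locb; exact: (tX i).1.2.
Qed.

Lemma C1grad_ibp_field (w : V -> R) (g X : 'I_d -> V -> R) : C1grad w g ->
  (forall i, test_fun (X i)) ->
  (\int[mu]_x (w x * \sum_(i < d) partial i (X i) x) =
    - \int[mu]_x (\sum_(i < d) g i x * X i x))%R.
Proof.
move=> wg; have [cw _ cg] := wg; apply: ibp_field.
- exact: continuous_measurableRd.
- exact: continuous_locb.
- by move=> i; apply: continuous_measurableRd; exact: cg.
- by move=> i; apply: continuous_locb; exact: cg.
- by move=> i phi; exact: ibp_C1.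
Qed.

Lemma integral_div0 (X : 'I_d -> V -> R) : (forall i, test_fun (X i)) ->
  (\int[mu]_x (\sum_(i < d) partial i (X i) x) = 0)%R.
Proof.
move=> tX; have := C1grad_ibp_field (@C1grad_cst R d 1) tX.
under eq_Rintegral do rewrite mul1r.
move=> ->; under eq_Rintegral do under eq_bigr do rewrite mul0r.
by under eq_Rintegral do rewrite big1//; rewrite Rintegral_cst// mul0r oppr0.
Qed.

End FieldIBP.

Section Radial.
Variables (R : realType) (d : nat) (c : 'rV[R]_d).
Local Notation V := 'rV[R]_d.

(** Radial functions are written in the squared distance, a polynomial, so that they are C1 at the
    centre as well. *)
Definition sqd (x : V) : R := \sum_(i < d) (x ord0 i - c ord0 i) ^+ 2.

Lemma sqd_ge0 (x : V) : 0 <= sqd x.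
Proof. by apply: sumr_ge0 => i _; exact: sqr_ge0. Qed.

Lemma enorm_sqd (x : V) : enorm (x - c) = Num.sqrt (sqd x).
Proof. by rewrite /enorm /sqd; congr Num.sqrt; apply: eq_bigr => i _; rewrite !mxE. Qed.

Lemma C1grad_coordB (j : 'I_d) :
  C1grad (fun x : V => x ord0 j - c ord0 j) (fun i _ => (i == j)%:R).
Proof.
apply: (C1grad_eq (C1gradD (@C1grad_coord R d j) (@C1grad_cst R d (- c ord0 j)))) => [x//|i x].
by rewrite addr0.
Qed.

Lemma C1grad_sqd : C1grad sqd (fun i x => 2 * (x ord0 i - c ord0 i)).
Proof.
have := C1grad_sum (index_enum 'I_d)
  (fun j => C1gradM (C1grad_coordB j) (C1grad_coordB j)).
move=> /C1grad_eq; apply=> [x//|i x].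
rewrite (bigD1 i)//= eqxx big1 => [|j ji]; first by rewrite /= addr0; ring.
by rewrite eq_sym (negbTE ji) mulr0 addr0.
Qed.

Lemma sqd_bounded (r : R) (x : V) : sqd x <= r -> `|x| <= `|c| + (1 + r).
Proof.
move=> xr; have r0 : 0 <= r := le_trans (sqd_ge0 x) xr.
rewrite -[x in `|x|](subrK c) addrC (le_trans (ler_normD _ _))// lerD2l.
rewrite [leLHS]/Num.norm /= mx_normrE; apply: bigmax_le => [|[j k] _ /=].
  by rewrite addr_ge0.
rewrite !mxE (ord1 j).
have : (x ord0 k - c ord0 k) ^+ 2 <= r.
  by rewrite (le_trans _ xr)// /sqd (bigD1 k)//= lerDl sumr_ge0// => i _; exact: sqr_ge0.
rewrite ler_norml => h; apply/andP; split; nra.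
Qed.

Lemma radial_bsupp (r : R) (f : R -> R) : (forall q, r < q -> f q = 0) ->
  bsupp (`|c| + (1 + r)) (fun x => f (sqd x)).
Proof.
move=> f0 x xr; apply: f0; rewrite ltNge; apply/negP => /sqd_bounded.
by rewrite leNgt xr.
Qed.

Lemma C1grad_radial (f f' : R -> R) : (forall q : R, is_derive q 1 f (f' q)) ->
  continuous f' ->
  C1grad (fun x => f (sqd x)) (fun i x => f' (sqd x) * (2 * (x ord0 i - c ord0 i))).
Proof. by move=> df cf'; exact: (C1grad_comp C1grad_sqd (fun x => df _) (fun x => cf' _)). Qed.

Definition rfield (K : R -> R) (i : 'I_d) (x : V) := (x ord0 i - c ord0 i) * K (sqd x).

Lemma rfield_test (K K' : R -> R) (r : R) : (forall q : R, is_derive q 1 K (K' q)) ->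
  continuous K' -> (forall q, r < q -> K q = 0) ->
  forall i, test_fun (rfield K i).
Proof.
move=> dK cK' K0 i.
apply: (C1grad_test (C1gradM (C1grad_coordB i) (C1grad_radial dK cK'))).
exact: bsuppMr (radial_bsupp K0).
Qed.

Lemma div_rfield (K K' : R -> R) (x : V) : (forall q : R, is_derive q 1 K (K' q)) ->
  continuous K' ->
  \sum_(i < d) partial i (rfield K i) x = d%:R * K (sqd x) + 2 * sqd x * K' (sqd x).
Proof.
move=> dK cK'.
have E i : partial i (rfield K i) x =
    K (sqd x) + 2 * (x ord0 i - c ord0 i) ^+ 2 * K' (sqd x).
  rewrite (C1grad_partial (C1gradM (C1grad_coordB i) (C1grad_radial dK cK')) i) eqxx /=.
  by ring.
under eq_bigr do rewrite E.
rewrite big_split /= sumr_const card_ord; congr (_ + _); first by rewrite mulr_natl.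
by rewrite /sqd mulr_sumr mulr_suml.
Qed.

End Radial.

Section RampPower.
Variable R : realType.
Implicit Types a b p q : R.

Definition rpow p a b q := ramp a b q * q `^ p.
Definition drpow p a b q := dramp a b q * q `^ p + ramp a b q * (p * q `^ (p - 1)).

Lemma rpow_lo p a b q : a < b -> q <= a -> rpow p a b q = 0.
Proof. by move=> ab qa; rewrite /rpow ramp_lo// mul0r. Qed.

Lemma drpow_lo p a b q : a < b -> q <= a -> drpow p a b q = 0.
Proof. by move=> ab qa; rewrite /drpow ramp_lo// dramp_out ?mul0r ?addr0//; left. Qed.

Lemma rpow_is_derive p a b q : 0 < a -> a < b -> is_derive q 1 (rpow p a b) (drpow p a b q).
Proof.
move=> a0 ab; have [q0|q0] := leP q 0.
  have qa : q < a := le_lt_trans q0 a0.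
  rewrite (drpow_lo p ab (ltW qa)).
  apply: (@near_eq_is_derive R R R (cst 0)).
  by have := lt_nbhsl qa; apply: filterS => y ya; rewrite rpow_lo// ltW.
have := is_derive1_powR p q0; have := ramp_is_derive a b q => d1 d2.
apply: (@is_derive_eq _ _ _ _ _ _ _ _ (is_deriveM d1 d2)).
by rewrite /drpow /GRing.scale /=; ring.
Qed.

Lemma powR_continuous_at p q : 0 < q -> {for q, continuous (fun y => y `^ p)}.
Proof.
move=> q0; apply/differentiable_continuous/derivable1_diffP.
by have [] := is_derive1_powR p q0.
Qed.

Lemma drpow_continuous p a b : 0 < a -> a < b -> continuous (drpow p a b).
Proof.
move=> a0 ab q; have [q0|q0] := leP q 0.
  have qa : q < a := le_lt_trans q0 a0.
  rewrite /continuous_at (drpow_lo p ab (ltW qa)).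
  apply: (@cvg_trans _ (cst (0 : R) @ q)); last exact: (@cst_continuous R R 0 q).
  apply: near_eq_cvg; have := lt_nbhsl qa; apply: filterS => y ya.
  by rewrite drpow_lo// ltW.
apply: cvgD; apply: cvgM.
- exact: dramp_continuous.
- exact: powR_continuous_at.
- apply/differentiable_continuous/derivable1_diffP.
  by have [] := ramp_is_derive a b q.
- by apply: cvgM; [exact: cvg_cst|exact: powR_continuous_at].
Qed.

Lemma powR_mulr p q : 0 < q -> q * q `^ (p - 1) = q `^ p.
Proof.
move=> q0; rewrite -[X in X * _](powRr1 (ltW q0)) -powRD.
  by congr (_ `^ _); ring.
by rewrite (gt_eqF q0) implybT.
Qed.

(** For [p = - d/2] the radial field of [q^p] is [(x - c) |x - c|^-d], divergence-free off its
    centre; hence everything cancels except the term with the derivative of the ramp. *)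
Lemma rpow_div (d : nat) a b q : 0 < a -> a < b ->
  d%:R * rpow (- (d%:R / 2)) a b q + 2 * q * drpow (- (d%:R / 2)) a b q =
  2 * dramp a b q * q `^ (1 - d%:R / 2).
Proof.
move=> a0 ab; have [q0|q0] := leP q 0.
  have qa : q <= a := le_trans q0 (ltW a0).
  by rewrite rpow_lo// drpow_lo// dramp_out ?mulr0 ?mul0r ?addr0//; left.
rewrite /rpow /drpow; have <- := powR_mulr (1 - d%:R / 2) q0.
rewrite (_ : 1 - d%:R / 2 - 1 = - (d%:R / 2)); last by ring.
by have <- := powR_mulr (- (d%:R / 2)) q0; field.
Qed.

End RampPower.

Lemma powR_anti (R : realType) (a b e : R) : 0 < a -> e <= 0 -> a <= b -> b `^ e <= a `^ e.
Proof.
move=> a0 e0 ab; rewrite -[e]opprK !(powRN _ (- e)) lef_pV2 ?posrE ?powR_gt0//; last first.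
  exact: lt_le_trans ab.
by apply: ge0_ler_powR => //; rewrite ?nnegrE; lra.
Qed.

(** * The sphere constant and the energy of shell fields *)

Section BallConstant.
Variables (R : realType) (d : nat).
Local Notation V := 'rV[R]_d.
Local Notation B := (borelRd R d).
Variable mu : {measure set B -> \bar R}.
Hypothesis hmu : is_lebesgue_Rd mu.
Variable c : V.
Local Notation q_ := (sqd c).

(** The divergence of the ramped field: a surface measure smeared over the shell
    [a < |x - c|^2 < b], scaled so that its mass does not depend on the shell. *)
Definition rho (a b q : R) : R := 2 * dramp a b q * q `^ (1 - d%:R / 2).

Lemma rho_ge0 (a b q : R) : a < b -> 0 <= rho a b q.
Proof. by move=> ab; rewrite /rho mulr_ge0 ?powR_ge0// mulr_ge0// dramp_ge0. Qed.

Lemma rho_out (a b q : R) : a < b -> q <= a \/ b <= q -> rho a b q = 0.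
Proof. by move=> ab h; rewrite /rho dramp_out// mulr0 mul0r. Qed.

Lemma sqd_continuous : continuous (q_ : V -> R).
Proof. by have [] := C1grad_sqd c. Qed.

Lemma rho_continuous (a b : R) : 0 < a -> a < b -> continuous (fun x : V => rho a b (q_ x)).
Proof.
move=> a0 ab x; apply: (@continuous_comp _ _ _ q_ (rho a b)); first exact: sqd_continuous.
rewrite (_ : rho a b = fun q => d%:R * rpow (- (d%:R / 2)) a b q +
    2 * q * drpow (- (d%:R / 2)) a b q); last first.
  by apply/funext => q; rewrite rpow_div.
apply: cvgD; apply: cvgM.
- exact: cvg_cst.
- by apply/differentiable_continuous/derivable1_diffP; have [] := rpow_is_derive (- (d%:R / 2)) (q_ x) a0 ab.
- by apply: cvgM; [exact: cvg_cst|exact: cvg_id].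
- exact: drpow_continuous.
Qed.

Lemma rho_bsupp (a b : R) : a < b -> bsupp (`|c| + (1 + b)) (fun x : V => rho a b (q_ x)).
Proof. by move=> ab; apply: radial_bsupp => q bq; rewrite rho_out//; right; exact: ltW. Qed.

Lemma rho_integrable (a b : R) : 0 < a -> a < b ->
  mu.-integrable [set: B] (fun x => (rho a b (q_ x))%:E).
Proof.
move=> a0 ab; apply: (continuous_bsupp_integrable hmu (rho_continuous a0 ab)).
exact: rho_bsupp.
Qed.

(** Beyond both [b] and [b'] the two ramps are 1 and the powers cancel: subtracting the second field
    makes the support compact. *)
Definition shell (a b a' b' q : R) : R :=
  rpow (- (d%:R / 2)) a b q - rpow (- (d%:R / 2)) a' b' q.
Definition dshell (a b a' b' q : R) : R :=
  drpow (- (d%:R / 2)) a b q - drpow (- (d%:R / 2)) a' b' q.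

Section Shell.
Variables a b a' b' : R.
Hypotheses (a0 : 0 < a) (ab : a < b) (a'0 : 0 < a') (ab' : a' < b').

Lemma shell_is_derive (q : R) : is_derive q 1 (shell a b a' b') (dshell a b a' b' q).
Proof.
have := rpow_is_derive (- (d%:R / 2)) q a0 ab.
have := rpow_is_derive (- (d%:R / 2)) q a'0 ab' => d1 d2.
exact: is_deriveB.
Qed.

Lemma dshell_continuous : continuous (dshell a b a' b').
Proof. by move=> q; apply: cvgB; exact: drpow_continuous. Qed.

Lemma shell_hi (q : R) : Num.max b b' < q -> shell a b a' b' q = 0.
Proof.
rewrite gt_max => /andP[bq bq'].
by rewrite /shell /rpow !ramp_hi ?subrr// ltW.
Qed.

Lemma shell_test (i : 'I_d) : test_fun (rfield c (shell a b a' b') i).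
Proof. exact: (rfield_test c shell_is_derive dshell_continuous shell_hi i). Qed.

Lemma div_shell (x : V) :
  \sum_(i < d) partial i (rfield c (shell a b a' b') i) x =
  rho a b (q_ x) - rho a' b' (q_ x).
Proof.
rewrite (div_rfield c x shell_is_derive dshell_continuous) /shell /dshell /rho.
by rewrite -!rpow_div//; ring.
Qed.

End Shell.

Definition ballcst : R := (\int[mu]_x rho 1 2 (q_ x))%R.

(** Two such densities differ by the divergence of a compactly supported field. The shell
    [1 < q < 2] in [ballcst] is an arbitrary reference. *)
Lemma int_rho (a b : R) : 0 < a -> a < b -> (\int[mu]_x rho a b (q_ x) = ballcst)%R.
Proof.
move=> a0 ab; have l12 : 1 < 2 :> R by rewrite ltr1n.
apply/eqP; rewrite -subr_eq0 /ballcst; apply/eqP.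
rewrite -RintegralB//; [|exact: rho_integrable|exact: rho_integrable].
have := integral_div0 hmu (shell_test a0 ab ltr01 l12).
by under eq_Rintegral do rewrite (div_shell a0 ab ltr01 l12).
Qed.

Lemma ballcst_ge0 : 0 <= ballcst.
Proof. by apply: Rintegral_ge0 => x _; apply: rho_ge0; rewrite ltr1n. Qed.

(** The field is [m (- D w)] with [0 <= m <= 1] and [w] the Newtonian potential
    [|x - c|^(2-d) / (d - 2)], so its square is at most its product with [- D w]. Integration by
    parts leaves [w] against [rho a b - rho a' b'], and [w] is at most [a^(1 - d/2) / (d - 2)] where
    [rho a b] lives. *)
Lemma shell_energy (a b a' b' : R) : (3 <= d)%N -> 0 < a -> a < b -> b <= a' -> a' < b' ->
  (\int[mu]_x (\sum_(i < d) rfield c (shell a b a' b') i x ^+ 2) <=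
   ballcst * (a `^ (1 - d%:R / 2) / (d%:R - 2)))%R.
Proof.
move=> d3 a0 ab ba ab'.
have d2 : 0 < d%:R - 2 :> R by rewrite subr_gt0 ltr_nat.
have a'0 : 0 < a' by lra.
pose K := shell a b a' b'; pose X := rfield c K.
have tX := shell_test a0 ab a'0 ab'; have dX := div_shell a0 ab a'0 ab'.
(* The pole of the potential is cut off between [a / 3] and [a / 2], inside the region [q <= a]
   where the field vanishes. *)
have a30 : 0 < a / 3 by lra. have a32 : a / 3 < a / 2 by lra.
pose w (x : V) : R := rpow (1 - d%:R / 2) (a / 3) (a / 2) (q_ x) * (d%:R - 2)^-1.
pose g (i : 'I_d) (x : V) : R := (drpow (1 - d%:R / 2) (a / 3) (a / 2) (q_ x) * (d%:R - 2)^-1) *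
   (2 * (x ord0 i - c ord0 i)).
have wg : C1grad w g.
  have := C1gradM (C1grad_radial c (fun q => rpow_is_derive (1 - d%:R/2) q a30 a32)
     (@drpow_continuous _ (1 - d%:R/2) _ _ a30 a32)) (@C1grad_cst R d (d%:R - 2)^-1).
  move=> /C1grad_eq; apply => [x|i x] //.
  by rewrite mulr0 add0r /g; ring.
have sX x : \sum_(i < d) X i x ^+ 2 = q_ x * K (q_ x) ^+ 2.
  rewrite [X in _ = X * _]/sqd mulr_suml; apply: eq_bigr => i _.
  by rewrite /X /rfield exprMn.
have cX i : continuous (X i) := test_fun_continuous (tX i).
have bX i : bsupp (`|c| + (1 + Num.max b b')) (X i).
  by apply: bsuppMr; apply: radial_bsupp => q; exact: shell_hi.
have [cw _ cg] := wg.
have crho : continuous (fun x : V => rho a b (q_ x) - rho a' b' (q_ x)).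
  by move=> x; apply: (@continuousB _ _ _ _ _ x); exact: rho_continuous.
have brho : bsupp (`|c| + (1 + Num.max b b')) (fun x : V => rho a b (q_ x) - rho a' b' (q_ x)).
  apply: (radial_bsupp (f := fun q => rho a b q - rho a' b' q)) => q.
  by rewrite gt_max => /andP[bq bq']; rewrite !rho_out ?subrr//; right; exact: ltW.
have i1 : mu.-integrable [set: B] (fun x => (\sum_(i < d) X i x ^+ 2)%:E).
  apply: integrable_bigsum => i; apply: continuous_bsupp_integrable hmu _ _ _ (bsuppMr _ (bX i)).
  by move=> x; apply: (@continuousM _ _ _ _ x); exact: cX.
have i2 : mu.-integrable [set: B] (fun x => (\sum_(i < d) (- g i x) * X i x)%:E).
  apply: integrable_bigsum => i; apply: continuous_bsupp_integrable hmu _ _ _ (bsuppMr _ (bX i)).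
  move=> x; apply: (@continuousM _ _ _ _ x); last exact: cX.
  by apply: continuousN; exact: cg.
have i3 : mu.-integrable [set: B] (fun x => (w x * (rho a b (q_ x) - rho a' b' (q_ x)))%:E).
  apply: continuous_bsupp_integrable hmu _ _ _ (bsuppMr _ brho).
  by move=> x; apply: (@continuousM _ _ _ _ x); [exact: cw|exact: crho].
apply: (@le_trans _ _ (\int[mu]_x (\sum_(i < d) (- g i x) * X i x))%R).
  apply: le_Rintegral => // x _; rewrite sX.
  have -> : \sum_(i < d) (- g i x) * X i x =
      - (drpow (1 - d%:R / 2) (a / 3) (a / 2) (q_ x) * (d%:R - 2)^-1 * 2) * (q_ x * K (q_ x)).
    rewrite [X in _ = _ * (X * _)]/sqd mulr_suml mulr_sumr; apply: eq_bigr => i _.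
    by rewrite /X /rfield /g; ring.
  have [qa|qa] := leP (q_ x) a.
    by rewrite /K /shell !rpow_lo ?subrr ?expr0n ?mulr0//; lra.
  rewrite /drpow dramp_out; [|lra|right; lra].
  rewrite ramp_hi; [|lra|lra].
  rewrite (_ : 1 - d%:R / 2 - 1 = - (d%:R / 2)); last by ring.
  rewrite /K /shell /rpow -mulrBl.
  set m := ramp a b (q_ x) - _; set P := q_ x `^ _.
  (* The second ramp starts only after the first has reached 1, because [b <= a']. *)
  have m01 : 0 <= m <= 1.
    rewrite /m; have := ramp_01 a b (q_ x); have := ramp_01 a' b' (q_ x).
    have [h|h] := leP (q_ x) a'; first by rewrite (ramp_lo ab' h) => *; lra.
    by rewrite (ramp_hi ab (_ : b <= q_ x)) => *; lra.
  have P0 : 0 <= P := powR_ge0 _ _.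
  rewrite (_ : - _ * _ = q_ x * (m * P ^+ 2)); last first.
    by field; rewrite subr_eq0; apply/eqP; lra.
  rewrite exprMn ler_wpM2l ?sqd_ge0// ler_wpM2r ?sqr_ge0//.
  by rewrite expr2; case/andP: m01 => ? ?; nra.
have -> : (\int[mu]_x (\sum_(i < d) (- g i x) * X i x) =
    \int[mu]_x (w x * (rho a b (q_ x) - rho a' b' (q_ x))))%R.
  have := C1grad_ibp_field hmu wg tX.
  under eq_Rintegral do rewrite dX.
  move=> ->; rewrite -mulN1r -RintegralZl//.
    apply: eq_Rintegral => x _; rewrite mulr_sumr; apply: eq_bigr => i _.
    by rewrite mulNr mulN1r.
  apply: integrable_bigsum => i; apply: continuous_bsupp_integrable hmu _ _ _ (bsuppMr _ (bX i)).
  by move=> x; apply: (@continuousM _ _ _ _ x); [exact: cg|exact: cX].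
rewrite -(int_rho a0 ab) -RintegralZr//; last exact: rho_integrable.
apply: le_Rintegral => // [|x _].
  by have := integrableZr measurableT (a `^ (1 - d%:R / 2) / (d%:R - 2)) (rho_integrable a0 ab).
have r1 := rho_ge0 (q_ x) ab; have r2 := rho_ge0 (q_ x) ab'.
have w0 : 0 <= w x.
  rewrite /w /rpow !mulr_ge0 ?powR_ge0 ?invr_ge0 ?(ltW d2)//.
  by have /andP[] := ramp_01 (a / 3) (a / 2) (q_ x).
apply: (@le_trans _ _ (w x * rho a b (q_ x))).
  by rewrite ler_wpM2l// lerBlDr lerDl.
have [qa|qa] := leP (q_ x) a.
  by rewrite rho_out ?mulr0 ?mul0r//; left.
rewrite mulrC ler_wpM2l// /w /rpow ramp_hi ?mul1r//; last lra.
rewrite ler_pM2r ?invr_gt0//.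
apply: powR_anti => //; [lra|exact: ltW].
Qed.

End BallConstant.

(** * Upper bound for the perimeter of balls *)

Section BallPerimeter.
Variables (R : realType) (d : nat).
Local Notation V := 'rV[R]_d.
Local Notation B := (borelRd R d).
Variable mu : {measure set B -> \bar R}.
Hypothesis hmu : is_lebesgue_Rd mu.

Lemma indicE_Rintegral (E : set V) (f : V -> R) : measurable (E : set B) ->
  mu.-integrable [set: B] (fun x => (f x)%:E) ->
  (\int[mu]_(x in (E : set B)) (f x)%:E = (\int[mu]_x (\1_E x * f x))%R%:E)%E.
Proof.
move=> mE fi; rewrite integral_mkcond.
have E1 : (fun x : B => (f x)%:E) \_ E = fun x : B => (\1_E x * f x)%:E.
  apply/funext => x; rewrite patchE indicE; case: ifPn => xE; by rewrite ?mul1r ?mul0r.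
rewrite E1 /Rintegral fineK//; apply: integrable_fin_num => //; rewrite -E1.
by apply/(integrable_mkcond _ mE); apply: integrableS fi.
Qed.

Lemma continuous_sum (I : Type) (s : seq I) (f : I -> V -> R) :
  (forall i, continuous (f i)) -> continuous (fun x => \sum_(i <- s) f i x).
Proof.
move=> cf; elim: s => [|i s IH].
  rewrite (_ : (fun x : V => _) = cst 0); first exact: cst_continuous.
  by apply/funext => x; rewrite big_nil.
rewrite (_ : (fun x : V => _) = fun x => f i x + \sum_(j <- s) f j x); last first.
  by apply/funext => x; rewrite big_cons.
by move=> x; apply: (@continuousD _ _ _ _ _ x); [exact: cf|exact: IH].
Qed.

Lemma div_continuous (phi : V -> V) : test_field phi -> continuous (div phi).
Proof. by move=> [C1phi _]; apply: continuous_sum => i; exact: (C1phi i).2. Qed.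

Lemma test_field_test_fun (phi : V -> V) (j : 'I_d) : test_field phi ->
  test_fun (fun x => phi x ord0 j).
Proof.
move=> [C1phi [C [cC C0]]]; split=> //; exists C; split=> // x xC.
by rewrite C0// mxE.
Qed.

Lemma div_bsupp (phi : V -> V) : test_field phi -> exists r, bsupp r (div phi).
Proof.
move=> [C1phi [C [/compact_bounded[M [_ /(_ (`|M| + 1)) +]] C0]]].
rewrite (le_lt_trans (ler_norm M)) ?ltrDl// => /(_ isT) CM.
exists (`|M| + 1) => x xM; rewrite /div big1// => i _; apply: bsupp_partial xM => y yM.
by rewrite C0 ?mxE// => /CM /=; rewrite leNgt yM.
Qed.

(** Cauchy-Schwarz with a known bound [t]: sum [2 t u v <= u^2 + t^2 v^2] and divide by [2 t]. *)
Lemma dot_le (I : finType) (u v : I -> R) (t : R) : 0 < t ->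
  \sum_i u i ^+ 2 <= t ^+ 2 -> \sum_i v i ^+ 2 <= 1 -> \sum_i u i * v i <= t.
Proof.
move=> t0 ut v1.
have : \sum_i 2 * t * (u i * v i) <= \sum_i (u i ^+ 2 + t ^+ 2 * v i ^+ 2).
  by apply: ler_sum => i _; have := sqr_ge0 (u i - t * v i); nra.
rewrite -mulr_sumr big_split /= -mulr_sumr.
move=> H; have t2 : 0 < t ^+ 2 by rewrite exprn_gt0.
have t20 : 0 < 2 * t by rewrite mulr_gt0.
by rewrite -(ler_pM2l t20) (le_trans H)//; nra.
Qed.

Lemma enorm_le1 (v : V) : enorm v <= 1 -> \sum_(i < d) v ord0 i ^+ 2 <= 1.
Proof. by rewrite /enorm -{1}sqrtr1 ler_sqrt. Qed.

Lemma cball_sqd (c : V) (s : R) : 0 <= s -> cball c s = [set x | sqd c x <= s ^+ 2].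
Proof.
move=> s0; have E : s = Num.sqrt (s ^+ 2) by rewrite sqrtr_sqr ger0_norm.
by apply/funext => x; rewrite /cball /= enorm_sqd {1}E ler_sqrt// sqr_ge0.
Qed.

Lemma sqd_measurable (c : V) : measurable_fun [set: B] (sqd c : B -> R).
Proof. by apply: continuous_measurableRd; exact: sqd_continuous. Qed.

Lemma cball_measurable (c : V) (s : R) : 0 <= s -> measurable (cball c s : set B).
Proof.
move=> s0; rewrite cball_sqd//; apply: closed_measurableRd.
rewrite (_ : [set x | _] = sqd c @^-1` `]-oo, s ^+ 2]%classic).
  apply: preimage_closed; last exact: lray_closed.
  by move=> x _; exact: sqd_continuous.
by apply/seteqP; split=> x /=; rewrite in_itv.
Qed.

Lemma div_integrable (phi : V -> V) : test_field phi ->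
  mu.-integrable [set: B] (fun x => (div phi x)%:E).
Proof.
move=> tphi; have [r sr] := div_bsupp tphi.
exact: (continuous_bsupp_integrable hmu (div_continuous tphi) sr).
Qed.

(** By parts, the left side is the integral of [2 dramp (x - c) . phi], where the product is at most
    [|x - c|]. Since [|x - c| = q^(1 - d/2) |x - c|^(d-1)], the integrand is at most [rho] times
    [s'^(d-1)], and [rho] has integral [ballcst]. *)
Lemma ramp_div_le (c : V) (s s' : R) (phi : V -> V) : (3 <= d)%N -> 0 < s -> s < s' ->
  test_field phi -> (forall x, enorm (phi x) <= 1) ->
  (\int[mu]_x ((1 - ramp (s ^+ 2) (s' ^+ 2) (sqd c x)) * div phi x) <=
   ballcst mu c * s' ^+ d.-1)%R.
Proof.
move=> d3 s0 ss tphi phi1.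
have ss2 : s ^+ 2 < s' ^+ 2 by nra.
have s20 : 0 < s ^+ 2 by nra.
have wg : C1grad (fun x : V => 1 - ramp (s ^+ 2) (s' ^+ 2) (sqd c x))
   (fun i x => - (dramp (s ^+ 2) (s' ^+ 2) (sqd c x) * (2 * (x ord0 i - c ord0 i)))).
  have := C1gradD (@C1grad_cst R d 1) (C1gradM (@C1grad_cst R d (-1))
    (C1grad_radial c (ramp_is_derive (s ^+ 2) (s' ^+ 2)) (@dramp_continuous R _ _))).
  move=> /C1grad_eq; apply => [x|i x]; first by rewrite mulN1r.
  by rewrite mulr0 add0r addr0 mulN1r.
have tX i := test_field_test_fun i tphi.
have [_ _ cg] := wg.
have cX i : continuous (fun x => phi x ord0 i) := test_fun_continuous (tX i).
have := C1grad_ibp_field hmu wg tX => /= ->.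
rewrite -(int_rho hmu c s20 ss2) -RintegralZr//; last exact: rho_integrable.
have sX i : exists r, bsupp r (fun x => phi x ord0 i).
  by have [r [M [_ _ ? _]]] := test_fun_bounded (tX i); exists r.
have ii : mu.-integrable [set: B] (fun x => (\sum_(i < d)
    - (dramp (s ^+ 2) (s' ^+ 2) (sqd c x) * (2 * (x ord0 i - c ord0 i))) * phi x ord0 i)%:E).
  apply: integrable_bigsum => i; have [r sr] := sX i.
  apply: continuous_bsupp_integrable hmu _ _ _ (bsuppMr _ sr).
  by move=> x; apply: (@continuousM _ _ _ _ x); [exact: cg|exact: cX].
rewrite -mulN1r -RintegralZl//; apply: le_Rintegral => //.
- exact: (integrableZl measurableT (-1) ii).
- by have := integrableZr measurableT (s' ^+ d.-1) (rho_integrable hmu c s20 ss2).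
move=> x _.
have -> : -1 * (\sum_(i < d)
    - (dramp (s ^+ 2) (s' ^+ 2) (sqd c x) * (2 * (x ord0 i - c ord0 i))) * phi x ord0 i) =
  2 * dramp (s ^+ 2) (s' ^+ 2) (sqd c x) *
    \sum_(i < d) (x ord0 i - c ord0 i) * phi x ord0 i.
  by rewrite !mulr_sumr; apply: eq_bigr => i _; ring.
have [qa|qa] := leP (sqd c x) (s ^+ 2).
  by rewrite rho_out ?dramp_out ?mulr0 ?mul0r//; left.
have [qb|qb] := leP (s' ^+ 2) (sqd c x).
  by rewrite rho_out ?dramp_out ?mulr0 ?mul0r//; right.
rewrite /rho -[leRHS]mulrA ler_wpM2l//; first by rewrite mulr_ge0// dramp_ge0.
set t := Num.sqrt (sqd c x).
have q0 : 0 < sqd c x by lra.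
have t0 : 0 < t by rewrite sqrtr_gt0.
have t2 : sqd c x = t ^+ 2 by rewrite sqr_sqrtr// ltW.
have ts : t <= s' by rewrite -(@ler_pXn2r _ 2) ?nnegrE -?t2 ?ltW//; lra.
apply: (@le_trans _ _ t).
  by apply: dot_le => //; [rewrite -t2|exact: enorm_le1].
have -> : t = sqd c x `^ (1 - d%:R / 2) * t ^+ d.-1.
  rewrite t2 -powR_mulrn ?ltW// -[t ^+ d.-1]powR_mulrn ?ltW// -powRrM -powRD; last first.
    by rewrite (gt_eqF t0) implybT.
  rewrite -[LHS]powRr1 ?ltW//; congr (_ `^ _).
  have -> : d%:R = d.-1%:R + 1 :> R by rewrite natr1 prednK// (ltn_trans _ d3).
  by field.
rewrite ler_wpM2l ?powR_ge0// lerXn2r// nnegrE ltW//; lra.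
Qed.

(** As [s'] decreases to [s], the cut-offs of [ramp_div_le] tend pointwise to the indicator of the
    closed ball; on the sphere itself they equal 1 throughout. *)
Lemma perimeter_cball_le (c : V) (s : R) : (3 <= d)%N -> 0 < s ->
  (perimeter mu (cball c s) <= (ballcst mu c * s ^+ d.-1)%:E)%E.
Proof.
move=> d3 s0; apply: ge_ereal_sup => _ [phi [tphi phi1] <-].
have mE := cball_measurable c (ltW s0).
rewrite indicE_Rintegral//; last exact: div_integrable.
rewrite lee_fin.
pose s_ n : R := s + n.+1%:R^-1.
have ss n : s < s_ n by rewrite ltrDl invr_gt0.
have cs : s_ n @[n --> \oo] --> s.
  by rewrite -[X in _ --> X]addr0; apply: cvgD; [exact: cvg_cst|exact: cvg_harmonic].
have [r sr] := div_bsupp tphi.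
have cdiv := div_continuous tphi.
have [M M0 bM] := continuous_supball_bounded r cdiv.
have c1 : (\int[mu]_x ((1 - ramp (s ^+ 2) (s_ n ^+ 2) (sqd c x)) * div phi x))%R
    @[n --> \oo] --> (\int[mu]_x (\1_(cball c s) x * div phi x))%R.
  apply: (bsupp_dominated hmu (M := M) (r := r)).
  - move=> n; apply: measurable_funM; last exact: continuous_measurableRd.
    apply: measurable_funB => //.
    apply: (@measurable_comp _ _ _ B _ _ setT) => //; last exact: sqd_measurable.
    apply: continuous_measurable_fun => q.
    apply/differentiable_continuous/derivable1_diffP.
    by have [] := ramp_is_derive (s ^+ 2) (s_ n ^+ 2) q.
  - apply: measurable_funM; last exact: continuous_measurableRd.
    exact: measurable_indic.
  - by move=> n; exact: bsuppMr.
  - move=> n x xr; rewrite normrM -[leRHS]mul1r ler_pM// ?bM//.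
    by have := ramp_01 (s ^+ 2) (s_ n ^+ 2) (sqd c x); rewrite ler_norml; lra.
  - apply: aeW => x; apply: cvgM; last exact: cvg_cst.
    rewrite indicE cball_sqd ?ltW//.
    have [qs|qs] := leP (sqd c x) (s ^+ 2).
      rewrite mem_set//; apply: (@cvg_trans _ (cst (1 : R) @ \oo)); last exact: cvg_cst.
      apply: near_eq_cvg; near=> n; rewrite ramp_lo ?subr0//.
      by have := ss n; nra.
    rewrite memNset; last by apply/negP; rewrite -ltNge.
    apply: (@cvg_trans _ (cst (0 : R) @ \oo)); last exact: cvg_cst.
    apply: near_eq_cvg.
    have cs2 : s_ n ^+ 2 @[n --> \oo] --> s ^+ 2 by rewrite expr2; apply: cvgM.
    apply: filterS (cvgr_lt _ cs2 _ qs) => n nq; rewrite ramp_hi ?subrr//.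
      by have := ss n; nra.
    exact: ltW.
have c2 : ballcst mu c * s_ n ^+ d.-1 @[n --> \oo] --> ballcst mu c * s ^+ d.-1.
  apply: cvgM; first exact: cvg_cst.
  exact: (cvg_comp _ _ cs (@exprn_continuous R d.-1 s)).
apply: (ler_cvg_to c1 c2); apply: nearW => n.
exact: ramp_div_le.
Unshelve. all: by end_near. Qed.

End BallPerimeter.

(** * Mollification and the capacity of balls *)

(** The integral of a nonnegative function is a supremum over simple functions below it, hence
    monotone as it stands. It is applied to [1/P] along the parallel sets, for which no
    measurability is established. *)
Lemma le_integral_nomeas (d : measure_display) (T : measurableType d) (R : realType)
  (mu : {measure set T -> \bar R}) (D : set T) (f g : T -> \bar R) :
  (forall x, D x -> (0 <= f x)%E) -> (forall x, D x -> (f x <= g x)%E) ->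
  (\int[mu]_(x in D) f x <= \int[mu]_(x in D) g x)%E.
Proof.
move=> f0 fg; have g0 x : D x -> (0 <= g x)%E by move=> Dx; exact: le_trans (f0 x Dx) (fg x Dx).
rewrite !ge0_integralE//; apply: ge_ereal_sup => _ [h hf <-].
apply: ereal_sup_ubound; exists h => // x; apply: (le_trans (hf x)).
by rewrite !patchE; case: ifPn => // /set_mem; exact: fg.
Qed.

(** With [n = d - 2] and [C] in the role of the sphere constant, the integrand is the inverse of the
    bound for the perimeter of a ball of radius [r + t]. *)
Lemma integral_power (R : realType) (n : nat) (C r : R) : (0 < n)%N -> 0 < C -> 0 < r ->
  (\int[lebesgue_measure]_(t in `]0%R, +oo[) ((C * (r + t) ^+ n.+1)^-1)%:E =
   (r^-1 ^+ n / (C * n%:R))%:E)%E.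
Proof.
move=> n0 C0 r0; have nR : 0 < n%:R :> R by rewrite ltr0n.
pose F (t : R) : R := - (C * n%:R)^-1 * (r + t)^-1 ^+ n.
pose f (t : R) : R := (C * (r + t) ^+ n.+1)^-1.
have rt (t : R) : 0 <= t -> r + t != 0 by move=> t0; rewrite gt_eqF// ltr_pwDl.
have dF (t : R) : 0 <= t -> is_derive t 1 F (f t).
  move=> t0.
  have d1 : is_derive t 1 (fun y : R => (r + y)^-1) (- (r + t) ^- 2).
    have d0 : is_derive t 1 (fun y : R => r + y) 1.
      have := @is_deriveD _ _ _ (cst r) id t 1 _ _ (is_derive_cst r t 1) (is_derive_id t 1).
      by rewrite add0r.
    have := @is_deriveV _ (fun y : R => r + y) t _ _ (rt t t0) d0.
    by rewrite /GRing.scale /= mulr1.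
  have := is_deriveX n d1; rewrite exprfctE => d2.
  apply: (is_derive_eq (is_deriveZ (- (C * n%:R)^-1) d2)).
  rewrite /GRing.scale /= /f.
  have -> : (r + t) ^+ n.+1 = (r + t) ^+ n.-1 * (r + t) ^+ 2 by rewrite -exprD addn2 prednK.
  have := rt t t0; have : (r + t) ^+ n.-1 != 0 by rewrite expf_neq0 ?rt.
  move=> h1 h2; rewrite exprVn; field.
  by rewrite h1 h2 !gt_eqF.
have fcont (t : R) : 0 <= t -> {for t, continuous f}.
  move=> t0; apply: cvgV; first by rewrite mulf_neq0 ?expf_neq0 ?rt// gt_eqF.
  apply: cvgM; first exact: cvg_cst.
  apply: (@cvg_comp _ _ _ (fun y : R => r + y) (fun y : R => y ^+ n.+1) _ (nbhs (r + t))).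
    by apply: cvgD; [exact: cvg_cst|exact: cvg_id].
  exact: exprn_continuous.
have f0 (t : R) : 0 <= t -> 0 <= f t.
  by move=> t0; rewrite invr_ge0 mulr_ge0 ?(ltW C0)// exprn_ge0// addr_ge0 ?(ltW r0).
have cw : {within `[0, +oo[, continuous f}.
  apply: continuous_in_subspaceT => t; rewrite inE /= in_itv /= andbT => t0; exact: fcont.
rewrite -[LHS]/(\int[lebesgue_measure]_(t in `]0%R, +oo[) (f t)%:E)%E.
rewrite integral_itv_obnd_cbnd; last first.
  apply/measurable_EFinP.
  have := @subspace_continuous_measurable_fun R `[0, +oo[%classic f (measurable_itv _) cw.
  apply: measurable_funS => //.
  by move=> t /=; rewrite !in_itv /= !andbT => /ltW.
rewrite (@ge0_continuous_FTC2y _ f F 0 0).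
- by rewrite -EFinB /F addr0 sub0r mulNr opprK mulrC.
- exact: f0.
- exact: cw.
- rewrite -(mulr0 (- (C * n%:R)^-1)); apply: cvgM; first exact: cvg_cst.
  rewrite -[X in _ --> X](_ : 0 ^+ n = 0); last by rewrite expr0n gtn_eqF.
  apply: (@cvg_comp _ _ _ (fun y : R => (r + y)^-1) (fun y : R => y ^+ n) _ (nbhs 0)).
    apply/gtr0_cvgV0.
      by near=> t; rewrite addr_gt0//; near: t; exact: nbhs_pinfty_gt.
    by apply: cvg_addrl; exact: cvg_id.
  exact: exprn_continuous.
- by move=> t t0; have [] := dF t (ltW t0).
- apply: cvg_at_right_filter; apply/differentiable_continuous/derivable1_diffP.
  by have [] := dF 0 (lexx 0).
- move=> t; rewrite in_itv /= andbT => t0.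
  by rewrite derive1E; have [_ ->] := dF t (ltW t0).
Unshelve. all: by end_near. Qed.

Section Euclid.
Variables (R : realType) (d : nat).
Local Notation V := 'rV[R]_d.

Lemma enorm_ge0 (x : V) : 0 <= enorm x. Proof. exact: sqrtr_ge0. Qed.

Lemma enorm_sqr (x : V) : enorm x ^+ 2 = \sum_(i < d) x ord0 i ^+ 2.
Proof. by rewrite sqr_sqrtr// sumr_ge0// => i _; exact: sqr_ge0. Qed.

Lemma enorm_dot (x y : V) : \sum_(i < d) x ord0 i * y ord0 i <= enorm x * enorm y.
Proof.
have [x0|x0] := eqVneq (enorm x) 0.
  rewrite x0 mul0r big1// => i _.
  have : \sum_(i < d) x ord0 i ^+ 2 = 0 by rewrite -enorm_sqr x0 expr0n.
  move=> /eqP; rewrite psumr_eq0 => [/allP /(_ i)|j _]; last exact: sqr_ge0.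
  by rewrite mem_index_enum => /(_ isT) /=; rewrite sqrf_eq0 => /eqP ->; rewrite mul0r.
have [y0|y0] := eqVneq (enorm y) 0.
  rewrite y0 mulr0 big1// => i _.
  have : \sum_(i < d) y ord0 i ^+ 2 = 0 by rewrite -enorm_sqr y0 expr0n.
  move=> /eqP; rewrite psumr_eq0 => [/allP /(_ i)|j _]; last exact: sqr_ge0.
  by rewrite mem_index_enum => /(_ isT) /=; rewrite sqrf_eq0 => /eqP ->; rewrite mulr0.
have xy : 0 < enorm x * enorm y by rewrite mulr_gt0// lt_def ?x0 ?y0 enorm_ge0.
have : 0 <= \sum_(i < d) (enorm y * x ord0 i - enorm x * y ord0 i) ^+ 2.
  by apply: sumr_ge0 => i _; exact: sqr_ge0.
have -> : \sum_(i < d) (enorm y * x ord0 i - enorm x * y ord0 i) ^+ 2 =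
   2 * (enorm x * enorm y) * (enorm x * enorm y - \sum_(i < d) x ord0 i * y ord0 i).
  transitivity (\sum_(i < d) (enorm y ^+ 2 * (x ord0 i ^+ 2) + enorm x ^+ 2 * (y ord0 i ^+ 2)
     + (- (2 * (enorm x * enorm y))) * (x ord0 i * y ord0 i))).
    by apply: eq_bigr => i _; ring.
  by rewrite !big_split /= -!mulr_sumr -!enorm_sqr; ring.
have k0 : 0 < 2 * (enorm x * enorm y) by rewrite mulr_gt0.
by rewrite (pmulr_rge0 _ k0) subr_ge0.
Qed.

Lemma enormD (x y : V) : enorm (x + y) <= enorm x + enorm y.
Proof.
rewrite -(@ler_pXn2r _ 2) ?nnegrE ?addr_ge0 ?enorm_ge0//.
rewrite enorm_sqr (_ : \sum_(i < d) (x + y) ord0 i ^+ 2 = enorm x ^+ 2 +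
   enorm y ^+ 2 + 2 * \sum_(i < d) x ord0 i * y ord0 i).
  by have := enorm_dot x y; nra.
rewrite !enorm_sqr mulr_sumr -!big_split /=; apply: eq_bigr => i _.
by rewrite mxE; ring.
Qed.

Lemma enormN (x : V) : enorm (- x) = enorm x.
Proof. by rewrite /enorm; congr Num.sqrt; apply: eq_bigr => i _; rewrite mxE sqrrN. Qed.

Lemma sqdC (x y : V) : sqd x y = sqd y x.
Proof. by apply: eq_bigr => i _; rewrite -sqrrN opprB. Qed.

Lemma sqd_shift (c x v : V) : sqd (c + v) x = sqd c (x - v).
Proof. by apply: eq_bigr => i _; rewrite !mxE; ring. Qed.

Lemma enorm_le (c x : V) (s : R) : 0 <= s -> (enorm (x - c) <= s) = (sqd c x <= s ^+ 2).
Proof.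
move=> s0; have E : s = Num.sqrt (s ^+ 2) by rewrite sqrtr_sqr ger0_norm.
by rewrite enorm_sqd {1}E ler_sqrt// sqr_ge0.
Qed.

Lemma sqd_triangle (c x y : V) (s t : R) : 0 <= s -> 0 <= t ->
  sqd c x <= s ^+ 2 -> sqd x y <= t ^+ 2 -> sqd c y <= (s + t) ^+ 2.
Proof.
move=> s0 t0; rewrite -!enorm_le ?addr_ge0// => h1 h2.
rewrite -[y](subrK x) -addrA (le_trans (enormD _ _))// [s + t]addrC lerD//.
Qed.

End Euclid.

(** * Mollifiers *)

Section Mollifier.
Variables (R : realType) (d : nat).
Local Notation V := 'rV[R]_d.
Local Notation B := (borelRd R d).
Variable mu : {measure set B -> \bar R}.
Hypothesis hmu : is_lebesgue_Rd mu.
Variable e : R.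
Hypothesis e0 : 0 < e.

(** The argument is a squared distance, so [e] is the square of the mollification radius. *)
Definition bump (q : R) : R := 1 - ramp (e / 2) e q.
Definition bumpcst : R := (\int[mu]_x bump (sqd 0 x))%R.
Definition moll (x y : V) : R := bumpcst^-1 * bump (sqd x y).

Let e2 : e / 2 < e. Proof. by rewrite ltr_pdivrMr// ltr_pMr// ltr1n. Qed.

Lemma bump_01 (q : R) : 0 <= bump q <= 1.
Proof. by rewrite /bump; have := ramp_01 (e / 2) e q; lra. Qed.

Lemma bump_hi (q : R) : e < q -> bump q = 0.
Proof. by move=> eq; rewrite /bump ramp_hi ?subrr// ltW. Qed.

Lemma bump_lo (q : R) : q <= e / 2 -> bump q = 1.
Proof. by move=> eq; rewrite /bump ramp_lo ?subr0. Qed.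

Lemma bump_C1grad (x : V) : C1grad (fun y => bump (sqd x y))
   (fun i y => - (dramp (e / 2) e (sqd x y) * (2 * (y ord0 i - x ord0 i)))).
Proof.
have := C1gradD (@C1grad_cst R d 1) (C1gradM (@C1grad_cst R d (-1))
    (C1grad_radial x (ramp_is_derive (e / 2) e) (@dramp_continuous R _ _))).
move=> /C1grad_eq; apply => [y|i y]; first by rewrite mulN1r.
by rewrite mulr0 add0r addr0 mulN1r.
Qed.

Lemma bump_bsupp (x : V) : bsupp (`|x| + (1 + e)) (fun y => bump (sqd x y)).
Proof. by apply: radial_bsupp => q; exact: bump_hi. Qed.

Lemma bump_integrable (x : V) : mu.-integrable [set: B] (fun y => (bump (sqd x y))%:E).
Proof.
have [cb _ _] := bump_C1grad x.
exact: (continuous_bsupp_integrable hmu cb (bump_bsupp (x := x))).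
Qed.

Lemma bumpcst_center (x : V) : (\int[mu]_y bump (sqd x y))%R = bumpcst.
Proof.
have [cb _ _] := bump_C1grad 0.
have := Rintegral_translate hmu (- x) (continuous_measurableRd cb).
rewrite /bumpcst => <-; apply: eq_Rintegral => y _; congr bump.
by rewrite -sqd_shift add0r.
Qed.

Lemma bumpcst_gt0 : 0 < bumpcst.
Proof.
(* A cube of half-side [t] fits where the bump is 1: [t <= 1] gives [t^2 <= t], and
   [d t <= e / 2]. *)
pose t : R := Num.min 1 (e / (2 * (d%:R + 1))).
have d1 : 0 < 2 * (d%:R + 1) :> R by rewrite mulr_gt0// ltr_wpDl.
have t0 : 0 < t by rewrite lt_min ltr01 divr_gt0.
have t1 : t <= 1 by rewrite ge_min lexx.
have te : t * (2 * (d%:R + 1)) <= e by rewrite -ler_pdivlMr// ge_min lexx orbT.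
pose bx := cbox (const_mx (- t) : V) (const_mx t).
have mbx : measurable (bx : set B) by exact: cbox_measurable.
have mubx : mu bx = ((2 * t) ^+ d)%:E.
  rewrite mu_cbox//; last by move=> i; rewrite !mxE; lra.
  congr EFin; transitivity (\prod_(i < d) (2 * t)); last by rewrite prodr_const card_ord.
  by apply: eq_bigr => i _; rewrite !mxE; ring.
have bl (x : V) : bx x -> sqd 0 x <= e / 2.
  move=> xb; apply: (@le_trans _ _ (\sum_(i < d) t)).
    apply: ler_sum => i _; have := xb i; rewrite !mxE subr0 => /andP[]; nra.
  by rewrite sumr_const card_ord -mulr_natr; nra.
rewrite -lte_fin /bumpcst /Rintegral fineK; last exact: integrable_fin_num (bump_integrable 0).
apply: (@lt_le_trans _ _ (mu bx)); first by rewrite mubx lte_fin exprn_gt0// mulr_gt0.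
rewrite -[X in mu X]setIT -integral_indic//.
apply: ge0_le_integral => //.
- by apply/measurable_EFinP; exact: measurable_indic.
- by have /measurable_int := bump_integrable 0.
- move=> x _; rewrite lee_fin indicE; case: (boolP (x \in bx)) => [/set_mem xb|_].
    by rewrite bump_lo// bl.
  by have /andP[] := bump_01 (sqd 0 x).
Qed.

Lemma moll_ge0 (x y : V) : 0 <= moll x y.
Proof.
by rewrite mulr_ge0 ?invr_ge0 ?(ltW bumpcst_gt0)//; have /andP[] := bump_01 (sqd x y).
Qed.

Lemma moll_C1grad (x : V) : C1grad (moll x) (fun i y => bumpcst^-1 *
   - (dramp (e / 2) e (sqd x y) * (2 * (y ord0 i - x ord0 i)))).
Proof.
have := C1gradM (@C1grad_cst R d bumpcst^-1) (bump_C1grad x).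
by move=> /C1grad_eq; apply => [//|i y]; rewrite mulr0 addr0.
Qed.

Lemma moll_bsupp (x : V) : bsupp (`|x| + (1 + e)) (moll x).
Proof. by apply: bsuppMr; exact: bump_bsupp. Qed.

Lemma moll_test (x : V) : test_fun (moll x).
Proof. exact: C1grad_test (moll_C1grad x) (moll_bsupp (x := x)). Qed.

Lemma moll_integrable (x : V) : mu.-integrable [set: B] (fun y => (moll x y)%:E).
Proof.
exact: (continuous_bsupp_integrable hmu (test_fun_continuous (moll_test x))
  (moll_bsupp (x := x))).
Qed.

Lemma int_moll (x : V) : (\int[mu]_y moll x y = 1)%R.
Proof.
rewrite RintegralZl//; last exact: bump_integrable.
by rewrite bumpcst_center mulVf// gt_eqF// bumpcst_gt0.
Qed.

Lemma mollC (x y : V) : moll x y = moll y x.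
Proof. by rewrite /moll sqdC. Qed.

Lemma moll_shift (x v y : V) : moll (x + v) y = moll x (y - v).
Proof. by rewrite /moll sqd_shift. Qed.

Lemma moll_hi (x y : V) : e < sqd x y -> moll x y = 0.
Proof. by move=> h; rewrite /moll bump_hi// mulr0. Qed.

Lemma moll_measurable : measurable_fun [set: B * B] (fun p : B * B => moll p.1 p.2).
Proof.
apply: measurable_funM => //.
apply: (@measurableT_comp _ _ _ _ _ _ bump).
  apply: continuous_measurable_fun => q; apply: cvgB; first exact: cvg_cst.
  apply/differentiable_continuous/derivable1_diffP.
  by have [] := ramp_is_derive (e / 2) e q.
apply: measurable_sum => i; apply: measurable_funX; apply: measurable_funB.
  apply: (@measurableT_comp _ _ _ _ _ _ (fun x : B => (x : V) ord0 i)) => //.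
  by apply: continuous_measurableRd; exact: coord_continuous.
apply: (@measurableT_comp _ _ _ _ _ _ (fun x : B => (x : V) ord0 i)) => //.
by apply: continuous_measurableRd; exact: coord_continuous.
Qed.

End Mollifier.

Section SigmaFinite.
Variables (R : realType) (d : nat).
Local Notation B := (borelRd R d).
Variable mu : {measure set B -> \bar R}.

(** A copy of [mu] indexed by [hmu]: the sigma-finite structure depends on that proof and can now be
    attached as an instance for the Fubini theorems. *)
Definition lebesgue_sf (hmu : is_lebesgue_Rd mu) : set B -> \bar R := mu.

Variable hmu : is_lebesgue_Rd mu.

HB.instance Definition _ := Measure.on (lebesgue_sf hmu).
HB.instance Definition _ := @Measure_isSigmaFinite.Build _ B R (lebesgue_sf hmu)
  (mu_sigma_finite hmu).

Lemma tonelliRd2 (f : B * B -> \bar R) :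
  measurable_fun setT f -> (forall z, (0 <= f z)%E) ->
  (\int[mu]_x \int[mu]_y f (x, y) = \int[mu]_y \int[mu]_x f (x, y))%E.
Proof.
by move=> mf f0; exact: (@fubini_tonelli _ _ _ _ _ (lebesgue_sf hmu) (lebesgue_sf hmu) f mf f0).
Qed.

End SigmaFinite.

Section Mollify.
Variables (R : realType) (d : nat).
Local Notation V := 'rV[R]_d.
Local Notation B := (borelRd R d).
Variable mu : {measure set B -> \bar R}.
Hypothesis hmu : is_lebesgue_Rd mu.
Variable e : R.
Hypothesis e0 : 0 < e.
Local Notation moll := (moll mu e).

Definition mollify (u : V -> R) (x : V) : R := (\int[mu]_y (u y * moll x y))%R.

Lemma loc_integrableM (f phi : V -> R) (r M : R) : loc_integrable mu f ->
  measurable_fun [set: B] (f : B -> R) -> measurable_fun [set: B] (phi : B -> R) ->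
  bsupp r phi -> (forall x, `|x| <= r -> `|phi x| <= M) ->
  mu.-integrable [set: B] (fun x => (f x * phi x)%:E).
Proof.
move=> lf mf mphi sphi bphi.
have mI : measurable (@supball R d r : set B) by exact: supball_measurable.
have i1 := lf _ (@supball_compact R d r).
have i2 : mu.-integrable [set: B] (((fun x : B => (f x)%:E) \_ (@supball R d r))).
  by apply/(integrable_mkcond _ mI).
have := integrableZl measurableT M i2.
apply: le_integrable => //; first by apply/measurable_EFinP; exact: measurable_funM.
move=> x _; rewrite patchE; case: ifPn => [/set_mem xr|xr].
  rewrite -EFinM !abse_EFin lee_fin !normrM mulrC ler_wpM2r//.
  by rewrite (le_trans (bphi x xr))// ler_norm.
rewrite (_ : point = 0%E)// mule0 sphi ?mulr0//.
by rewrite ltNge; apply: contra xr => xr; rewrite inE.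
Qed.

Lemma mollify_bounds (u : V -> R) (x : V) (lo hi : R) : continuous u ->
  (forall y, sqd x y <= e -> lo <= u y <= hi) -> lo <= mollify u x <= hi.
Proof.
move=> cu bu.
have iu : mu.-integrable [set: B] (fun y => (u y * moll x y)%:E).
  apply: continuous_bsupp_integrable hmu _ _ _ (bsuppMr _ (@moll_bsupp R d mu e e0 x)).
  move=> y; apply: (@continuousM _ _ _ _ y); first exact: cu.
  by apply: test_fun_continuous; exact: moll_test.
have ic (k : R) : mu.-integrable [set: B] (fun y => (k * moll x y)%:E).
  exact: (integrableZl measurableT k (moll_integrable hmu e0 x)).
have Ec (k : R) : k = (\int[mu]_y (k * moll x y))%R.
  by rewrite RintegralZl ?int_moll ?mulr1//; exact: moll_integrable.
apply/andP; split.
  rewrite [leLHS]Ec; apply: le_Rintegral => [//|||y _]; [exact: ic|exact: iu|].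
  have [ye|ye] := leP (sqd x y) e; last by rewrite moll_hi// !mulr0.
  by rewrite ler_wpM2r// ?moll_ge0//; case/andP: (bu y ye).
rewrite [leRHS]Ec; apply: le_Rintegral => [//|||y _]; [exact: iu|exact: ic|].
have [ye|ye] := leP (sqd x y) e; last by rewrite moll_hi// !mulr0.
by rewrite ler_wpM2r// ?moll_ge0//; case/andP: (bu y ye).
Qed.

(** Shifting the centre of the kernel is shifting its argument the other way, so the quotient falls
    on the kernel. *)
Lemma dquot_mollify (i : 'I_d) (n : nat) (u : V -> R) (x : V) : continuous u ->
  dquot i n (mollify u) x =
  (\int[mu]_y (u y * (n.+1%:R * (moll x (y - n.+1%:R^-1 *: evec R i) - moll x y))))%R.
Proof.
move=> cu; rewrite /dquot /mollify.
have iu z : mu.-integrable [set: B] (fun y => (u y * moll z y)%:E).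
  apply: continuous_bsupp_integrable hmu _ _ _ (bsuppMr _ (@moll_bsupp R d mu e e0 z)).
  move=> y; apply: (@continuousM _ _ _ _ y); first exact: cu.
  by apply: test_fun_continuous; exact: moll_test.
rewrite -RintegralB; [|by []|exact: iu|exact: iu].
rewrite -RintegralZl; [|by []|exact: (integrableB measurableT (iu _) (iu _))].
by apply: eq_Rintegral => y _; rewrite moll_shift; ring.
Qed.

Section Bounds.
Variables (u : V -> R) (i : 'I_d).
Hypothesis cu : continuous u.

Let F (n : nat) (x y : V) :=
  u y * (n.+1%:R * (moll x (y - n.+1%:R^-1 *: evec R i) - moll x y)).

Let F_measurable (n : nat) (x : V) : measurable_fun [set: B] (F n x : B -> R).
Proof.
have mm := test_fun_measurable (moll_test mu e0 x).
apply: measurable_funM; first exact: continuous_measurableRd.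
apply: measurable_funM => //; apply: measurable_funB => //.
by apply: (@measurable_comp _ _ _ B B _ setT) => //; exact: translate_measurable.
Qed.

Let F_bsupp (n : nat) (x : V) (r : R) : `|x| <= r -> bsupp (r + (1 + e) + 1) (F n x).
Proof.
move=> xr y yr; have xe : `|x| + (1 + e) <= r + (1 + e) by rewrite lerD2r.
have m0 := @moll_bsupp R d mu e e0 x.
rewrite /F !m0 ?subrr ?mulr0//.
  apply: le_lt_trans yr; rewrite (le_trans xe)// lerDl//.
apply: (le_lt_trans xe); rewrite ltNge; apply/negP => h.
move: yr; rewrite ltNge -[y](subrK (n.+1%:R^-1 *: evec R i)) => /negP; apply.
by rewrite (le_trans (ler_normD _ _))// lerD// norm_step.
Qed.

Let F_bound : exists2 K, 0 <= K & forall n x y, `|F n x y| <= `|u y| * K.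
Proof.
have [_ [K [_ K0 _ bK]]] := test_fun_bounded (moll_test mu e0 0).
exists K => // n x y; rewrite normrM ler_wpM2l// normrM ger0_norm// mulrC -ler_pdivlMr//.
have mE z : moll x z = moll 0 (z - x) by rewrite -moll_shift add0r.
rewrite !mE addrAC -scaleNr.
have := @line_lipschitz _ _ (moll 0) i K (y - x) (- n.+1%:R^-1)
  ((moll_test mu e0 0).1.1 i) (fun t _ => bK i _).
by rewrite normrN (@ger0_norm _ n.+1%:R^-1).
Qed.

Lemma dquot_mollify_bounded (r : R) :
  exists M : R, forall x n, `|x| <= r -> `|dquot i n (mollify u) x| <= M.
Proof.
have [K K0 bF] := F_bound.
have [M M0 bu] := continuous_supball_bounded (r + (1 + e) + 1) cu.
exists (M * K * fine (mu (@supball R d (r + (1 + e) + 1)))) => x n xr.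
rewrite dquot_mollify//; apply: (bsupp_Rintegral_le hmu (F_measurable n x) (F_bsupp n xr)).
by move=> y yr; rewrite (le_trans (bF n x y))// ler_wpM2r// bu.
Qed.

(** The limit is [u] integrated against minus the derivative of the kernel; as the kernel is a test
    function, the weak derivative [g] can be inserted. This holds at every point [x]. *)
Lemma cvg_dquot_mollify (g : V -> R) (x : V) :
  (forall phi, test_fun phi ->
    (\int[mu]_x (u x * partial i phi x) = - \int[mu]_x (g x * phi x))%R) ->
  dquot i n (mollify u) x @[n --> \oo] --> mollify g x.
Proof.
move=> ug; have tm := moll_test mu e0 x.
have [K K0 bF] := F_bound.
pose r := `|x| + (1 + e) + 1.
have [M M0 bu] := continuous_supball_bounded r cu.
have -> : mollify g x = (\int[mu]_y (u y * - partial i (moll x) y))%R.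
  rewrite -[LHS]opprK -(ug _ tm).
  under [in RHS]eq_Rintegral do rewrite mulrN -mulN1r.
  rewrite RintegralZl ?mulN1r//.
  apply: continuous_bsupp_integrable hmu _ _ _ (bsuppMr _ (bsupp_partial i (@moll_bsupp R d mu e e0 x))).
  move=> y; apply: (@continuousM _ _ _ _ y); first exact: cu.
  exact: tm.1.2.
rewrite (_ : (fun n => dquot i n (mollify u) x) = fun n => (\int[mu]_y F n x y)%R); last first.
  by apply/funext => n; rewrite dquot_mollify.
apply: (bsupp_dominated hmu (M := M * K) (r := r)).
- by move=> n; exact: F_measurable.
- apply: measurable_funM; first exact: continuous_measurableRd.
  apply: measurableT_comp => //.
  by apply: continuous_measurableRd; exact: tm.1.2.
- by move=> n; exact: F_bsupp.
- by move=> n y yr; rewrite (le_trans (bF n x y))// ler_wpM2r// bu.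
- apply: aeW => y; apply: cvgM; first exact: cvg_cst.
  by apply: cvg_dquotN; exact: tm.1.1.
Qed.

End Bounds.

Lemma mollify_measurable (u : V -> R) : continuous u -> (forall x, 0 <= u x) ->
  measurable_fun [set: B] (mollify u : B -> R).
Proof.
move=> cu u0; pose f (p : B * B) : \bar R := (u p.2 * moll p.1 p.2)%:E.
have mf : measurable_fun setT f.
  apply/measurable_EFinP; apply: measurable_funM; last exact: moll_measurable.
  by apply: (@measurableT_comp _ _ _ _ _ _ (u : B -> R)) => //; exact: continuous_measurableRd.
have f0 p : (0 <= f p)%E by rewrite lee_fin mulr_ge0// moll_ge0.
have := @measurable_fun_fubini_tonelli_F _ _ B B R (lebesgue_sf hmu) f mf f0.
by move=> mF; apply: (measurableT_comp (fine_measurable measurableT) mF).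
Qed.

Lemma moll_le (x y : V) : moll x y <= (bumpcst mu e)^-1.
Proof.
rewrite -[leRHS]mulr1 ler_wpM2l ?invr_ge0 ?(ltW (bumpcst_gt0 hmu e0))//.
by have /andP[] := bump_01 e (sqd x y).
Qed.

Lemma integral_moll (y : V) : (\int[mu]_x (moll x y)%:E = 1)%E.
Proof.
under eq_integral do rewrite mollC.
have := int_moll hmu e0 y; rewrite /Rintegral => <-.
by rewrite fineK//; exact: integrable_fin_num (moll_integrable hmu e0 y).
Qed.

Section Energy.
Variable g : 'I_d -> V -> R.
Hypothesis lg : forall i, loc_integrable mu (g i).
Hypothesis mg : forall i, measurable_fun [set: B] (g i : B -> R).
Hypothesis gfin : (\int[mu]_x (sqgrad g x)%:E < +oo)%E.

Lemma sqgrad_measurable (h : 'I_d -> V -> R) :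
  (forall i, measurable_fun [set: B] (h i : B -> R)) ->
  measurable_fun [set: B] (sqgrad h : B -> R).
Proof. by move=> mh; apply: measurable_sum => i; exact: measurable_funX. Qed.

Lemma sqgrad_ge0 (h : 'I_d -> V -> R) (x : V) : 0 <= sqgrad h x.
Proof. by apply: sumr_ge0 => i _; exact: sqr_ge0. Qed.

Lemma sqgrad_integrable : mu.-integrable [set: B] (fun x => (sqgrad g x)%:E).
Proof.
apply/integrableP; split; first by apply/measurable_EFinP; exact: sqgrad_measurable.
by under eq_integral do rewrite abse_EFin ger0_norm ?sqgrad_ge0//.
Qed.

(** With [a] the mollified vector at [x], integrate [2 a . g - |a|^2 <= |g|^2] against the kernel of
    mass 1: the left side becomes [|a|^2]. *)
Lemma mollify_jensen (x : V) :
  ((sqgrad (fun i => mollify (g i)) x)%:E <= \int[mu]_y (sqgrad g y * moll x y)%:E)%E.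
Proof.
have mm := test_fun_measurable (moll_test mu e0 x).
have ig i : mu.-integrable [set: B] (fun y => (g i y * moll x y)%:E).
  apply: (loc_integrableM (M := (bumpcst mu e)^-1) (lg i) (mg i) mm (@moll_bsupp R d mu e e0 x)).
  by move=> y _; rewrite ger0_norm ?moll_ge0// moll_le.
have isq : mu.-integrable [set: B] (fun y => (sqgrad g y * moll x y)%:E).
  have := integrableZl measurableT (bumpcst mu e)^-1 sqgrad_integrable.
  apply: le_integrable => //.
    by apply/measurable_EFinP; apply: measurable_funM => //; exact: sqgrad_measurable.
  have nm y : `|moll x y| <= `|(bumpcst mu e)^-1|.
    rewrite (ger0_norm (moll_ge0 hmu e0 x y)).
    by rewrite ger0_norm ?invr_ge0 ?(ltW (bumpcst_gt0 hmu e0))// moll_le.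
  move=> y _; rewrite -EFinM !abse_EFin lee_fin [leLHS]normrM [leRHS]normrM mulrC.
  by rewrite ler_wpM2r.
pose a i := mollify (g i) x.
have i1 : mu.-integrable [set: B] (fun y => (\sum_(i < d) 2 * a i * (g i y * moll x y))%:E).
  by apply: integrable_bigsum => i; exact: (integrableZl measurableT (2 * a i) (ig i)).
have i2 : mu.-integrable [set: B] (fun y => (sqgrad (fun i => mollify (g i)) x * moll x y)%:E).
  exact: (integrableZl measurableT _ (moll_integrable hmu e0 x)).
rewrite -[leRHS]fineK; last exact: integrable_fin_num isq.
rewrite lee_fin.
have -> : sqgrad (fun i => mollify (g i)) x = (\int[mu]_y
   (\sum_(i < d) 2 * a i * (g i y * moll x y) - sqgrad (fun i => mollify (g i)) x * moll x y))%R.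
  rewrite RintegralB// RintegralZl ?int_moll ?mulr1//; last exact: moll_integrable.
  rewrite Rintegral_bigsum => [|i]; last exact: (integrableZl measurableT (2 * a i) (ig i)).
  apply/eqP; rewrite eq_sym subr_eq -mulr2n; apply/eqP.
  rewrite -[RHS]mulr_natl /sqgrad mulr_sumr; apply: eq_bigr => i _.
  rewrite RintegralZl//; last exact: ig.
  by rewrite -/(mollify (g i) x) /a; ring.
apply: le_Rintegral => [//|||y _]; [exact: (integrableB measurableT i1 i2)|exact: isq|].
rewrite /sqgrad !mulr_suml -sumrB; apply: ler_sum => i _.
have m0 := moll_ge0 hmu e0 x y; have := mulr_ge0 m0 (sqr_ge0 (g i y - a i)).
by rewrite /a; lra.
Qed.

(** The pointwise inequality, then Tonelli: by symmetry the kernel has mass 1 in its first variable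
    too. *)
Lemma mollify_energy :
  (forall i, measurable_fun [set: B] (mollify (g i) : B -> R)) ->
  (\int[mu]_x (sqgrad (fun i => mollify (g i)) x)%:E <= \int[mu]_x (sqgrad g x)%:E)%E.
Proof.
move=> mm; pose f (p : B * B) : \bar R := (sqgrad g p.2 * moll p.1 p.2)%:E.
have mf : measurable_fun setT f.
  apply/measurable_EFinP; apply: measurable_funM; last exact: moll_measurable.
  by apply: (@measurableT_comp _ _ _ _ _ _ (sqgrad g : B -> R)) => //; exact: sqgrad_measurable.
have f0 p : (0 <= f p)%E by rewrite lee_fin mulr_ge0 ?sqgrad_ge0// moll_ge0.
have mF := @measurable_fun_fubini_tonelli_F _ _ B B R (lebesgue_sf hmu) f mf f0.
apply: (@le_trans _ _ (\int[mu]_x \int[mu]_y f (x, y))%E).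
  apply: ge0_le_integral => //.
  - by move=> x _; rewrite lee_fin sqgrad_ge0.
  - by apply/measurable_EFinP; exact: sqgrad_measurable.
  - by move=> x _; exact: mollify_jensen.
rewrite (tonelliRd2 hmu mf f0); apply: ge0_le_integral => //.
- by move=> y _; apply: integral_ge0.
- exact: (@measurable_fun_fubini_tonelli_G _ _ B B R (lebesgue_sf hmu) f mf f0).
- by apply/measurable_EFinP; exact: sqgrad_measurable.
move=> y _; rewrite /f /=; under eq_integral do rewrite EFinM.
rewrite ge0_integralZl//; first by rewrite integral_moll mule1.
- apply/measurable_EFinP; under eq_fun do rewrite mollC.
  exact: test_fun_measurable (moll_test mu e0 y).
- by move=> x _; rewrite lee_fin moll_ge0.
- by rewrite lee_fin sqgrad_ge0.
Qed.

End Energy.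

End Mollify.

Section Trunc.
Variable R : realType.
Implicit Types M s t : R.

(** On [s >= 0] an increasing rational substitute for [min s M]. Its increments factor exactly
    through [dtrunc], which lies in [[0, 1]], so the quotients of a truncated function are
    controlled by those of the function. *)
Definition trunc M s := M * s / (M + `|s|).
Definition dtrunc M s t := M ^+ 2 / ((M + `|s|) * (M + `|t|)).

Lemma trunc_den_gt0 M s : 0 < M -> 0 < M + `|s|.
Proof. by move=> M0; rewrite ltr_pwDl. Qed.

Lemma trunc_ge0 M s : 0 < M -> 0 <= s -> 0 <= trunc M s.
Proof.
by move=> M0 s0; rewrite /trunc divr_ge0 ?(ltW (trunc_den_gt0 s M0))// mulr_ge0// ltW.
Qed.

Lemma trunc_le M s : 0 < M -> 0 <= s -> trunc M s <= M.
Proof.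
move=> M0 s0; rewrite /trunc ler_pdivrMr ?trunc_den_gt0// ger0_norm//.
by rewrite ler_pM2l// lerDr ltW.
Qed.

Lemma trunc_le_id M s : 0 < M -> 0 <= s -> trunc M s <= s.
Proof.
move=> M0 s0; rewrite /trunc ler_pdivrMr ?trunc_den_gt0// ger0_norm// mulrC.
by rewrite ler_wpM2l// lerDl.
Qed.

Lemma truncB M s t : 0 < M -> 0 <= s -> 0 <= t ->
  trunc M t - trunc M s = dtrunc M s t * (t - s).
Proof.
move=> M0 s0 t0; have := trunc_den_gt0 s M0; have := trunc_den_gt0 t M0.
rewrite /trunc /dtrunc !ger0_norm// => h1 h2; field.
by rewrite !gt_eqF.
Qed.

Lemma dtrunc_01 M s t : 0 < M -> 0 <= dtrunc M s t <= 1.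
Proof.
move=> M0; have h1 := trunc_den_gt0 s M0; have h2 := trunc_den_gt0 t M0.
rewrite /dtrunc divr_ge0 ?sqr_ge0 ?mulr_ge0 ?(ltW h1) ?(ltW h2)//=.
rewrite ler_pdivrMr ?mulr_gt0// mul1r expr2 ler_pM ?(ltW M0)//; by rewrite lerDl.
Qed.

Lemma trunc_homo M s t : 0 < M -> 0 <= s -> s <= t -> trunc M s <= trunc M t.
Proof.
move=> M0 s0 st; have t0 := le_trans s0 st; rewrite -subr_ge0 truncB//.
by rewrite mulr_ge0 ?subr_ge0//; have /andP[] := dtrunc_01 s t M0.
Qed.

Lemma trunc_continuous M : 0 < M -> continuous (trunc M).
Proof.
move=> M0 s; apply: cvgM; first by apply: cvgM; [exact: cvg_cst|exact: cvg_id].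
apply: cvgV; first by rewrite gt_eqF// trunc_den_gt0.
by apply: cvgD; [exact: cvg_cst|exact: norm_continuous].
Qed.

Lemma dtrunc_continuous_r M s : 0 < M -> continuous (dtrunc M s).
Proof.
move=> M0 t; apply: cvgM; first exact: cvg_cst.
apply: cvgV; first by rewrite gt_eqF// mulr_gt0 ?trunc_den_gt0.
apply: cvgM; first exact: cvg_cst.
by apply: cvgD; [exact: cvg_cst|exact: norm_continuous].
Qed.

Lemma dtrunc_continuous_diag M : 0 < M -> continuous (fun s => dtrunc M s s).
Proof.
move=> M0 t; apply: cvgM; first exact: cvg_cst.
apply: cvgV; first by rewrite gt_eqF// mulr_gt0 ?trunc_den_gt0.
by apply: cvgM; apply: cvgD; [exact: cvg_cst|exact: norm_continuous|
  exact: cvg_cst|exact: norm_continuous].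
Qed.

End Trunc.

(** * Lower bound for the capacity of balls *)

Section BallCapacity.
Variables (R : realType) (d : nat).
Local Notation V := 'rV[R]_d.
Local Notation B := (borelRd R d).
Variable mu : {measure set B -> \bar R}.
Hypothesis hmu : is_lebesgue_Rd mu.
Hypothesis d3 : (3 <= d)%N.
Variables (c : V) (r : R) (u : V -> R) (g : 'I_d -> V -> R).
Hypotheses (cu : continuous u) (u1 : forall x, \1_(cball c r) x <= u x).
Hypothesis ug : D1 mu u g.

Local Notation cst := (ballcst mu c).
Local Notation G := (fine (\int[mu]_x (sqgrad g x)%:E)).

Lemma u_ge0 (x : V) : 0 <= u x.
Proof. by apply: le_trans (u1 x); rewrite indicE. Qed.

Lemma u_ge1 (x : V) : 0 <= r -> sqd c x <= r ^+ 2 -> 1 <= u x.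
Proof.
move=> r0 xr; apply: le_trans (u1 x); rewrite indicE mem_set//.
by rewrite cball_sqd.
Qed.

Let lg i : loc_integrable mu (g i). Proof. by have [_ [? _] _ _ _] := ug. Qed.

Let mg i : measurable_fun [set: B] (g i : B -> R).
Proof. by have [_ _ ? _ _] := ug. Qed.

Let gfin : (\int[mu]_x (sqgrad g x)%:E < +oo)%E.
Proof. by have [_ _ _ ? _] := ug. Qed.

Let wg i phi : test_fun phi ->
  (\int[mu]_x (u x * partial i phi x) = - \int[mu]_x (g i x * phi x))%R.
Proof.
move=> tphi; have [_ [_ h] _ _ _] := ug.
by rewrite /Rintegral (h phi i tphi) fineN.
Qed.

Section Step.
Variables (e M : R).
Hypotheses (e0 : 0 < e) (M0 : 0 < M).
Local Notation ue := (mollify mu e u).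
Local Notation ge i := (mollify mu e (g i)).

Lemma ue_ge0 (x : V) : 0 <= ue x.
Proof.
apply: Rintegral_ge0 => y _.
by rewrite mulr_ge0 ?u_ge0// moll_ge0.
Qed.

Let cq i x : dquot i n ue x @[n --> \oo] --> ge i x.
Proof. by apply: cvg_dquot_mollify => // phi; exact: wg. Qed.

Let mue : measurable_fun [set: B] (ue : B -> R).
Proof. exact: (mollify_measurable hmu e0 cu u_ge0). Qed.

Let mge i : measurable_fun [set: B] (ge i : B -> R).
Proof.
apply: (@measurable_fun_cvg _ B R setT (fun n => dquot i n ue)) => [n|x _].
  exact: dquot_measurable.
exact: cq.
Qed.

Let bge i : locb (ge i).
Proof.
move=> s; have [K bK] := dquot_mollify_bounded hmu e0 i cu s.
exists K => x xs.
have c1 : `|dquot i n ue x| @[n --> \oo] --> `|ge i x| by apply: cvg_norm; exact: cq.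
have c2 : (fun _ : nat => K) n @[n --> \oo] --> K by exact: cvg_cst.
by apply: (ler_cvg_to c1 c2); apply: nearW => n; exact: bK.
Qed.

Let v (x : V) : R := trunc M (ue x).
Let Dv (i : 'I_d) (x : V) : R := dtrunc M (ue x) (ue x) * ge i x.

Let Dv_le i x : `|Dv i x| <= `|ge i x|.
Proof.
have /andP[h1 h2] := dtrunc_01 (ue x) (ue x) M0.
by rewrite normrM -[leRHS]mul1r ler_wpM2r// ger0_norm.
Qed.

Let dquot_v i n x : dquot i n v x =
  dtrunc M (ue x) (ue (x + n.+1%:R^-1 *: evec R i)) * dquot i n ue x.
Proof. by rewrite /dquot /v truncB ?ue_ge0//; ring. Qed.

Let mv : measurable_fun [set: B] (v : B -> R).
Proof.
apply: (@measurableT_comp _ _ _ _ _ _ (trunc M)) => //.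
by apply: continuous_measurable_fun; exact: trunc_continuous.
Qed.

Let bv : locb v.
Proof.
move=> s; exists M => x _; rewrite ger0_norm ?trunc_ge0 ?ue_ge0//.
by rewrite trunc_le// ue_ge0.
Qed.

Let mDv i : measurable_fun [set: B] (Dv i : B -> R).
Proof.
apply: measurable_funM => //.
apply: (@measurableT_comp _ _ _ _ _ _ (fun s => dtrunc M s s)) => //.
by apply: continuous_measurable_fun; exact: dtrunc_continuous_diag.
Qed.

Let bDv i : locb (Dv i).
Proof.
move=> s; have [K bK] := bge i s; exists K => x xs.
exact: le_trans (Dv_le i x) (bK x xs).
Qed.

Let ue_step i x : ue (x + n.+1%:R^-1 *: evec R i) @[n --> \oo] --> ue x.
Proof.
rewrite (_ : (fun n : nat => _) = fun n : nat => n.+1%:R^-1 * dquot i n ue x + ue x).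
  rewrite -[X in _ --> X]add0r -(mul0r (ge i x)); apply: cvgD; last exact: cvg_cst.
  by apply: cvgM; [exact: cvg_harmonic|exact: cq].
by apply/funext => n; rewrite /dquot mulKf ?pnatr_eq0// subrK.
Qed.

Let wv i phi : test_fun phi ->
  (\int[mu]_x (v x * partial i phi x) = - \int[mu]_x (Dv i x * phi x))%R.
Proof.
apply: ibp_dquot => //.
- move=> s; have [K bK] := dquot_mollify_bounded hmu e0 i cu s.
  exists K => x n xs; rewrite dquot_v normrM (le_trans _ (bK x n xs))//.
  rewrite -[leRHS]mul1r ler_wpM2r//.
  have /andP[h1 h2] := dtrunc_01 (ue x) (ue (x + n.+1%:R^-1 *: evec R i)) M0.
  by rewrite ger0_norm.
- apply: aeW => x.
  rewrite (_ : (fun n : nat => _) = fun n =>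
    dtrunc M (ue x) (ue (x + n.+1%:R^-1 *: evec R i)) * dquot i n ue x); last first.
    by apply/funext => n; rewrite dquot_v.
  apply: cvgM; last exact: cq.
  exact: (continuous_cvg _ (@dtrunc_continuous_r _ M (ue x) M0 (ue x)) (@ue_step i x)).
Qed.

(** The truncated mollification [v] is tested with a shell field, whose divergence is one density
    inside the ball, where [v >= trunc M 1], minus one far out. Young's inequality with weight [lam]
    splits the cross term; [shell_energy] bounds the field and [mollify_energy] the gradient. The
    mollification radius [eps] has to fit between [beta] and [r], so that averages centred in the
    ball of radius [beta] see only values at least 1. *)
Lemma cap_step (a b beta eps A A' lam : R) : 0 <= beta -> 0 <= eps -> beta + eps <= r ->
  b = beta ^+ 2 -> e = eps ^+ 2 -> 0 < a -> a < b -> b <= A -> A < A' -> 0 < lam ->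
  2 * (trunc M 1 * cst) <=
  2 * (\int[mu]_x (v x * rho d A A' (sqd c x)))%R +
  (lam * (cst * (a `^ (1 - d%:R / 2) / (d%:R - 2))) + lam^-1 * G).
Proof.
move=> be0 ep0 ber Eb Ee a0 ab bA AA' lam0.
have A0 : 0 < A by lra.
have r0 : 0 <= r by lra.
have tX := shell_test c a0 ab A0 AA'; have dX := div_shell c a0 ab A0 AA'.
have := ibp_field hmu mv bv mDv bDv wv tX.
under eq_Rintegral do rewrite dX mulrBr.
have ir (a1 b1 : R) : 0 < a1 -> a1 < b1 ->
    mu.-integrable [set: B] (fun x => (v x * rho d a1 b1 (sqd c x))%:E).
  move=> a10 ab1; have sr := @rho_bsupp _ d c a1 b1 ab1.
  apply: (locb_bsupp_integrable hmu _ (bsuppMr v sr)).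
    apply: measurable_funM => //.
    by apply: continuous_measurableRd; exact: rho_continuous.
  by apply: locbM => //; apply: continuous_locb; exact: rho_continuous.
rewrite RintegralB//; [|exact: ir|exact: ir].
move=> E.
pose X := rfield c (shell d a b A A').
have cX i : continuous (X i) := test_fun_continuous (tX i).
have bX i : bsupp (`|c| + (1 + Num.max b A')) (X i).
  by apply: bsuppMr; apply: radial_bsupp => q; exact: shell_hi.
have i1 : mu.-integrable [set: B] (fun x => (\sum_(i < d) X i x ^+ 2)%:E).
  apply: integrable_bigsum => i; apply: continuous_bsupp_integrable hmu _ _ _ (bsuppMr _ (bX i)).
  by move=> x; apply: (@continuousM _ _ _ _ x); exact: cX.
have enl : (\int[mu]_x (sqgrad (fun i => ge i) x)%:E <= \int[mu]_x (sqgrad g x)%:E)%E.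
  exact: mollify_energy.
have i2 : mu.-integrable [set: B] (fun x => (sqgrad (fun i => ge i) x)%:E).
  apply/integrableP; split.
    by apply/measurable_EFinP; exact: sqgrad_measurable.
  under eq_integral do rewrite abse_EFin ger0_norm ?sqgrad_ge0//.
  exact: le_lt_trans gfin.
have i3 : mu.-integrable [set: B] (fun x => (\sum_(i < d) Dv i x * X i x)%:E).
  apply: integrable_bigsum => i.
  apply: (locb_bsupp_integrable hmu _ (bsuppMr (Dv i) (bX i))).
    by apply: measurable_funM => //; apply: continuous_measurableRd; exact: cX.
  by apply: locbM => //; apply: continuous_locb; exact: cX.
have le1 : trunc M 1 * cst <= (\int[mu]_x (v x * rho d a b (sqd c x)))%R.
  rewrite -(int_rho hmu c a0 ab) -RintegralZl//; last exact: rho_integrable.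
  apply: le_Rintegral => [//|||x _]; [|exact: ir|].
    exact: (integrableZl measurableT _ (rho_integrable hmu c a0 ab)).
  have [h|h] := leP b (sqd c x); first by rewrite rho_out ?mulr0//; right.
  rewrite ler_wpM2r ?rho_ge0// /v trunc_homo//.
  have : 1 <= ue x <= M + ue x.
    suff : 1 <= ue x by have := M0; lra.
    (* [mollify_bounds] asks for two-sided bounds; any local bound of [u] serves as the upper
       one. *)
    have [K _ bK] := continuous_supball_bounded (`|x| + (1 + e)) cu.
    suff /andP[]// : 1 <= ue x <= K by [].
    apply: (mollify_bounds hmu e0 cu) => y xy; apply/andP; split.
      apply: u_ge1 => //.
      apply: (@le_trans _ _ ((beta + eps) ^+ 2)); last by rewrite lerXn2r ?nnegrE ?addr_ge0.
      by apply: (@sqd_triangle _ _ c x y) => //; rewrite -?Eb -?Ee// ltW.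
    by apply: (le_trans (ler_norm _)); apply: bK; exact: sqd_bounded.
  by case/andP.
have le2 : - (2 * (\int[mu]_x (\sum_(i < d) Dv i x * X i x))%R) <=
    lam * (\int[mu]_x (\sum_(i < d) X i x ^+ 2))%R +
    lam^-1 * (\int[mu]_x (sqgrad (fun i => ge i) x))%R.
  rewrite -mulNr -!RintegralZl// -RintegralD//.
  - apply: le_Rintegral => [//|||x _].
    + exact: (integrableZl measurableT _ i3).
    + exact: (integrableD measurableT (integrableZl measurableT lam i1) (integrableZl measurableT lam^-1 i2)).
    rewrite /sqgrad !mulr_sumr -big_split /=; apply: ler_sum => i _.
    have h1 : Dv i x ^+ 2 <= ge i x ^+ 2.
      by rewrite -[leLHS]real_normK ?num_real// -[leRHS]real_normK ?num_real// lerXn2r ?nnegrE.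
    apply: (@le_trans _ _ (lam * X i x ^+ 2 + lam^-1 * Dv i x ^+ 2)); last first.
      by rewrite lerD2l ler_wpM2l// invr_ge0 ltW.
    have := mulr_ge0 (ltW lam0) (sqr_ge0 (X i x + lam^-1 * Dv i x)).
    rewrite (_ : lam * (X i x + lam^-1 * Dv i x) ^+ 2 =
      lam * X i x ^+ 2 + lam^-1 * Dv i x ^+ 2 + 2 * Dv i x * X i x); last first.
      by field; rewrite gt_eqF.
    lra.
  - exact: (integrableZl measurableT lam i1).
  - exact: (integrableZl measurableT lam^-1 i2).
have le3 := shell_energy hmu c d3 a0 ab bA AA'.
have le4 : (\int[mu]_x (sqgrad (fun i => ge i) x))%R <= G.
  rewrite /Rintegral fine_le//; first exact: integrable_fin_num i2.
  by rewrite ge0_fin_numE// integral_ge0// => x _; rewrite lee_fin sqgrad_ge0.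
have le5 : lam * (\int[mu]_x (\sum_(i < d) X i x ^+ 2))%R <=
    lam * (cst * (a `^ (1 - d%:R / 2) / (d%:R - 2))) by rewrite ler_pM2l.
have le6 : lam^-1 * (\int[mu]_x (sqgrad (fun i => ge i) x))%R <= lam^-1 * G.
  by rewrite ler_pM2l ?invr_gt0.
move: E; rewrite -/X; lra.
Qed.

End Step.

Lemma sqd_sup_le (x y : V) (t : R) : 0 <= t -> sqd x y <= t ^+ 2 -> `|y - x| <= t.
Proof.
move=> t0 h; rewrite [leLHS]/Num.norm /= mx_normrE; apply: bigmax_le => // -[j k] _ /=.
rewrite !mxE (ord1 j) -(@ler_pXn2r _ 2) ?nnegrE// real_normK ?num_real//.
by rewrite (le_trans _ h)// /sqd (bigD1 k)//= lerDl sumr_ge0// => i _; exact: sqr_ge0.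
Qed.

Lemma mollify_cvg (t : R) (x : V) : 0 < t ->
  mollify mu ((t / n.+1%:R) ^+ 2) u x @[n --> \oo] --> u x.
Proof.
move=> t0; apply/cvgrPdist_le => eta eta0.
have /cvgrPdist_le/(_ _ eta0)/nbhs_ballP[s /= s0 sE] := cu (x := x).
have ch : t / n.+1%:R @[n --> \oo] --> 0.
  by rewrite -(mulr0 t); apply: cvgM; [exact: cvg_cst|exact: cvg_harmonic].
near=> n.
have tn0 : 0 < t / n.+1%:R by rewrite divr_gt0.
have tn2 : 0 < (t / n.+1%:R) ^+ 2 by rewrite exprn_gt0.
rewrite ler_distlC.
apply: (mollify_bounds hmu tn2 cu) => y xy.
have : `|u x - u y| <= eta.
  apply: sE; rewrite -ball_normE /ball_ /= distrC.
  apply: (le_lt_trans (sqd_sup_le (ltW tn0) xy)).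
  near: n; exact: (cvgr_lt _ ch _ s0).
by rewrite ler_distlC => /andP[h1 h2]; apply/andP; split; lra.
Unshelve. all: by end_near. Qed.

(** The mollification radius tends to 0 at fixed [M]; the truncation supplies the dominating
    constant. *)
Lemma cap_limit_eps (M a beta A A' lam : R) : 0 < M -> 0 <= beta -> beta < r ->
  0 < a -> a < beta ^+ 2 -> beta ^+ 2 <= A -> A < A' -> 0 < lam ->
  2 * (trunc M 1 * cst) <=
  2 * (\int[mu]_x (trunc M (u x) * rho d A A' (sqd c x)))%R +
  (lam * (cst * (a `^ (1 - d%:R / 2) / (d%:R - 2))) + lam^-1 * G).
Proof.
move=> M0 be0 ber a0 ab bA AA' lam0.
have A0 : 0 < A by lra.
have t0 : 0 < r - beta by lra.
set K := lam * _ + _.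
pose e_ n := ((r - beta) / n.+1%:R) ^+ 2.
have tn0 n : 0 < (r - beta) / n.+1%:R by rewrite divr_gt0.
have e_0 n : 0 < e_ n by rewrite exprn_gt0.
have crho := @rho_continuous R d c A A' A0 AA'.
have srho := @rho_bsupp _ d c A A' AA'.
have [N N0 bN] := continuous_supball_bounded (`|c| + (1 + A')) crho.
have mtr (w : V -> R) : measurable_fun [set: B] (w : B -> R) ->
   measurable_fun [set: B] ((fun x => trunc M (w x) * rho d A A' (sqd c x)) : B -> R).
  move=> mw; apply: measurable_funM; last exact: continuous_measurableRd.
  apply: (@measurableT_comp _ _ _ _ _ _ (trunc M)) => //.
  by apply: continuous_measurable_fun; exact: trunc_continuous.
have c1 : (\int[mu]_x (trunc M (mollify mu (e_ n) u x) * rho d A A' (sqd c x)))%R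
    @[n --> \oo] --> (\int[mu]_x (trunc M (u x) * rho d A A' (sqd c x)))%R.
  apply: (bsupp_dominated hmu (M := M * N) (r := `|c| + (1 + A'))).
  - by move=> n; apply: mtr; exact: (mollify_measurable hmu (e_0 n) cu u_ge0).
  - by apply: mtr; exact: continuous_measurableRd.
  - by move=> n; exact: bsuppMr.
  - move=> n x xr; rewrite normrM ler_pM// ?bN//.
    by rewrite ger0_norm ?trunc_ge0 ?trunc_le ?ue_ge0.
  - apply: aeW => x; apply: cvgM; last exact: cvg_cst.
    have cm := @mollify_cvg (r - beta) x t0.
    exact: (continuous_cvg _ (@trunc_continuous _ M M0 (u x)) cm).
have c2 : 2 * (\int[mu]_x (trunc M (mollify mu (e_ n) u x) * rho d A A' (sqd c x)))%R + K
    @[n --> \oo] --> 2 * (\int[mu]_x (trunc M (u x) * rho d A A' (sqd c x)))%R + K.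
  by apply: cvgD; [apply: cvgM => //; exact: cvg_cst|exact: cvg_cst].
have c3 : (fun _ : nat => 2 * (trunc M 1 * cst)) n @[n --> \oo] --> 2 * (trunc M 1 * cst).
  exact: cvg_cst.
apply: (ler_cvg_to c3 c2); apply: nearW => n.
apply: (@cap_step (e_ n) M (e_0 n) M0 a (beta ^+ 2) beta ((r - beta) / n.+1%:R)) => //.
- exact: ltW.
- by rewrite -lerBrDl ler_pdivrMr// ler_peMr ?ler1n// ltW.
Qed.

(** The outer shell goes to infinity. Its density has constant mass but height at most [4 / A],
    while [trunc M u] is at most [delta] off a set of finite measure and at most [M] on it. This is
    where the decay at infinity in [D1] enters. *)
Lemma cap_limit_infty (M a beta lam : R) : 0 < M -> 0 <= beta -> beta < r ->
  0 < a -> a < beta ^+ 2 -> 0 < lam ->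
  2 * (trunc M 1 * cst) <=
  lam * (cst * (a `^ (1 - d%:R / 2) / (d%:R - 2))) + lam^-1 * G.
Proof.
move=> M0 be0 ber a0 ab lam0; set K := lam * _ + _.
apply/ler_addgt0Pr => eta eta0.
have cst0 := ballcst_ge0 mu c.
(* [delta] makes the part with small [u] cost at most [eta / 2], and the choice of [A] below does
   the same for the exceptional set. *)
pose delta : R := eta / (4 * (cst + 1)).
have de0 : 0 < delta by rewrite divr_gt0// mulr_gt0// ltr_wpDl.
have dec : 2 * delta * cst <= eta / 2.
  rewrite /delta (_ : 2 * _ * cst = eta / 2 * (cst / (cst + 1))); last first.
    by field; rewrite gt_eqF// ltr_wpDl.
  by rewrite -[leRHS]mulr1 ler_pM2l ?divr_gt0// ler_pdivrMr ?ltr_wpDl// mul1r lerDl.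
have fin : (mu [set x : V | (delta < `|u x|)%R] < +oo)%E by have [_ _ _ _ h] := ug; exact: h.
pose m := fine (mu [set x : V | (delta < `|u x|)%R]).
have m0 : 0 <= m by rewrite fine_ge0.
pose A : R := 1 + beta ^+ 2 + 16 * M * (m + 1) / eta.
have p1 : 0 < 16 * M * (m + 1) / eta by rewrite divr_gt0// !mulr_gt0// ltr_wpDl.
have bA : beta ^+ 2 <= A by rewrite /A; lra.
have A1 : 1 <= A by have := sqr_ge0 beta; rewrite /A; lra.
have A0 : 0 < A by lra.
have AA : A < 2 * A by lra.
have := cap_limit_eps M0 be0 ber a0 ab bA AA lam0; rewrite -/K => h.
apply: (le_trans h); rewrite addrC lerD2l.
have mu_ : measurable ([set x : V | (delta < `|u x|)%R] : set B).
  rewrite (_ : [set x | _] = u @^-1` `]delta, +oo[%classic); last first.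
    by apply/seteqP; split => x /=; rewrite in_itv /= andbT (ger0_norm (u_ge0 x)).
  have := @continuous_measurableRd R d setT _ cu measurableT _ (measurable_itv `]delta, +oo[).
  by rewrite setTI.
(* Between [A] and [2 A] the ramp has slope at most [2 / A], and the power is at most 1 because
   [q > A >= 1]. *)
have rhoA x : rho d A (2 * A) (sqd c x) <= 4 / A.
  have [h1|h1] := leP (sqd c x) A.
    by rewrite rho_out ?divr_ge0 ?(ltW A0)//; left.
  rewrite /rho -[leRHS]mulr1 ler_pM ?powR_ge0//.
  - by rewrite mulr_ge0// dramp_ge0.
  - have := dramp_le (sqd c x) AA; rewrite (_ : 2 * A - A = A); last by ring.
    by set D := dramp _ _ _ => hD; lra.
  - rewrite -[leRHS](powRr0 (sqd c x)) ler_powR//; first by lra.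
    rewrite subr_le0 ler_pdivlMr// mul1r ler_nat; exact: leq_trans d3.
have i1 : mu.-integrable [set: B] (fun x => (delta * rho d A (2 * A) (sqd c x))%:E).
  exact: (integrableZl measurableT delta (rho_integrable hmu c A0 AA)).
have i20 : mu.-integrable [set: B] (fun x => (\1_[set x : V | (delta < `|u x|)%R] x)%:E).
  apply/integrableP; split; first by apply/measurable_EFinP; exact: measurable_indic.
  under eq_integral do rewrite gee0_abs ?lee_fin//.
  by rewrite integral_indic// setIT.
have i2 := integrableZl measurableT (M * (4 / A)) i20.
have i3 : mu.-integrable [set: B] (fun x => (trunc M (u x) * rho d A (2 * A) (sqd c x))%:E).
  have sA := @rho_bsupp _ d c A (2 * A) AA.
  apply: (continuous_bsupp_integrable hmu _ (bsuppMr (fun x => trunc M (u x)) sA)).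
  move=> x; apply: (@continuousM _ _ _ _ x); last exact: rho_continuous.
  exact: (@continuous_comp _ _ _ u (trunc M) x (@cu x) (@trunc_continuous R M M0 (u x))).
have : (\int[mu]_x (trunc M (u x) * rho d A (2 * A) (sqd c x)) <=
   \int[mu]_x (delta * rho d A (2 * A) (sqd c x) +
      M * (4 / A) * \1_[set x : V | (delta < `|u x|)%R] x))%R.
  apply: le_Rintegral => [//|//||x _]; first exact: (integrableD measurableT i1 i2).
  have r0 := rho_ge0 d (sqd c x) AA; have u0 := u_ge0 x.
  rewrite indicE; case: (boolP (x \in _)) => [_|xn].
    rewrite mulr1; apply: (@le_trans _ _ (M * (4 / A))); last by rewrite lerDr mulr_ge0// ltW.
    by rewrite ler_pM ?trunc_ge0 ?trunc_le.
  rewrite mulr0 addr0 ler_wpM2r// (le_trans (trunc_le_id M0 u0))//.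
  move: xn; rewrite notin_setE /= => /negP; rewrite -leNgt ger0_norm//.
rewrite RintegralD// [X in _ <= X + _]RintegralZl//; last exact: rho_integrable.
rewrite int_rho// [X in _ <= _ + X]RintegralZl//.
have -> : (\int[mu]_x \1_[set x : V | (delta < `|u x|)%R] x)%R = m.
  by rewrite /Rintegral integral_indic// setIT.
have : 2 * (M * (4 / A) * m) <= eta / 2.
  rewrite (_ : 2 * _ = 8 * M * m / A); last by ring.
  rewrite ler_pdivrMr//.
  have -> : eta / 2 * A = eta / 2 * (1 + beta ^+ 2) + 8 * M * (m + 1).
    by rewrite /A; field; rewrite gt_eqF.
  have : 0 <= eta / 2 * (1 + beta ^+ 2) by rewrite mulr_ge0 ?addr_ge0 ?sqr_ge0// ltW// divr_gt0.
  by have := mulr_ge0 (ltW M0) m0; nra.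
lra.
Qed.

(** The weight [lam = w^-1] makes the field term equal to [cst]: then
    [2 trunc M 1 cst <= cst + w G], and [trunc M 1] tends to 1 as [M] grows. *)
Lemma cap_ball_pre (a : R) : 0 < a -> a < r ^+ 2 -> 0 < r ->
  cst * (d%:R - 2) <= a `^ (1 - d%:R / 2) * G.
Proof.
move=> a0 ar r0.
have d2 : 0 < d%:R - 2 :> R by rewrite subr_gt0 ltr_nat.
have cst0 := ballcst_ge0 mu c.
pose w : R := a `^ (1 - d%:R / 2) / (d%:R - 2).
have w0 : 0 < w by rewrite divr_gt0// powR_gt0.
suff H : cst <= w * G.
  have -> : a `^ (1 - d%:R / 2) * G = w * G * (d%:R - 2).
    by rewrite /w; field; rewrite gt_eqF.
  by rewrite ler_pM2r.
pose s := Num.sqrt a.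
have s0 : 0 < s by rewrite sqrtr_gt0.
have s2 : s ^+ 2 = a by rewrite sqr_sqrtr// ltW.
have sr : s < r by rewrite -(@ltr_pXn2r _ 2) ?nnegrE ?s2// ltW.
pose beta := (s + r) / 2.
have be0 : 0 <= beta by rewrite /beta; lra.
have ber : beta < r by rewrite /beta; lra.
have ab : a < beta ^+ 2 by rewrite -s2 ltrXn2r ?nnegrE// /beta; lra.
apply/ler_addgt0Pr => eta eta0.
pose M : R := 2 * (cst + 1) / eta.
have M0 : 0 < M by rewrite divr_gt0// mulr_gt0// ltr_wpDl.
have iw0 : 0 < w^-1 by rewrite invr_gt0.
have := cap_limit_infty M0 be0 ber a0 ab iw0; rewrite -/w invrK.
have -> : w^-1 * (cst * w) = cst by rewrite mulrCA mulVf ?mulr1// gt_eqF.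
have -> : trunc M 1 * cst = cst - cst / (M + 1).
  by rewrite /trunc normr1; field; rewrite gt_eqF// ltr_wpDl// ltW.
have : 2 * (cst / (M + 1)) <= eta.
  rewrite mulrA ler_pdivrMr; last by rewrite ltr_wpDl// ltW.
  have -> : eta * (M + 1) = 2 * (cst + 1) + eta by rewrite /M; field; rewrite gt_eqF.
  lra.
lra.
Qed.

Lemma cap_ball_ge : 0 < r -> cst * (d%:R - 2) * r ^+ d.-2 <= G.
Proof.
move=> r0; have G0 : 0 <= G.
  by apply: fine_ge0; apply: integral_ge0 => x _; rewrite lee_fin sqgrad_ge0.
pose t_ n : R := r * (1 - n.+1%:R^-1).
have ct : t_ n @[n --> \oo] --> r.
  rewrite -[X in _ --> X]mulr1; apply: cvgM; first exact: cvg_cst.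
  rewrite -[X in _ --> X]subr0; apply: cvgB; first exact: cvg_cst.
  exact: cvg_harmonic.
have c1 : cst * (d%:R - 2) * t_ n ^+ d.-2 @[n --> \oo] --> cst * (d%:R - 2) * r ^+ d.-2.
  apply: cvgM; first exact: cvg_cst.
  exact: (cvg_comp _ _ ct (@exprn_continuous R d.-2 r)).
have c2 : (fun _ : nat => G) n @[n --> \oo] --> G by exact: cvg_cst.
apply: (ler_cvg_to c1 c2); near=> n.
(* The first radius of the sequence is 0 and has to be skipped. *)
have n0 : (0 < n)%N by near: n; exact: nbhs_infty_gt.
have n1 : 0 < 1 - n.+1%:R^-1 :> R by rewrite subr_gt0 invf_lt1// ltr1n.
have t0 : 0 < t_ n by rewrite mulr_gt0.
have tr : t_ n < r by rewrite /t_ gtr_pMr// ltrBlDr ltrDl invr_gt0.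
have t2 : t_ n ^+ 2 < r ^+ 2 by rewrite ltrXn2r ?nnegrE// ltW.
have := cap_ball_pre (exprn_gt0 2 t0) t2 r0.
have E : (t_ n ^+ 2) `^ (1 - d%:R / 2) * t_ n ^+ d.-2 = 1.
  rewrite -[t_ n ^+ 2]powR_mulrn ?ltW// -[t_ n ^+ d.-2]powR_mulrn ?ltW// -powRrM -powRD; last first.
    by rewrite (gt_eqF t0) implybT.
  rewrite -[RHS](powRr0 (t_ n)); congr (_ `^ _).
  have -> : d%:R = d.-2%:R + 2 :> R.
    by rewrite -natrD addn2; congr (_%:R); move: d3; case: d => [|[|]].
  by field.
have := exprn_gt0 d.-2 t0 => td h.
by move: (ler_wpM2r (ltW td) h); rewrite -mulrA mulrAC E mul1r.
Unshelve. all: by end_near. Qed.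

End BallCapacity.

(** * Filled sets *)

Section Filled.
Variables (R : realType) (d : nat).
Local Notation V := 'rV[R]_d.
Implicit Types (K A : set V) (x y c : V).

Lemma affine_continuous c v : continuous (fun s : R => c + s *: v).
Proof.
move=> s; apply: (@cvgD _ V _ (nbhs s) _ (fun _ : R => c) (fun s : R => s *: v)).
  exact: cvg_cst.
exact: scalel_continuous.
Qed.

(** Stated over an arbitrary interval so as to serve both bounded segments and rays. *)
Lemma segment_component K x y c v (i : interval R) (s t : R) : s \in i -> t \in i ->
  c + s *: v = x -> c + t *: v = y ->
  (forall s, s \in i -> ~ K (c + s *: v)) -> connected_component (~` K) x y.
Proof.
move=> si ti sx ty nK.
pose f (s : R) := c + s *: v.
have cf : connected [set f s | s in [set` i]].
  apply: connected_continuous_connected.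
    by apply/connected_intervalP; exact: interval_is_interval.
  by apply: continuous_subspaceT; exact: affine_continuous.
apply: (connected_component_max _ _ cf).
- by exists s.
- by move=> _ [w wi <-]; exact: nK.
- by exists t.
Qed.

(** The ray is connected and leaves every bounded set, so the component of [x] is unbounded. *)
Lemma ray_UK K c x : x != c -> (forall s, 1 <= s -> ~ K (c + s *: (x - c))) -> UK K x.
Proof.
move=> xc nK.
have x1 : c + 1 *: (x - c) = x by rewrite scale1r addrC subrK.
split; first by rewrite -x1; apply: nK.
move=> [M [_ /(_ (`|M| + 1))]].
rewrite (le_lt_trans (ler_norm M)) ?ltrDl// => /(_ isT) CM.
have n0 : 0 < `|x - c| by rewrite normr_gt0 subr_eq0.
(* Far enough out that the point with parameter [s] has norm greater than [|M| + 1], even after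
   subtracting [|c|]. *)
pose s := 1 + (`|M| + 1 + `|c| + 1) / `|x - c|.
have s1 : 1 <= s by rewrite lerDl divr_ge0// !addr_ge0.
have : connected_component (~` K) x (c + s *: (x - c)).
  apply: (@segment_component _ _ _ c (x - c) `[1, +oo[ 1 s) => //.
  - by rewrite in_itv /= lexx.
  - by rewrite in_itv /= s1.
  - by move=> w; rewrite in_itv /= andbT; exact: nK.
move=> /CM /=; apply/negP; rewrite -ltNge.
have sn : `|s *: (x - c)| = `|x - c| + (`|M| + 1 + `|c| + 1).
  rewrite normrZ ger0_norm ?(le_trans ler01)// /s mulrDl mul1r mulfVK// gt_eqF//.
have := ler_normB (c + s *: (x - c)) c; rewrite addrAC subrr add0r sn.
by have := normr_ge0 c; lra.
Qed.

Lemma Ktilde_sub K : K `<=` Ktilde K.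
Proof. by move=> x Kx [nK _]. Qed.

Lemma Ktilde_bounded K (M : R) : 0 <= M -> (forall x, K x -> `|x| <= M) ->
  forall x, Ktilde K x -> `|x| <= M.
Proof.
move=> M0 KM x; rewrite leNgt; apply: contra_notN => xM.
apply: (@ray_UK _ 0) => [|s s1 /KM].
  by apply/eqP => x0; move: xM; rewrite x0 normr0 ltNge M0.
rewrite add0r subr0 normrZ ger0_norm ?(le_trans ler01)// leNgt => /negP; apply.
by apply: (lt_le_trans xM); rewrite ler_peMl.
Qed.

(** The points of a ball around [x] that misses [K] are joined to [x] by segments, so they share its
    component. *)
Lemma UK_open K : closed K -> open (UK K).
Proof.
move=> cK; rewrite openE => x [nKx ub].
have oK : open (~` K) by rewrite openC.
have /nbhs_ballP[e /= e0 eK] : nbhs x (~` K) by apply: open_nbhs_nbhs.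
apply/nbhs_ballP; exists e => //= y xy; split; first exact: eK.
have [ee exy] : 0 < e /\ `|y - x| < e.
  by split=> //; move: xy; rewrite -ball_normE /ball_ /= distrC.
have cxy : connected_component (~` K) y x.
  apply: (@segment_component _ _ _ x (y - x) `[0, 1] 1 0).
  - by rewrite in_itv /= lexx ler01.
  - by rewrite in_itv /= lexx ler01.
  - by rewrite scale1r addrC subrK.
  - by rewrite scale0r addr0.
  move=> s; rewrite in_itv /= => /andP[s0 s1]; apply: eK.
  rewrite -ball_normE /ball_ /= opprD addrA subrr add0r normrN normrZ ger0_norm//.
  by apply: le_lt_trans exy; rewrite ler_piMl.
move=> yb; apply: ub.
suff sub : connected_component (~` K) x `<=` connected_component (~` K) y.
  move: yb => [M [Mr hM]]; exists M; split=> // N MN z /sub; exact: hM.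
by rewrite (same_connected_component cxy).
Qed.

Lemma Ktilde_compact K : compact K -> compact (Ktilde K).
Proof.
move=> cK; apply: bounded_closed_compact; last first.
  by apply: open_closedC; apply: UK_open; apply: compact_closed => //; exact: norm_hausdorff.
have [M [_ /(_ (`|M| + 1))]] := compact_bounded cK.
rewrite (le_lt_trans (ler_norm M)) ?ltrDl// => /(_ isT) CM.
exists (`|M| + 1); split; first exact: num_real.
move=> N MN x Kx /=; apply: (le_trans _ (ltW MN)).
by apply: (@Ktilde_bounded K) => //; rewrite addr_ge0.
Qed.

Lemma enormZ (a : R) x : enorm (a *: x) = `|a| * enorm x.
Proof.
rewrite /enorm -sqrtr_sqr -sqrtrM ?sqr_ge0//; congr Num.sqrt.
by rewrite mulr_sumr; apply: eq_bigr => i _; rewrite mxE exprMn.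
Qed.

Lemma Ktilde_cball c (r : R) : 0 <= r -> Ktilde (cball c r) = cball c r.
Proof.
move=> r0; apply/seteqP; split; last exact: Ktilde_sub.
move=> x; rewrite /cball /= leNgt; apply: contra_notN => xr.
have xc : x != c.
  apply/eqP => xc; move: xr; rewrite xc subrr ltNge.
  have -> : enorm (0 : V) = 0 by rewrite -(scale0r c) enormZ normr0 mul0r.
  by rewrite r0.
apply: (ray_UK xc) => s s1; rewrite /cball /= addrAC subrr add0r enormZ.
rewrite ger0_norm ?(le_trans ler01)// leNgt => /negP; apply.
by apply: (lt_le_trans xr); rewrite ler_peMl// enorm_ge0.
Qed.

Lemma parallel_cball c (r t : R) : 0 <= r -> 0 <= t -> parallel (cball c r) t = cball c (r + t).
Proof.
move=> r0 t0; apply/seteqP; split=> x; rewrite /parallel /cball /=.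
  move=> [y /= yr xy]; rewrite -[x](subrK y) -addrA (le_trans (enormD _ _))//.
  by rewrite [r + t]addrC lerD.
move=> xrt; have [xr|xr] := leP (enorm (x - c)) r.
  exists x => //=; rewrite subrr (_ : enorm 0 = 0)//.
  by rewrite -(scale0r c) enormZ normr0 mul0r.
have n0 : 0 < enorm (x - c) := le_lt_trans r0 xr.
exists (c + (r / enorm (x - c)) *: (x - c)) => /=.
  rewrite addrAC subrr add0r enormZ ger0_norm ?divr_ge0 ?(ltW n0)//.
  by rewrite mulfVK// gt_eqF.
rewrite opprD addrA -[X in X - _]scale1r -scalerBl enormZ ger0_norm; last first.
  by rewrite subr_ge0 ler_pdivrMr// mul1r ltW.
by rewrite mulrBl mul1r mulfVK ?gt_eqF// lerBlDr [t + r]addrC.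
Qed.

End Filled.

(** * The distance function and its gradient *)

Section Distance.
Variables (R : realType) (d : nat).
Local Notation V := 'rV[R]_d.
Local Notation B := (borelRd R d).
Variable A : set V.
Hypotheses (A0 : A !=set0) (cA : compact A).

Lemma coord_le (x : V) (i : 'I_d) : `|x ord0 i| <= `|x|.
Proof.
rewrite [leRHS]/Num.norm /= mx_normrE.
exact: (le_bigmax 0 (fun j : 'I_1 * 'I_d => `|x j.1 j.2|) (ord0, i)).
Qed.

Lemma enorm_sup (x : V) : `|x| <= enorm x.
Proof.
have := @sqd_sup_le R d 0 x (enorm x) (enorm_ge0 x); rewrite subr0; apply.
by rewrite -enorm_le ?enorm_ge0// subr0.
Qed.

Lemma enorm_le_sup (x : V) : enorm x <= d%:R * `|x|.
Proof.
rewrite -[X in enorm X]subr0 enorm_le ?mulr_ge0// /sqd.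
apply: (@le_trans _ _ (\sum_(i < d) `|x| ^+ 2)).
  apply: ler_sum => i _; rewrite !mxE subr0 -[leLHS]real_normK ?num_real// lerXn2r ?nnegrE//.
  exact: coord_le.
rewrite sumr_const card_ord -[leLHS]mulr_natl exprMn ler_wpM2r ?sqr_ge0//.
by case: (d) => [|n]; rewrite ?expr0n// expr2 ler_peMl// ler1n.
Qed.

Lemma enorm_continuous (c : V) : continuous (fun x : V => enorm (x - c)).
Proof.
move=> x; rewrite (_ : (fun x : V => _) = fun x => Num.sqrt (sqd c x)); last first.
  by apply/funext => y; rewrite enorm_sqd.
apply: (@continuous_comp _ _ _ (sqd c) Num.sqrt); first exact: sqd_continuous.
exact: sqrt_continuous.
Qed.

Lemma nearest_exists (x : V) : exists y, A y /\ forall z, A z -> enorm (x - y) <= enorm (x - z).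
Proof.
have cf : {within A, continuous (fun y => enorm (y - x))}.
  by apply: continuous_subspaceT; exact: enorm_continuous.
have [y yA yP] := EVT_min_rV A0 cA cf.
exists y; split; first by move: yA; rewrite inE.
by move=> z zA; rewrite -enormN opprB -[leRHS]enormN opprB; apply: yP; rewrite inE.
Qed.

(** A selection: where several nearest points exist, nothing is known about which one it picks. *)
Definition nearest (x : V) : V := sval (cid (nearest_exists x)).
Definition dA (x : V) : R := enorm (x - nearest x).

Lemma nearest_in (x : V) : A (nearest x).
Proof. by rewrite /nearest; case: cid => y []. Qed.

Lemma dA_le (x z : V) : A z -> dA x <= enorm (x - z).
Proof. by rewrite /dA /nearest; case: cid => y [_ h] /=; exact: h. Qed.

Lemma dA_ge0 (x : V) : 0 <= dA x. Proof. exact: enorm_ge0. Qed.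

Lemma dA_lipschitz (x y : V) : `|dA x - dA y| <= enorm (x - y).
Proof.
have H (u v : V) : dA u - dA v <= enorm (u - v).
  rewrite lerBlDr (le_trans (dA_le u (nearest_in v)))//.
  by rewrite -[u - nearest v](subrKA v) enormD.
by rewrite ler_norml H andbT lerNl opprB -enormN opprB H.
Qed.

Lemma dA_in (x : V) : A x -> dA x = 0.
Proof.
move=> xA; apply/eqP; rewrite eq_le dA_ge0 andbT (le_trans (dA_le x xA))//.
by rewrite subrr -(scale0r x) enormZ normr0 mul0r.
Qed.

Lemma dA_continuous : continuous dA.
Proof.
move=> x; apply/(@cvgrPdist_le _ _ _ (nbhs (x : V)) _ dA) => e e0.
have K0 : 0 < d%:R + 1 :> R by rewrite ltr_wpDl.
near=> y.
apply: (le_trans (dA_lipschitz x y)); apply: (le_trans (enorm_le_sup _)).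
apply: (@le_trans _ _ ((d%:R + 1) * `|x - y|)); first by rewrite ler_wpM2r// lerDl.
rewrite -ler_pdivlMl//; near: y.
by apply: cvgr_dist_le; [exact: cvg_id|rewrite mulr_gt0 ?invr_gt0].
Unshelve. all: by end_near. Qed.

Lemma dA_measurable : measurable_fun [set: B] (dA : B -> R).
Proof. by apply: continuous_measurableRd; exact: dA_continuous. Qed.

Lemma parallel_dA (t : R) : parallel A t = [set x | dA x <= t].
Proof.
apply/seteqP; split=> x /=; first by move=> [y yA]; exact: le_trans (dA_le x yA).
by move=> xt; exists (nearest x) => //; exact: nearest_in.
Qed.

Lemma dA_bounded : exists2 M, 0 <= M & forall x, `|x| <= M + dA x.
Proof.
have [M [_ /(_ (`|M| + 1))]] := compact_bounded cA.
rewrite (le_lt_trans (ler_norm M)) ?ltrDl// => /(_ isT) CM.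
exists (`|M| + 1); first by rewrite addr_ge0.
move=> x; rewrite -[x in `|x|](subrK (nearest x)) addrC (le_trans (ler_normD _ _))//.
by rewrite lerD ?enorm_sup//; apply: CM; exact: nearest_in.
Qed.

Lemma enorm_evec (i : 'I_d) (h : R) : enorm (h *: evec R i) = `|h|.
Proof.
rewrite enormZ (_ : enorm _ = 1) ?mulr1// /enorm (bigD1 i)//= big1.
  by rewrite /evec mxE !eqxx /= expr1n addr0 sqrtr1.
by move=> j ji; rewrite /evec mxE (negbTE ji) andbF expr0n.
Qed.

Lemma dquot_dA_le1 (i : 'I_d) (n : nat) (x : V) : `|dquot i n dA x| <= 1.
Proof.
rewrite /dquot normrM ger0_norm// mulrC -ler_pdivlMr// mul1r.
rewrite (le_trans (dA_lipschitz _ _))// addrAC subrr add0r enorm_evec.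
by rewrite ger0_norm// invr_ge0.
Qed.

Definition near_pt (x y : V) : Prop := A y /\ enorm (x - y) = dA x.

Definition good (x : V) : Prop := forall y z, near_pt x y -> near_pt x z -> y = z.

Lemma nearest_near_pt (x : V) : near_pt x (nearest x).
Proof. by split=> //; exact: nearest_in. Qed.

Lemma dA_sqr (x y : V) : near_pt x y -> dA x ^+ 2 = sqd y x.
Proof. by move=> [_ <-]; rewrite enorm_sqr; apply: eq_bigr => i _; rewrite !mxE. Qed.

Lemma dA_sqr_le (x y : V) : A y -> dA x ^+ 2 <= sqd y x.
Proof.
move=> yA; rewrite -[sqd y x](_ : enorm (x - y) ^+ 2 = _).
  by rewrite lerXn2r ?nnegrE ?enorm_ge0 ?dA_ge0// dA_le.
by rewrite enorm_sqr; apply: eq_bigr => i _; rewrite !mxE.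
Qed.

End Distance.

(** * Almost everywhere uniqueness of the nearest point *)

Section NearestAE.
Variables (R : realType) (d : nat).
Local Notation V := 'rV[R]_d.
Local Notation B := (borelRd R d).
Variable A : set V.
Hypotheses (A0 : A !=set0) (cA : compact A).
Local Notation dA := (dA A0 cA).
Local Notation p := (fun x : V => dA x ^+ 2).
Local Notation step n := (n.+1%:R^-1 : R).

Lemma sqd_evec (y x : V) (i : 'I_d) (h : R) :
  sqd y (x + h *: evec R i) = sqd y x + 2 * h * (x ord0 i - y ord0 i) + h ^+ 2.
Proof.
rewrite /sqd (bigD1 i)//= [in RHS](bigD1 i)//= !mxE !eqxx mulr1.
rewrite (eq_bigr (fun j => (x ord0 j - y ord0 j) ^+ 2)); first by ring.
by move=> j ji; rewrite !mxE (negbTE ji) andbF mulr0 addr0.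
Qed.

Lemma dA_sqr_dquot (i : 'I_d) (n : nat) (x : V) : `|dquot i n p x| <= 2 * dA x + 1.
Proof.
have := dquot_dA_le1 A0 cA i n x.
rewrite /dquot; set a := dA (x + _) => ab.
have a0 : 0 <= a := dA_ge0 _ _ _.
have b0 : 0 <= dA x := dA_ge0 _ _ _.
have aB : a <= dA x + 1.
  have : a - dA x <= `|n.+1%:R * (a - dA x)|.
    apply: le_trans (ler_norm _) _; rewrite normrM ger0_norm// ler_peMl//.
    by rewrite ler1n.
  lra.
rewrite subr_sqr mulrA normrM [X in _ * X]ger0_norm ?addr_ge0//.
apply: (@le_trans _ _ (1 * (a + dA x))); first by rewrite ler_wpM2r ?addr_ge0.
lra.
Qed.

(** Backward and forward quotients of the squared distance, corrected by the amount [step n] that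
    the square of the increment produces. For every nearest point [y], the value [2 (x - y)_i] lies
    between them. *)
Definition quotL (i : 'I_d) (n : nat) (x : V) : R :=
  dquot i n p (x - step n *: evec R i) + step n.
Definition quotR (i : 'I_d) (n : nat) (x : V) : R := dquot i n p x - step n.

Lemma stepK (n : nat) : n.+1%:R * step n = 1.
Proof. by rewrite divff. Qed.

(** A nearest point of [x] still bounds the distance at the shifted point, and [|x + h e_i - y|^2]
    expands exactly. *)
Lemma quotR_le (i : 'I_d) (n : nat) (x y : V) : near_pt A0 cA x y ->
  quotR i n x <= 2 * (x ord0 i - y ord0 i).
Proof.
move=> nxy; have := dA_sqr_le A0 cA (x + step n *: evec R i) nxy.1.
rewrite sqd_evec -(dA_sqr nxy) /quotR /dquot => h.
rewrite lerBlDr; apply: (@le_trans _ _ (n.+1%:R * (2 * step n * (x ord0 i - y ord0 i) + step n ^+ 2))).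
  by rewrite ler_wpM2l// lerBlDl addrA.
have := stepK n; set u := n.+1%:R; set v := u^-1 => uv.
rewrite le_eqVlt; apply/orP; left; apply/eqP; transitivity (u * v * (2 * (x ord0 i - y ord0 i) + v)); first by ring.
by rewrite uv mul1r.
Qed.

Lemma quotL_ge (i : 'I_d) (n : nat) (x y : V) : near_pt A0 cA x y ->
  2 * (x ord0 i - y ord0 i) <= quotL i n x.
Proof.
move=> nxy; have := dA_sqr_le A0 cA (x - step n *: evec R i) nxy.1.
rewrite -scaleNr sqd_evec -(dA_sqr nxy) /quotL /dquot scaleNr subrK => h.
rewrite -lerBlDr; apply: (@le_trans _ _ (n.+1%:R * (2 * step n * (x ord0 i - y ord0 i) - step n ^+ 2))).
  have := stepK n; set u := n.+1%:R; set v := u^-1 => uv.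
  rewrite le_eqVlt; apply/orP; left; apply/eqP; transitivity (u * v * (2 * (x ord0 i - y ord0 i) - v)); last by ring.
  by rewrite uv mul1r.
rewrite ler_wpM2l// lerBrDl addrC -lerBrDl; apply: le_trans h _.
by rewrite le_eqVlt; apply/orP; left; apply/eqP; ring.
Qed.

Variable mu : {measure set B -> \bar R}.
Hypothesis hmu : is_lebesgue_Rd mu.

Lemma dA_sqr_measurable : measurable_fun [set: B] (p : B -> R).
Proof.
have := measurable_funM (dA_measurable A0 cA) (dA_measurable A0 cA).
by apply: eq_measurable_fun => x _; rewrite expr2.
Qed.

Lemma quotR_measurable (i : 'I_d) (n : nat) : measurable_fun [set: B] (quotR i n : B -> R).
Proof. by apply: measurable_funB => //; apply: dquot_measurable; exact: dA_sqr_measurable. Qed.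

Lemma quotL_measurable (i : 'I_d) (n : nat) : measurable_fun [set: B] (quotL i n : B -> R).
Proof.
apply: measurable_funD => //.
apply: (@measurable_comp _ _ _ B B _ setT) => //; last exact: translate_measurable.
by apply: dquot_measurable; exact: dA_sqr_measurable.
Qed.

Lemma step_le1 (n : nat) : 0 <= step n <= 1.
Proof. by rewrite invr_ge0 ler0n/= invf_le1// ler1n. Qed.

Lemma quotL_locb (i : 'I_d) (r : R) :
  exists2 M, 0 <= M & forall n x, `|x| <= r -> `|quotL i n x| <= M.
Proof.
have [M M0 bM] := continuous_supball_bounded (r + 1) (@dA_continuous _ _ _ A0 cA).
exists (2 * M + 2); first by lra.
move=> n x xr; rewrite /quotL (le_trans (ler_normD _ _))//.
have /andP[s0 s1] := step_le1 n.
have := dA_sqr_dquot i n (x - step n *: evec R i).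
have : dA (x - step n *: evec R i) <= M.
  apply: le_trans (ler_norm _) _; apply: bM.
  by rewrite (le_trans (ler_normB _ _))// lerD// norm_step.
rewrite [`|n.+1%:R^-1|]ger0_norm// => h1 h2; apply: le_trans (lerD h2 s1) _.
by rewrite -addrA lerD// ler_wpM2l.
Qed.

(* [quotL] is [quotR] shifted by one step, up to [2 step n]: the shift is moved onto [zeta]. *)
Lemma quot_gap_small (i : 'I_d) (zeta : V -> R) : test_fun zeta ->
  exists C : R, forall n,
    `|\int[mu]_x (zeta x * (quotL i n x - quotR i n x))%R| <= step n * C.
Proof.
move=> tz; have [r [K [r0 K0 sz bz]]] := test_fun_bounded tz.
have [Mz Mz0 hMz] := continuous_supball_bounded r (test_fun_continuous tz).
have [M M0 hM] := quotL_locb i (r + 1).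
have mz := test_fun_measurable tz.
have zM x : `|zeta x| <= Mz.
  by have [/hMz//|xr] := leP `|x| r; rewrite sz// normr0.
have sz' n : bsupp (r + 1) (fun x => zeta (x - step n *: evec R i)).
  move=> x xr; apply: sz; rewrite ltNge; apply/negP => xr'.
  move: xr; rewrite ltNge => /negP; apply.
  rewrite -[x](subrK (step n *: evec R i)) (le_trans (ler_normD _ _))//.
  by rewrite lerD// norm_step.
have mz' n : measurable_fun [set: B] ((fun x => zeta (x - step n *: evec R i)) : B -> R).
  by apply: (@measurable_comp _ _ _ B B _ setT) => //; exact: translate_measurable.
pose G n x := (zeta x - zeta (x - step n *: evec R i)) * quotL i n x + 2 * step n * zeta x.
pose F n x := zeta (x - step n *: evec R i) * quotL i n x.
have mG n : measurable_fun [set: B] (G n : B -> R).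
  apply: measurable_funD; last exact: measurable_funM.
  by apply: measurable_funM; [exact: measurable_funB|exact: quotL_measurable].
have mF n : measurable_fun [set: B] (F n : B -> R).
  by apply: measurable_funM => //; exact: quotL_measurable.
have sG n : bsupp (r + 1) (G n).
  move=> x xr; rewrite /G sz' ?sz ?subrr ?mul0r ?mulr0 ?addr0//.
  by rewrite (le_lt_trans _ xr)// lerDl.
have bG n x : `|x| <= r + 1 -> `|G n x| <= step n * (K * M + 2 * Mz).
  move=> xr; have /andP[s0 s1] := step_le1 n.
  rewrite mulrDr; apply: le_trans (ler_normD _ _) _; apply: lerD.
    rewrite normrM mulrA ler_pM//; last exact: hM.
    rewrite -normrN opprB -scaleNr mulrC.
    have := @line_lipschitz _ _ zeta i K x (- step n) (tz.1.1 i) (fun t _ => bz i _).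
    by rewrite normrN (@ger0_norm _ n.+1%:R^-1).
  rewrite 2!normrM (@ger0_norm _ n.+1%:R^-1)// (@ger0_norm _ 2)//.
  by rewrite [leRHS]mulrA [n.+1%:R^-1 * 2]mulrC ler_wpM2l ?zM// mulr_ge0.
have sF n : bsupp (r + 1) (F n) by move=> x /sz' E; rewrite /F E mul0r.
have bF n x : `|x| <= r + 1 -> `|F n x| <= Mz * M.
  by move=> xr; rewrite normrM ler_pM//; exact: hM.
have mFs n : measurable_fun [set: B] ((fun x => F n (x + step n *: evec R i)) : B -> R).
  by apply: (@measurable_comp _ _ _ B B _ setT) => //; exact: translate_measurable.
have FsE n x : F n (x + step n *: evec R i) = zeta x * (quotR i n x + 2 * step n).
  by rewrite /F /quotL addrK /quotR; ring.
have iFs n : mu.-integrable [set: B] (fun x => (F n (x + step n *: evec R i))%:E).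
  apply: (bsupp_integrable hmu (M := Mz * M) (r := r)) => //.
    by move=> x xr; rewrite /F addrK sz// mul0r.
  move=> x xr; rewrite /F addrK normrM ler_pM//.
  by apply: hM; rewrite (le_trans (ler_normD _ _))// lerD// norm_step.
exists ((K * M + 2 * Mz) * fine (mu (supball (r + 1)))) => n.
rewrite (_ : (\int[mu]_x _)%R = (\int[mu]_x G n x)%R).
  by rewrite mulrA; apply: (bsupp_Rintegral_le hmu) => //; exact: bG.
have iG : mu.-integrable [set: B] (fun x => (G n x)%:E).
  exact: (bsupp_integrable hmu (mG n) (sG n) (@bG n)).
have iF : mu.-integrable [set: B] (fun x => (F n x)%:E).
  exact: (bsupp_integrable hmu (mF n) (sF n) (@bF n)).
rewrite -[RHS]addr0 -(subrr (\int[mu]_x F n x)%R).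
rewrite -[X in _ + (_ - X)](Rintegral_translate hmu (step n *: evec R i) (mF n)).
have iD : mu.-integrable [set: B] (fun x => (F n x - F n (x + step n *: evec R i))%:E).
  have := integrableB measurableT iF (iFs n).
  by apply: eq_integrable => // x _; rewrite EFinB.
rewrite -(RintegralB measurableT iF (iFs n)) -(RintegralD measurableT iG iD).
apply: eq_Rintegral => x _; rewrite FsE /F /G; ring.
Qed.

(** Two nearest points that differ in coordinate [i] keep the gap bounded below for all [n] at once,
    which puts [x] in one of these sets. *)
Definition gapset (i : 'I_d) (k r : nat) : set V :=
  [set x : V | `|x| <= r%:R /\ forall n, k.+1%:R^-1 <= quotL i n x - quotR i n x].

Lemma gapset_measurable (i : 'I_d) (k r : nat) : measurable (gapset i k r : set B).
Proof.
rewrite (_ : gapset i k r = supball r%:R `&`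
   \bigcap_n ((fun x => quotL i n x - quotR i n x) @^-1` `[k.+1%:R^-1, +oo[%classic)).
  apply: measurableI; first exact: supball_measurable.
  apply: bigcapT_measurable => n; rewrite -[X in measurable X]setTI.
  have mm : measurable_fun [set: B] ((fun x => quotL i n x - quotR i n x) : B -> R).
    by apply: measurable_funB; [exact: quotL_measurable|exact: quotR_measurable].
  by apply: mm => //; exact: measurable_itv.
apply/seteqP; split => x /=.
  by move=> [xr h]; split=> // n _ /=; rewrite in_itv/= h.
by move=> [xr h]; split=> // n; have := h n I; rewrite /= in_itv/= andbT.
Qed.

Lemma quot_gap_ge0 (i : 'I_d) (n : nat) (x : V) : 0 <= quotL i n x - quotR i n x.
Proof.
have xn := nearest_near_pt A0 cA x.
by rewrite subr_ge0 (le_trans (quotR_le i n xn))// quotL_ge.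
Qed.

(** Chebyshev: as [zeta] is 1 on the ball, the measure divided by [k + 1] is at most the integrated
    gap, which tends to 0. *)
Lemma gapset_null (i : 'I_d) (k r : nat) : mu (gapset i k r) = 0%E.
Proof.
(* [bump e] is 1 up to [e / 2], which exceeds [(d r)^2], a bound for the squared Euclidean norm on
   the sup-norm ball of radius [r]. *)
pose e : R := 2 * ((d%:R * r%:R) ^+ 2 + 1).
have e0 : 0 < e by rewrite mulr_gt0// ltr_wpDl// sqr_ge0.
pose zeta (x : V) : R := bump e (sqd 0 x).
have sz : bsupp (`|0 : V| + (1 + e)) zeta := @bump_bsupp R d e e0 0.
have tz : test_fun zeta := C1grad_test (@bump_C1grad R d e 0) sz.
have z01 x : 0 <= zeta x <= 1 := bump_01 e _.
have z1 x : `|x| <= r%:R -> zeta x = 1.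
  move=> xr; rewrite /zeta bump_lo// (@le_trans _ _ ((d%:R * r%:R) ^+ 2))//.
    rewrite -enorm_le ?mulr_ge0// subr0 (le_trans (enorm_le_sup x))//.
    by rewrite ler_wpM2l.
  by rewrite /e [leRHS]mulrC mulKf// lerDl.
have [C hC] := quot_gap_small i tz.
have mg n : measurable_fun [set: B] ((fun x => quotL i n x - quotR i n x) : B -> R).
  by apply: measurable_funB; [exact: quotL_measurable|exact: quotR_measurable].
have muN : (mu (gapset i k r) < +oo)%E.
  apply: le_lt_trans (supball_lty hmu r%:R); apply: le_measure; rewrite ?inE//.
  - exact: gapset_measurable.
  - exact: supball_measurable.
  - by move=> x [].
have bg n : locb (fun x => zeta x * (quotL i n x - quotR i n x)).
  apply: locbM; first exact: continuous_locb (test_fun_continuous tz).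
  move=> s; have [M M0 hM] := quotL_locb i s.
  have [K K0 hK] := continuous_supball_bounded s (@dA_continuous _ _ _ A0 cA).
  exists (M + (2 * K + 1 + 1)) => x xs.
  apply: le_trans (ler_normB _ _) _; apply: lerD; first exact: hM.
  apply: le_trans (ler_normB _ _) _; have /andP[s0 s1] := step_le1 n.
  apply: lerD; last by rewrite (ger0_norm s0).
  apply: le_trans (dA_sqr_dquot i n x) _; apply: lerD => //; apply: ler_wpM2l => //.
  by apply: le_trans (ler_norm _) _; exact: hK.
have iz n : mu.-integrable [set: B] (fun x => (zeta x * (quotL i n x - quotR i n x))%:E).
  apply: (locb_bsupp_integrable hmu (r := `|0 : V| + (1 + e))) => //.
    by apply: measurable_funM; [exact: test_fun_measurable tz|].
  by move=> x /sz ->; rewrite mul0r.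
have key n : k.+1%:R^-1 * fine (mu (gapset i k r)) <= step n * C.
  apply: le_trans (le_trans (ler_norm _) (hC n)).
  rewrite -lee_fin /Rintegral fineK; last exact: integrable_fin_num.
  rewrite EFinM fineK; last by rewrite ge0_fin_numE.
  rewrite -[X in mu X]setIT -integral_indic//; last exact: gapset_measurable.
  rewrite -ge0_integralZl_EFin//; last first.
    by apply: measurableT_comp => //; apply: measurable_indic; exact: gapset_measurable.
  apply: ge0_le_integral => //.
  - by apply: measurable_funeM; apply: measurableT_comp => //; apply: measurable_indic; exact: gapset_measurable.
  - by apply: measurableT_comp => //; apply: measurable_funM => //; exact: test_fun_measurable tz.
  move=> x _; rewrite -EFinM lee_fin indicE; case: (boolP (x \in gapset i k r)) => [|_].
    by rewrite inE => -[/z1 -> /(_ n)]; rewrite mulr1 mul1r.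
  by rewrite mulr0 mulr_ge0 ?quot_gap_ge0//; case/andP: (z01 x).
have le0 : k.+1%:R^-1 * fine (mu (gapset i k r)) <= 0.
  have c0 : (step n * C) @[n --> \oo] --> (0 : R).
    by rewrite -[X in _ --> X](mul0r C); apply: cvgMr_tmp; exact: cvg_harmonic.
  have c1 : ((fun _ : nat => k.+1%:R^-1 * fine (mu (gapset i k r))) n) @[n --> \oo]
      --> k.+1%:R^-1 * fine (mu (gapset i k r)) by exact: cvg_cst.
  by apply: (ler_cvg_to c1 c0); apply: nearW.
apply/eqP; rewrite eq_le measure_ge0 andbT -[mu _]fineK ?ge0_fin_numE// lee_fin.
by rewrite -(pmulr_rle0 _ (_ : 0 < k.+1%:R^-1))// invr_gt0.
Qed.

Lemma good_ae : {ae mu, forall x : B, good A0 cA x}.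
Proof.
(* Coordinates are indexed by natural numbers through [insub] to fit a countable union. *)
have H : mu.-negligible (\bigcup_j \bigcup_k (if (insub j : option 'I_d) is Some i
    then \bigcup_r gapset i k r else set0)).
  apply: negligible_bigcup => j; apply: negligible_bigcup => k.
  case: insub => [i|]; last exact: negligible_set0.
  apply: negligible_bigcup => r; exists (gapset i k r); split => //.
    exact: gapset_measurable.
  exact: gapset_null.
apply: negligibleS H => x /= /existsNP[y /existsNP[z /not_implyP[xy /not_implyP[xz yz]]]].
have [i hi] : exists i, y ord0 i != z ord0 i.
  apply: contrapT => /forallNP h; apply: yz; apply/rowP => i.
  by apply/eqP/negPn/negP; exact: h.
have gap n : `|y ord0 i - z ord0 i| <= quotL i n x - quotR i n x.
  have := quotL_ge i n xy; have := quotL_ge i n xz.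
  have := quotR_le i n xy; have := quotR_le i n xz.
  by rewrite ler_norml => *; apply/andP; split; lra.
have [k hk] : exists k, k.+1%:R^-1 <= `|y ord0 i - z ord0 i|.
  have a0 : 0 < `|y ord0 i - z ord0 i| by rewrite normr_gt0 subr_eq0.
  exists (Num.truncn (`|y ord0 i - z ord0 i|^-1)).
  by rewrite invf_ple ?posrE// ltW// truncnS_gt.
exists i => //; exists k => //; rewrite valK /=.
exists (Num.truncn `|x|).+1 => //; split; first by rewrite ltW// truncnS_gt.
by move=> n; exact: le_trans hk (gap n).
Qed.

End NearestAE.

(** * Derivative of the distance where the nearest point is unique *)

Section Derivative.
Variables (R : realType) (d : nat).
Local Notation V := 'rV[R]_d.
Local Notation B := (borelRd R d).
Variable A : set V.
Hypotheses (A0 : A !=set0) (cA : compact A).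
Local Notation dA := (dA A0 cA).
Local Notation p := (fun x : V => dA x ^+ 2).
Local Notation step n := (n.+1%:R^-1 : R).
Local Notation near_pt := (near_pt A0 cA).

(** Compactness: on the part of [A] at distance at least [e] from [y], the squared distance to [x]
    has a minimum, which exceeds [dA x ^+ 2] because [y] is the only nearest point; half the excess
    serves as [al]. *)
Lemma good_isolates (x y : V) (e : R) : good A0 cA x -> near_pt x y -> 0 < e ->
  exists2 al : R, 0 < al & forall z, A z -> sqd z x <= dA x ^+ 2 + al -> `|z - y| <= e.
Proof.
move=> gx nxy e0.
pose A' := A `&` [set z : V | e <= `|z - y|].
have cA' : compact A'.
  apply: compact_closedI => //.
  apply: (@preimage_closed V R (fun z : V => `|z - y|) [set t | e <= t]); last exact: closed_ge.
  move=> z _; apply: (@continuous_comp _ _ _ (fun z : V => z - y) (fun z : V => `|z|)); last exact: norm_continuous.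
  by apply: (@continuousD _ _ _ (fun z => z) (fun=> - y)); [exact: cvg_id|exact: cst_continuous].
have [A'0|/set0P A'0] := eqVneq A' set0.
  exists 1 => // z zA _; rewrite leNgt; apply/negP => ez.
  have : A' z by split => //=; exact: ltW.
  by rewrite A'0.
have cs : {within A', continuous (fun z : V => sqd x z)}.
  by apply: continuous_subspaceT; exact: sqd_continuous.
have [z0 + z0P] := EVT_min_rV A'0 cA' cs; rewrite inE => -[z0A /= ez0].
have lt0 : dA x ^+ 2 < sqd z0 x.
  rewrite lt_neqAle dA_sqr_le// andbT; apply/eqP => E.
  have nz0 : near_pt x z0.
    split=> //; apply/eqP; rewrite -(@eqrXn2 _ 2) ?enorm_ge0 ?dA_ge0// E enorm_sqr.
    by apply/eqP; apply: eq_bigr => i _; rewrite !mxE.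
  by move: ez0; rewrite (gx _ _ nz0 nxy) subrr normr0 leNgt e0.
exists ((sqd z0 x - dA x ^+ 2) / 2); first by rewrite divr_gt0// subr_gt0.
move=> z zA zx; rewrite leNgt; apply/negP => ez.
have : A' z by split => //=; exact: ltW.
move=> /mem_set/z0P; rewrite sqdC [leRHS]sqdC; lra.
Qed.

(** The upper bound comes from the nearest point [y] of [x], the lower one from a nearest point [yn]
    of [x + h e_i]. As [yn] is almost nearest to [x], [good_isolates] brings it close to [y]. *)
Lemma cvg_dquot_sqr (i : 'I_d) (x y : V) : good A0 cA x -> near_pt x y ->
  dquot i n p x @[n --> \oo] --> 2 * (x ord0 i - y ord0 i).
Proof.
move=> gx nxy; apply/cvgrPdist_le => e e0.
have e4 : 0 < e / 4 by rewrite divr_gt0.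
have [al al0 alP] := good_isolates gx nxy e4.
have ch : step n @[n --> \oo] --> (0 : R) by exact: cvg_harmonic.
have K0 : 0 < 4 * dA x + 4 by rewrite ltr_wpDl// mulr_ge0// dA_ge0.
near=> n.
have h1 : step n <= e / 4 by near: n; apply: cvgr_le ch _ _.
have h2 : step n * (4 * dA x + 4) <= al.
  by rewrite -ler_pdivlMr//; near: n; apply: cvgr_le ch _ _; rewrite divr_gt0.
have /andP[s0 s1] := step_le1 R n.
pose x' := x + step n *: evec R i.
have [yn nyn] : exists yn, near_pt x' yn by exists (nearest A0 cA x'); exact: nearest_near_pt.
have ynA := nyn.1.
have dx' : dA x' <= dA x + step n.
  have := le_trans (ler_norm _) (dA_lipschitz A0 cA x' x).
  by rewrite /x' addrAC subrr add0r enorm_evec ger0_norm// lerBlDl.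
have yny : `|yn - y| <= e / 4.
  (* [|x - yn| <= h + dA x' <= dA x + 2 h], whose square exceeds [dA x ^+ 2] by at most
     [h (4 dA x + 4)] for [h <= 1]. *)
  apply: alP => //; apply: (@le_trans _ _ ((dA x + 2 * step n) ^+ 2)).
    rewrite -enorm_le ?addr_ge0 ?dA_ge0 ?mulr_ge0//.
    rewrite -[x - yn](subrKA x') (le_trans (enormD _ _))// nyn.2.
    rewrite -enormN opprB /x' addrAC subrr add0r enorm_evec ger0_norm//.
    rewrite addrC (_ : 2 * step n = step n + step n); last by rewrite mulr2n mulrDl mul1r.
    by rewrite addrA lerD2r.
  rewrite (_ : (dA x + 2 * step n) ^+ 2 = dA x ^+ 2 + step n * (4 * dA x + 4 * step n)); last by ring.
  by rewrite lerD2l (le_trans _ h2)// ler_wpM2l// lerD2l ler_piMr.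
have up := quotR_le i n nxy.
have lo := quotL_ge i n nyn.
have yi : `|yn ord0 i - y ord0 i| <= e / 4.
  apply: le_trans yny; have -> : yn ord0 i - y ord0 i = (yn - y) ord0 i by rewrite !mxE.
  exact: coord_le.
move: up lo yi; rewrite /quotR /quotL /x' addrK !mxE !eqxx mulr1.
move: h1 s0 => {dx' yny h2 s1}; move: (n.+1%:R^-1 : R) (dquot _ _ _ _) => h D.
rewrite !ler_norml => h1 h0 up lo /andP[l1 l2]; apply/andP; split; lra.
Unshelve. all: by end_near. Qed.

Lemma cvg_dA_step (i : 'I_d) (x : V) : dA (x + step n *: evec R i) @[n --> \oo] --> dA x.
Proof.
apply/cvgrPdist_le => e e0; have ch : step n @[n --> \oo] --> (0 : R) by exact: cvg_harmonic.
near=> n; apply: le_trans (dA_lipschitz A0 cA _ _) _.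
rewrite opprD addrA subrr add0r enormN enorm_evec ger0_norm ?invr_ge0//.
by near: n; apply: cvgr_le ch _ _.
Unshelve. all: by end_near. Qed.

(** Divide the quotient of the square by the sum of the two distances, whose limit [2 dA x] is
    positive. *)
Lemma cvg_dquot_dA (i : 'I_d) (x : V) : good A0 cA x -> 0 < dA x ->
  dquot i n dA x @[n --> \oo] --> (x ord0 i - nearest A0 cA x ord0 i) / dA x.
Proof.
move=> gx d0; have nx := nearest_near_pt A0 cA x.
have c1 := @cvg_dquot_sqr i x _ gx nx.
have c2 : (dA (x + step n *: evec R i) + dA x)^-1 @[n --> \oo] --> (dA x + dA x)^-1.
  apply: cvgV; first by rewrite gt_eqF// addr_gt0.
  by apply: cvgD; [exact: cvg_dA_step|exact: cvg_cst].
have := cvgM c1 c2.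
rewrite (_ : 2 * _ * _ = (x ord0 i - nearest A0 cA x ord0 i) / dA x); last first.
  by rewrite -mulr2n -[dA x *+ 2]mulr_natl -mulf_div divff ?mul1r ?pnatr_eq0.
move=> /(_ eventually_filter); apply: cvg_trans; apply: near_eq_cvg; apply: nearW => n /=.
rewrite /dquot subr_sqr mulrA mulfK// gt_eqF// ltr_wpDl// dA_ge0.
Unshelve. all: by end_near. Qed.

End Derivative.
Section Gradient.
Variables (R : realType) (d : nat).
Local Notation V := 'rV[R]_d.
Local Notation B := (borelRd R d).
Variable A : set V.
Hypotheses (A0 : A !=set0) (cA : compact A).
Local Notation dA := (dA A0 cA).

(* The truncation only serves to have [|ddA| <= 1] at every point. *)
Definition ddA (i : 'I_d) (x : V) : R :=
  Num.max (-1) (Num.min 1 (limn_sup (fun n => dquot i n dA x : R^o))).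

Lemma indic_dA_measurable (a b : R) :
  measurable_fun [set: B] ((fun x => \1_(`]a, b[%classic) (dA x)) : B -> R).
Proof.
by apply: (measurableT_comp _ (dA_measurable A0 cA)); apply: measurable_indic; exact: measurable_itv.
Qed.

Lemma ddA_le1 (i : 'I_d) (x : V) : `|ddA i x| <= 1.
Proof.
rewrite /ddA ler_norml le_max lexx/= ge_max ge_min lexx/= andbT.
by rewrite (@le_trans _ _ 0)// oppr_le0.
Qed.

Lemma ddA_measurable (i : 'I_d) : measurable_fun [set: B] (ddA i : B -> R).
Proof.
have h n x := ler_normlP _ _ (dquot_dA_le1 A0 cA i n x).
apply: measurable_maxr => //; apply: measurable_minr => //.
apply: (@measurable_fun_limn_sup _ B R setT (fun n => dquot i n dA)).
- by move=> x _; exists 1 => _ [n _ <-]; have [] := h n x.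
- by move=> x _; exists (-1) => _ [n _ <-]; have [] := h n x; rewrite lerNl.
- by move=> n; apply: dquot_measurable; exact: dA_measurable.
Qed.

Lemma ddA_nearest (i : 'I_d) (x : V) : good A0 cA x -> 0 < dA x ->
  ddA i x = (x ord0 i - nearest A0 cA x ord0 i) / dA x.
Proof.
move=> gx d0; have c := cvg_dquot_dA (i := i) gx d0.
have : `|(x ord0 i - nearest A0 cA x ord0 i) / dA x| <= 1.
  rewrite normrM normfV [X in _ / X]gtr0_norm// ler_pdivrMr// mul1r /dA.
  rewrite -sqrtr_sqr /enorm ler_wsqrtr// (bigD1 i)//= !mxE lerDl.
  by apply: sumr_ge0 => j _; exact: sqr_ge0.
rewrite ler_norml => /andP[l1 l2].
rewrite /ddA cvg_limn_supE; last by apply/cvg_ex; exists ((x ord0 i - nearest A0 cA x ord0 i) / dA x).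
by rewrite (cvg_lim _ c)// min_r// max_r.
Qed.

Lemma cvg_ddA (i : 'I_d) (x : V) : good A0 cA x -> 0 < dA x ->
  dquot i n dA x @[n --> \oo] --> ddA i x.
Proof. by move=> gx d0; rewrite ddA_nearest//; exact: cvg_dquot_dA. Qed.

Lemma ddA_unit (x : V) : good A0 cA x -> 0 < dA x -> \sum_(i < d) ddA i x ^+ 2 = 1.
Proof.
move=> gx d0; rewrite (eq_bigr (fun i => (x - nearest A0 cA x) ord0 i ^+ 2 / dA x ^+ 2)).
  by rewrite -mulr_suml -enorm_sqr divff// expf_neq0// gt_eqF.
by move=> i _; rewrite ddA_nearest// !mxE expr_div_n.
Qed.

End Gradient.

Section Primitive.
Variable R : realType.
Local Notation leb := (@lebesgue_measure R).

Lemma dominated_Rintegral (dd : measure_display) (T : measurableType dd)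
  (nu : {measure set T -> \bar R}) (f_ : nat -> T -> R) (f g : T -> R) :
  (forall n, measurable_fun setT (f_ n)) -> measurable_fun setT f ->
  nu.-integrable setT (EFin \o g) -> (forall n x, `|f_ n x| <= g x) ->
  (forall x, f_ n x @[n --> \oo] --> f x) ->
  (\int[nu]_x f_ n x)%R @[n --> \oo] --> (\int[nu]_x f x)%R.
Proof.
move=> mf_ mf ig bf cf.
have h1 : forall n, measurable_fun setT (fun x => (f_ n x)%:E).
  by move=> n; exact/measurable_EFinP.
have h2 : measurable_fun setT (fun x => (f x)%:E) by exact/measurable_EFinP.
have h3 : {ae nu, forall x, setT x -> (f_ n x)%:E @[n --> \oo] --> (f x)%:E}.
  by apply: aeW => x _; exact: (cvg_comp _ _ (cf x)).
have h4 : {ae nu, forall x n, setT x -> (`|(f_ n x)%:E| <= (g x)%:E)%E}.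
  by apply: aeW => x n _; rewrite abse_EFin lee_fin.
have [fI _ cI] := dominated_convergence measurableT h1 h2 h3 ig h4.
apply: fine_cvg.
have fI' : ((\int[nu]_x (f x)%:E) \is a fin_num)%E by exact: integrable_fin_num.
by move: cI; rewrite -[X in _ --> X -> _]fineK.
Qed.

Lemma indic_itv_integrable (M a b : R) :
  leb.-integrable setT (EFin \o (fun t => M * \1_(`]a, b[%classic) t)).
Proof.
have i1 := integrable_indic_itv a b false true.
have := integrableZl measurableT M i1.
by apply: eq_integrable => // t _; rewrite /= EFinM.
Qed.

Lemma bounded_itv_integrable (M a b : R) (f : R -> R) : measurable_fun setT f ->
  (forall t, `|f t| <= M * \1_(`]a, b[%classic) t) -> leb.-integrable setT (EFin \o f).
Proof.
move=> mf bf; apply: (le_integrable measurableT _ _ (indic_itv_integrable M a b)).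
  exact/measurable_EFinP.
by move=> t _; rewrite /= lee_fin (le_trans (bf t))// ler_norm.
Qed.

Variables (a b M : R) (psi : R -> R).
Hypotheses (cpsi : continuous psi) (bpsi : forall t, `|psi t| <= M * \1_(`]a, b[%classic) t).

(** Integration over [t >= s] makes [tail psi (dA x)] the integral of [psi] over the levels whose
    sublevel set contains [x], a form to which Fubini applies. *)
Definition tail (s : R) : R := (\int[leb]_t (psi t * (s <= t :> R)%:R))%R.

Lemma tail_is_derive (s : R) : is_derive s (1:R) tail (- psi s).
Proof.
have mpsi : measurable_fun setT psi by exact: continuous_measurable_fun.
have ipsi := bounded_itv_integrable mpsi bpsi.
have tailE s' : tail s' = (\int[leb]_t psi t)%R - (\int[leb]_(t in `]-oo, s']) psi t)%R.
  rewrite -set_itvNyy Rintegral_itvB//=; last by rewrite set_itvNyy.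
  rewrite Rintegral_itv_obnd_cbnd; last by apply: integrableS ipsi.
  rewrite /tail [RHS]Rintegral_mkcond; apply: eq_Rintegral => t _.
  rewrite patchE; case: ifPn; rewrite ?inE ?notin_setE /= in_itv/= andbT; first by move=> ->; rewrite mulr1.
  by move=> /negP/negbTE ->; rewrite mulr0.
have [||||dF eF] := @continuous_FTC1 R psi -oo%O s (s + 1).
- by rewrite ltrDl.
- exact: integrableS ipsi.
- by rewrite ltNyr.
- exact: cpsi.
have -> : tail = (fun=> (\int[leb]_t psi t)%R) - (fun s' => (\int[leb]_(t in `]-oo, s']) psi t)%R).
  by apply/funext => s'; rewrite tailE.
rewrite -[- psi s]add0r; apply: is_deriveB.
by rewrite -eF derive1E; exact: DeriveDef.
Qed.

End Primitive.

Lemma ge_indic_measurable (R : realType) (s : R) :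
  measurable_fun setT (fun t : R => (s <= t :> R)%:R : R).
Proof.
rewrite (_ : (fun t => _) = fun t : R => if s <= t then 1 else 0); last first.
  by apply/funext => t; case: (_ <= _).
by apply: measurable_fun_ifT => //; apply: measurable_fun_ler.
Qed.

Section Chain.
Variable R : realType.

Lemma derive_lipschitz (F f : R -> R) (M : R) : (forall x : R, is_derive x (1:R) F (f x)) ->
  (forall x, `|f x| <= M) -> forall s t, `|F s - F t| <= M * `|s - t|.
Proof.
move=> dF bf s t; wlog st : s t / s < t.
  move=> W; have [/W//|ts|->] := ltgtP s t; last by rewrite !subrr normr0 mulr0.
  by rewrite distrC [`|s - t|]distrC W.
have [|c _ E] := @MVT R F f s t st (fun x _ => dF x).
  apply: continuous_subspaceT => x; apply: differentiable_continuous.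
  by apply/derivable1_diffP; exact: ex_derive.
by rewrite distrC E normrM [`|s - t|]distrC ler_wpM2r.
Qed.

(* [l] may fail to be the limit of [a]: at a zero of [f] it is enough that [a] is bounded. *)
Lemma chain_quot (F : R -> R) (f s : R) (sn a : nat -> R) (L M : R) :
  is_derive s (1:R) F f -> sn n @[n --> \oo] --> s ->
  (forall n, n.+1%:R * (sn n - s) = a n) -> (forall n, `|a n| <= M) ->
  f * a n @[n --> \oo] --> L ->
  n.+1%:R * (F (sn n) - F s) @[n --> \oo] --> L.
Proof.
move=> dF cs aE ba cL.
have M0 : 0 <= M := le_trans (normr_ge0 _) (ba 0).
pose q (u : R) : R := if u == s then 0 else (F u - F s) / (u - s) - f.
have qE n : n.+1%:R * (F (sn n) - F s) = q (sn n) * a n + f * a n.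
  rewrite /q -aE; case: eqVneq => [->|ne]; first by rewrite !subrr !mulr0 addr0.
  by rewrite mulrBl subrK mulrCA divfK// subr_eq0.
under eq_fun do rewrite qE.
rewrite -[L]add0r; apply: cvgD => //.
have cq : q (sn n) @[n --> \oo] --> (0 : R).
  have q0 : q u @[u --> s] --> (0 : R).
    have [ex eF] := dF; move/cvgrPdist_le: ex => ex.
    apply/cvgrPdist_le => e e0; have := ex e e0; rewrite /= -/('D_1 F s) eF => {}ex.
    have : \forall h \near (0:R), h != 0 -> `|f - h^-1 *: (F (h *: 1 + s) - F s)| <= e.
      by move: ex; rewrite /dnbhs near_withinE.
    rewrite (near_shift s 0) /=; apply: filterS => u /= hu.
    rewrite sub0r normrN /q; case: eqVneq => [_|ne]; first by rewrite normr0 ltW.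
    rewrite distrC; have := hu; rewrite sub0r subr_eq0 ne => /(_ isT).
    by rewrite /GRing.scale /= mulr1 subrK mulrC.
  exact: (cvg_comp _ _ cs q0).
apply/cvgrPdist_le => e e0.
have M1 : 0 < M + 1 by rewrite ltr_wpDl.
have eM : 0 < e / (M + 1) by rewrite divr_gt0.
move/cvgrPdist_le : cq => /(_ _ eM); apply: filterS => n; rewrite sub0r normrN => qn; rewrite sub0r normrN normrM.
apply: le_trans (ler_pM _ _ qn (ba n)) _ => //.
by rewrite mulrAC ler_pdivrMr// ler_wpM2l ?ltW// ltrDl.
Qed.

End Chain.

(** * Integration along the level sets *)

Section ProductFubini.
Variables (R : realType) (d : nat).
Local Notation V := 'rV[R]_d.
Local Notation B := (borelRd R d).
Local Notation leb := (@lebesgue_measure R).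
Variable mu : {measure set B -> \bar R}.
Hypothesis hmu : is_lebesgue_Rd mu.
Variables (a b r M : R) (f : B * R -> R).
Hypotheses (mf : measurable_fun setT f)
  (bf : forall x t, `|f (x, t)| <= M * \1_(supball r) x * \1_(`]a, b[%classic) t).

Lemma section1_measurable (x : B) : measurable_fun setT (fun t : R => f (x, t)).
Proof. exact: (measurableT_comp mf (pair1_measurable x)). Qed.

Lemma section2_measurable (t : R) : measurable_fun setT (fun x : B => f (x, t)).
Proof. exact: (measurableT_comp mf (pair2_measurable t)). Qed.

Lemma section1_integrable (x : B) : leb.-integrable setT (fun t => (f (x, t))%:E).
Proof. by apply: (bounded_itv_integrable (section1_measurable x)); exact: bf. Qed.

Lemma section2_integrable (t : R) : mu.-integrable setT (fun x => (f (x, t))%:E).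
Proof.
apply: (le_integrable measurableT _ _ (@integrable_ball_indic R d mu hmu (M * \1_(`]a, b[%classic) t) r)).
  by apply/measurable_EFinP; exact: section2_measurable.
by move=> x _; rewrite /= lee_fin mulrAC (le_trans (bf x t))// ler_norm.
Qed.

Lemma product_integrable : ((lebesgue_sf hmu) \x leb)%E.-integrable setT (EFin \o f).
Proof.
apply/integrable12ltyP; first exact/measurable_EFinP.
have M0 x t : 0 <= M * \1_(supball r) x * \1_(`]a, b[%classic) t := le_trans (normr_ge0 _) (bf x t).
pose L := (\int[leb]_t (\1_(`]a, b[%classic) t)%:E)%E.
have fL : (L \is a fin_num)%E by apply: integrable_fin_num => //; exact: (integrable_indic_itv a b false true).
apply: (@le_lt_trans _ _ (\int[mu]_x (fine L * M * \1_(supball r) x)%:E)%E).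
  apply: le_integral_nomeas => x _; first by apply: integral_ge0.
  rewrite -mulrA mulrC EFinM fineK// -integralZl//; last exact: (integrable_indic_itv a b false true).
  by apply: le_integral_nomeas => t _ //=; rewrite lee_fin bf.
have := integrable_ball_indic hmu (fine L * M) r.
by move/integrable_fin_num => /(_ measurableT); rewrite fin_numE => /andP[_]; rewrite -ltey.
Qed.

Lemma section2_int_measurable : measurable_fun setT (fun t : R => (\int[mu]_x f (x, t))%R).
Proof.
by apply: (measurableT_comp (@fine_measurable R setT measurableT));
  exact: (measurable_fubini_G product_integrable).
Qed.

Lemma Rintegral_swap :
  (\int[mu]_x (\int[leb]_t f (x, t))%R = \int[leb]_t (\int[mu]_x f (x, t)))%R.
Proof.
rewrite /Rintegral; congr fine.
transitivity (\int[mu]_x \int[leb]_t (f (x, t))%:E)%E.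
  by apply: eq_integral => x _; rewrite fineK//; apply: integrable_fin_num => //; exact: section1_integrable.
transitivity (\int[leb]_t \int[mu]_x (f (x, t))%:E)%E; first exact: (Fubini product_integrable).
by apply: eq_integral => t _; rewrite fineK//; apply: integrable_fin_num => //; exact: section2_integrable.
Qed.

End ProductFubini.

Section LevelSets.
Variables (R : realType) (d : nat).
Local Notation V := 'rV[R]_d.
Local Notation B := (borelRd R d).
Local Notation leb := (@lebesgue_measure R).
Variable mu : {measure set B -> \bar R}.
Hypothesis hmu : is_lebesgue_Rd mu.
Variable A : set V.
Hypotheses (A0 : A !=set0) (cA : compact A).
Local Notation dA := (dA A0 cA).
Local Notation ddA := (ddA A0 cA).
Variables (a b : R) (i : 'I_d) (phi : V -> R).
Hypotheses (a0 : 0 < a) (tphi : test_fun phi).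
Local Notation I := (`]a, b[%classic : set R).

Definition below (t : R) (x : V) : R := (dA x <= t :> R)%:R.

Lemma below_01 (t : R) (x : V) : 0 <= below t x <= 1.
Proof. by rewrite /below ler0n lern1 leq_b1. Qed.

Lemma sublevel_measurable : measurable_fun [set: B * R] (fun z : B * R => below z.2 z.1).
Proof.
rewrite (_ : (fun z => _) = fun z : B * R => if dA z.1 <= z.2 then 1 else 0); last first.
  by apply/funext => z; rewrite /below; case: (_ <= _).
apply: measurable_fun_ifT => //.
apply: measurable_fun_ler; first exact: measurableT_comp (dA_measurable A0 cA) measurable_fst.
exact: measurable_snd.
Qed.

Lemma below_measurable (t : R) : measurable_fun [set: B] (below t : B -> R).
Proof. exact: (measurableT_comp sublevel_measurable (pair2_measurable t)). Qed.

(** For the components of a field of length at most 1, these sum to at most the perimeter of the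
    sublevel set. *)
Definition flux (t : R) : R :=
  \1_I t * (\int[mu]_x (below t x * partial i phi x))%R.

Definition gradA_phi (x : V) : R := \1_I (dA x) * (ddA i x * phi x).

(** The coarea identity in divergence form, one component at a time. It is linear in [psi], which
    allows the passage from continuous functions to indicators of measurable sets. *)
Definition coarea (psi : R -> R) : Prop :=
  (\int[mu]_x (psi (dA x) * gradA_phi x) = \int[leb]_t (psi t * flux t))%R.

Let phi_data := test_fun_bounded tphi.

Lemma partial_phi_measurable : measurable_fun [set: B] (partial i phi : B -> R).
Proof. by apply: continuous_measurableRd; exact: tphi.1.2. Qed.

Lemma below_partial_integrable (t : R) :
  mu.-integrable setT (fun x : B => (below t x * partial i phi x)%:E).
Proof.
have [r [K [r0 K0 sphi bphi]]] := phi_data.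
apply: (bsupp_integrable hmu (M := K) (r := r)).
- by apply: measurable_funM; [exact: below_measurable|exact: partial_phi_measurable].
- by move=> x /(bsupp_partial i sphi) ->; rewrite mulr0.
move=> x _; have /andP[u0 u1] := below_01 t x.
by rewrite normrM ger0_norm// (le_trans _ (bphi i x))// ler_piMl.
Qed.

Lemma test_fun_sup (f : V -> R) : test_fun f ->
  exists r M : R, [/\ 0 <= r, 0 <= M, bsupp r f & forall x, `|f x| <= M].
Proof.
move=> tf; have [r [K [r0 K0 sf _]]] := test_fun_bounded tf.
have [M M0 hM] := continuous_supball_bounded r (test_fun_continuous tf).
exists r, M; split=> // x; have [/hM//|xr] := leP `|x| r.
by rewrite sf// normr0.
Qed.

Lemma gradA_phi_measurable : measurable_fun [set: B] (gradA_phi : B -> R).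
Proof.
apply: measurable_funM; last first.
  by apply: measurable_funM; [exact: ddA_measurable|exact: test_fun_measurable].
exact: indic_dA_measurable.
Qed.

Lemma gradA_phi_bounded : exists r M : R, [/\ 0 <= r, 0 <= M, bsupp r gradA_phi &
  forall x, `|gradA_phi x| <= M].
Proof.
have [r [K [r0 K0 sphi bphi]]] := test_fun_sup tphi.
exists r, K; split=> // [x /sphi E|x]; first by rewrite /gradA_phi E !mulr0.
rewrite /gradA_phi !normrM -[leRHS]mul1r ler_pM// ?mulr_ge0//.
  by rewrite ger0_norm// indicE lern1 leq_b1.
by rewrite -[leRHS]mul1r ler_pM// ddA_le1.
Qed.

Lemma gradA_integrable (psi : R -> R) (N : R) : measurable_fun setT psi ->
  (forall t, `|psi t| <= N) ->
  mu.-integrable setT (fun x : B => (psi (dA x) * gradA_phi x)%:E).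
Proof.
move=> mpsi bpsi; have [r [K [r0 K0 sg bg]]] := gradA_phi_bounded.
apply: (bsupp_integrable hmu (M := N * K) (r := r)).
- apply: measurable_funM; last exact: gradA_phi_measurable.
  exact: (measurableT_comp mpsi (dA_measurable A0 cA)).
- by move=> x /sg ->; rewrite mulr0.
by move=> x _; rewrite normrM ler_pM.
Qed.

Lemma flux_kernel (c t : R) :
  c * flux t = (\int[mu]_x (c * (\1_I t * (below t x * partial i phi x))))%R.
Proof.
rewrite /flux mulrA -RintegralZl//; last exact: below_partial_integrable.
by apply: eq_Rintegral => x _; rewrite !mulrA.
Qed.

Lemma kernel_bound (psi : R -> R) (N : R) : (forall t, `|psi t| <= N) ->
  exists r M : R, forall x t, `|psi t * (\1_I t * (below t x * partial i phi x))|
     <= M * \1_(supball r) x * \1_I t.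
Proof.
move=> bpsi; have [r [K [r0 K0 sphi bphi]]] := phi_data.
have N0 : 0 <= N := le_trans (normr_ge0 _) (bpsi 0).
exists r, (N * K) => x t; have /andP[u0 u1] := below_01 t x.
rewrite !normrM (@ger0_norm _ (\1_I t))// (@ger0_norm _ (below t x))// mulrCA.
rewrite [leRHS]mulrC ler_wpM2l// -mulrA ler_pM// ?mulr_ge0//.
apply: (@le_trans _ _ (`|partial i phi x|)); first by rewrite ler_piMl.
rewrite indicE; case: (leP `|x| r) => xr; first by rewrite mem_set// mulr1.
by rewrite memNset/= ?mulr0 ?(bsupp_partial i sphi)// ?normr0//; apply/negP; rewrite -ltNge.
Qed.

Lemma kernel_measurable (psi : R -> R) : measurable_fun setT psi ->
  measurable_fun [set: B * R] (fun z : B * R =>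
    psi z.2 * (\1_I z.2 * (below z.2 z.1 * partial i phi z.1))).
Proof.
move=> mpsi; apply: measurable_funM; first exact: measurableT_comp mpsi measurable_snd.
apply: measurable_funM.
  by apply: (measurableT_comp _ measurable_snd); apply: measurable_indic; exact: measurable_itv.
apply: measurable_funM; first exact: sublevel_measurable.
exact: measurableT_comp partial_phi_measurable measurable_fst.
Qed.

Let one_bound (t : R) : `|1| <= 1 :> R. Proof. by rewrite normr1. Qed.

Lemma flux_measurable : measurable_fun setT flux.
Proof.
have [r [M bM]] := @kernel_bound (fun=> 1) 1 one_bound.
have mc : measurable_fun setT (fun _ : R => 1 : R) by exact: measurable_cst.
have := section2_int_measurable hmu (kernel_measurable mc) bM.
by apply: eq_measurable_fun => t _; rewrite -flux_kernel mul1r.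
Qed.

Lemma flux_bounded : exists2 C : R, 0 <= C & forall t, `|flux t| <= C * \1_I t.
Proof.
have [r [K [r0 K0 sphi bphi]]] := phi_data.
exists (K * fine (mu (supball r))) => [|t].
  by rewrite mulr_ge0// fine_ge0.
rewrite /flux normrM mulrC [`|\1_I t|]ger0_norm// ler_wpM2r//.
apply: (bsupp_Rintegral_le hmu).
- by apply: measurable_funM; [exact: below_measurable|exact: partial_phi_measurable].
- by move=> x /(bsupp_partial i sphi) ->; rewrite mulr0.
move=> x _; have /andP[u0 u1] := below_01 t x.
by rewrite normrM ger0_norm// (le_trans _ (bphi i x))// ler_piMl.
Qed.

(** Fubini for [psi t] times the indicator of [dA x <= t]. It is stated for bounded measurable [psi]
    because it also computes the weak derivative of the competitor. *)
Lemma tail_flux (N : R) (psi : R -> R) : measurable_fun setT psi ->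
  (forall t, `|psi t| <= N) ->
  (\int[mu]_x (tail (fun t => psi t * \1_I t) (dA x) * partial i phi x) =
   \int[leb]_t (psi t * flux t))%R.
Proof.
move=> mpsi bpsi; have [r [M bM]] := @kernel_bound psi _ bpsi.
under [RHS]eq_Rintegral do rewrite flux_kernel.
rewrite -(Rintegral_swap hmu (kernel_measurable mpsi) bM) /=.
apply: eq_Rintegral => x _; rewrite /tail -RintegralZr//.
  by apply: eq_Rintegral => t _; rewrite /below; ring.
apply: (@bounded_itv_integrable R N a b).
  apply: measurable_funM; last exact: ge_indic_measurable.
  by apply: measurable_funM => //; apply: measurable_indic; exact: measurable_itv.
move=> t; rewrite -mulrA normrM ler_pM// normrM -[leRHS]mulr1.
by rewrite (@ger0_norm _ (\1_I t))// ler_wpM2l// ger0_norm// lern1 leq_b1.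
Qed.

(** Continuity of [psi] makes [tail psi] differentiable everywhere, so the quotients of
    [tail psi (dA x)] converge almost everywhere and [ibp_dquot] applies. *)
Lemma coarea_continuous (M : R) (psi : R -> R) : continuous psi ->
  (forall t, `|psi t| <= M * \1_I t) -> coarea psi.
Proof.
move=> cpsi bpsi.
have mpsi : measurable_fun setT psi by exact: continuous_measurable_fun.
have psiI t : psi t * \1_I t = psi t.
  move: (bpsi t); rewrite indicE; case: (t \in I); rewrite ?mulr1//.
  by rewrite mulr0 normr_le0 => /eqP ->; rewrite mul0r.
have bM t : `|psi t| <= `|M|.
  apply: (le_trans (bpsi t)); apply: (@le_trans _ _ (`|M| * \1_I t)).
    by rewrite ler_wpM2r// ler_norm.
  by rewrite ler_piMr// indicE lern1 leq_b1.
have dT := tail_is_derive cpsi bpsi.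
have lipT : forall s t, `|tail psi s - tail psi t| <= `|M| * `|s - t|.
  by apply: derive_lipschitz dT _ => x; rewrite normrN.
have cT : continuous (tail psi).
  by move=> s; apply: differentiable_continuous; apply/derivable1_diffP; exact: ex_derive.
pose w x := tail psi (dA x).
pose D x := - psi (dA x) * ddA i x.
have cw : continuous w.
  by move=> x; apply: (@continuous_comp _ _ _ dA (tail psi)); [exact: dA_continuous|exact: cT].
have psi0 : psi 0 = 0 by rewrite -psiI indicE memNset ?mulr0// /= in_itv/= ltNge ltW.
have mD : measurable_fun [set: B] (D : B -> R).
  apply: measurable_funM; last exact: ddA_measurable.
  apply: measurableT_comp => //; apply: (measurableT_comp mpsi); exact: dA_measurable.
have E1 : (\int[mu]_x (w x * partial i phi x) = - \int[mu]_x (D x * phi x))%R.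
  apply: (ibp_dquot hmu) => //.
  - exact: continuous_measurableRd.
  - exact: continuous_locb.
  - move=> r; exists `|M| => x n _.
    rewrite /dquot normrM ger0_norm// mulrC -ler_pdivlMr// (le_trans (lipT _ _))//.
    rewrite ler_wpM2l// (le_trans (dA_lipschitz A0 cA _ _))// addrAC subrr add0r enorm_evec.
    by rewrite ger0_norm// invr_ge0.
  apply: (@filterS _ _ (ae_filter_ringOfSetsType mu) _ _ _ (good_ae A0 cA hmu)) => x gx.
  apply: (@chain_quot R (tail psi) (- psi (dA x)) (dA x)
    (fun n => dA (x + n.+1%:R^-1 *: evec R i)) (fun n => dquot i n dA x) _ 1) => //.
  - exact: cvg_dA_step.
  - by move=> n; exact: dquot_dA_le1.
  have [d0|] := ltP 0 (dA x); first by apply: cvgM; [exact: cvg_cst|exact: cvg_ddA].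
  (* On [A] the quotients of [dA] may fail to converge, but there [psi] vanishes because 0 is
     outside [I]. *)
  move=> d0; have -> : dA x = 0 by apply/eqP; rewrite eq_le d0 dA_ge0.
  rewrite /D (_ : dA x = 0); last by apply/eqP; rewrite eq_le d0 dA_ge0.
  by rewrite psi0 oppr0 mul0r; under eq_fun do rewrite mul0r; exact: cvg_cst.
rewrite /coarea.
have -> : (\int[mu]_x (psi (dA x) * gradA_phi x))%R = (- \int[mu]_x (D x * phi x))%R.
  rewrite (_ : (\int[mu]_x (D x * phi x))%R = (\int[mu]_x (-1 * (psi (dA x) * gradA_phi x)))%R).
    by rewrite RintegralZl// ?mulN1r ?opprK//; exact: gradA_integrable mpsi bM.
  by apply: eq_Rintegral => x _; rewrite /gradA_phi /D [psi _ * (\1_I _ * _)]mulrA psiI; ring.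
rewrite -E1 -(tail_flux mpsi bM); apply: eq_Rintegral => x _; congr (tail _ _ * _).
by apply/funext => t; rewrite psiI.
Qed.

(* [flux] and [gradA_phi] carry the cut-off to [I], so only the values on [I] matter. *)
Lemma coarea_eq (f g : R -> R) : (forall t, a < t < b -> f t = g t) -> coarea f -> coarea g.
Proof.
move=> fg; have fgI t : f t * \1_I t = g t * \1_I t.
  rewrite indicE; case: (boolP (t \in I)); rewrite ?mulr0// inE/= in_itv/= => tI.
  by rewrite fg.
rewrite /coarea => E.
transitivity (\int[mu]_x (f (dA x) * gradA_phi x))%R.
  by apply: eq_Rintegral => x _; rewrite /gradA_phi !mulrA fgI.
by rewrite E; apply: eq_Rintegral => t _; rewrite /flux !mulrA fgI.
Qed.

Lemma flux_integrable (f : R -> R) (N : R) : measurable_fun setT f ->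
  (forall t, `|f t| <= N) -> leb.-integrable setT (fun t => (f t * flux t)%:E).
Proof.
move=> mf bf; have [C C0 hC] := flux_bounded.
apply: (@bounded_itv_integrable R (N * C) a b); first exact: measurable_funM mf flux_measurable.
by move=> t; rewrite normrM -mulrA ler_pM.
Qed.

Lemma coareaD (c N N' : R) (f g : R -> R) : measurable_fun setT f -> measurable_fun setT g ->
  (forall t, `|f t| <= N) -> (forall t, `|g t| <= N') -> coarea f -> coarea g ->
  coarea (fun t => f t + c * g t).
Proof.
move=> mf mg bf bg cf cg; rewrite /coarea.
have if1 := gradA_integrable mf bf; have ig1 := gradA_integrable mg bg.
have if2 := flux_integrable mf bf; have ig2 := flux_integrable mg bg.
have igc1 : mu.-integrable setT (fun x : B => (c * (g (dA x) * gradA_phi x))%:E).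
  by under eq_fun do rewrite EFinM; exact: integrableZl.
have igc2 : leb.-integrable setT (fun t => (c * (g t * flux t))%:E).
  by under eq_fun do rewrite EFinM; exact: integrableZl.
transitivity (\int[mu]_x (f (dA x) * gradA_phi x + c * (g (dA x) * gradA_phi x)))%R.
  by apply: eq_Rintegral => x _; ring.
rewrite RintegralD// RintegralZl// cf cg -RintegralZl// -RintegralD//.
by apply: eq_Rintegral => t _; ring.
Qed.

Lemma coarea_lim (N : R) (f_ : nat -> R -> R) (f : R -> R) :
  (forall n, measurable_fun setT (f_ n)) -> measurable_fun setT f ->
  (forall n t, `|f_ n t| <= N) -> (forall t, f_ n t @[n --> \oo] --> f t) ->
  (forall n, coarea (f_ n)) -> coarea f.
Proof.
move=> mf_ mf bf cf cof.
have [r [K [r0 K0 sg bg]]] := gradA_phi_bounded.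
have c1 : (\int[mu]_x (f_ n (dA x) * gradA_phi x))%R @[n --> \oo] -->
    (\int[mu]_x (f (dA x) * gradA_phi x))%R.
  apply: (bsupp_dominated hmu (M := N * K) (r := r)).
  - move=> n; apply: measurable_funM; last exact: gradA_phi_measurable.
    exact: (measurableT_comp (mf_ n) (dA_measurable A0 cA)).
  - apply: measurable_funM; last exact: gradA_phi_measurable.
    exact: (measurableT_comp mf (dA_measurable A0 cA)).
  - by move=> n x /sg ->; rewrite mulr0.
  - by move=> n x _; rewrite normrM ler_pM.
  by apply: aeW => x; apply: cvgM; [exact: cf|exact: cvg_cst].
have [C C0 hC] := flux_bounded.
have c2 : (\int[leb]_t (f_ n t * flux t))%R @[n --> \oo] --> (\int[leb]_t (f t * flux t))%R.
  apply: (@dominated_Rintegral R _ _ leb (fun n t => f_ n t * flux t) (fun t => f t * flux t)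
    (fun t => N * C * \1_I t)).
  - by move=> n; exact: measurable_funM (mf_ n) flux_measurable.
  - exact: measurable_funM mf flux_measurable.
  - exact: indic_itv_integrable.
  - by move=> n t; rewrite normrM -mulrA ler_pM.
  by move=> t; apply: cvgM; [exact: cf|exact: cvg_cst].
have E : (fun n => \int[mu]_x (f_ n (dA x) * gradA_phi x))%R =
    (fun n => \int[leb]_t (f_ n t * flux t))%R by apply/funext => n; exact: cof.
by move: c1; rewrite E => c1; exact: (cvg_unique (@Rhausdorff R) c1 c2).
Qed.

Lemma ramp_continuous (u v : R) : continuous (ramp u v).
Proof.
move=> q; apply: differentiable_continuous; apply/derivable1_diffP.
exact: (@ex_derive _ _ _ _ _ _ _ (ramp_is_derive u v q)).
Qed.

(** The indicator is the pointwise limit of products of two ramps lying below it, which keeps them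
    zero outside [I]. *)
Lemma coarea_itv (s : R) : a <= s -> coarea (\1_(`]s, b[%classic)).
Proof.
move=> sa.
pose h n : R := n.+1%:R^-1.
have h0 n : 0 < h n by rewrite invr_gt0.
pose f_ n t := ramp s (s + h n) t * (1 - ramp (b - h n) b t).
have cf n : continuous (f_ n).
  move=> t; apply: continuousM; first exact: ramp_continuous.
  by apply: continuousB; [exact: cst_continuous|exact: ramp_continuous].
have f01 n t : 0 <= f_ n t <= \1_(`]s, b[%classic) t.
  have /andP[r0 r1] := ramp_01 s (s + h n) t; have /andP[q0 q1] := ramp_01 (b - h n) b t.
  apply/andP; split; first by rewrite mulr_ge0// subr_ge0.
  rewrite indicE; case: (boolP (t \in _)) => [_|]; first by rewrite mulr_ile1// ?subr_ge0// gerBl.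
  rewrite notin_setE /= in_itv/= => /negP; rewrite negb_and -!leNgt => /orP[ts|bt].
    by rewrite /f_ ramp_lo ?mul0r// ltrDl.
  by rewrite /f_ [ramp _ b _]ramp_hi ?subrr ?mulr0// ltrBlDr ltrDl.
have f1 n t : `|f_ n t| <= \1_(`]s, b[%classic) t.
  by have /andP[? ?] := f01 n t; rewrite ger0_norm.
apply: (@coarea_lim 1 f_).
- by move=> n; exact: continuous_measurable_fun (cf n).
- by apply: measurable_indic; exact: measurable_itv.
- by move=> n t; rewrite (le_trans (f1 n t))// indicE lern1 leq_b1.
- move=> t; rewrite indicE; case: (boolP (t \in _)) => [|tI]; last first.
    rewrite (_ : (fun n => _) = fun=> 0); first exact: cvg_cst.
    apply/funext => n; apply/eqP; rewrite -normr_le0 (le_trans (f1 n t))//.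
    by rewrite indicE (negbTE tI).
  rewrite inE/= in_itv/= => /andP[st tb].
  have ch : h n @[n --> \oo] --> (0 : R) by exact: cvg_harmonic.
  apply: cvg_near_cst; near=> n.
  rewrite /f_ ramp_hi ?ltrDl// ?ramp_lo ?subr0 ?mulr1 ?ltrBlDr ?ltrDl//.
    by rewrite lerBrDr -lerBrDl; near: n; apply: cvgr_le ch _ _; rewrite subr_gt0.
  by rewrite -lerBrDl; near: n; apply: cvgr_le ch _ _; rewrite subr_gt0.
move=> n; apply: (@coarea_continuous 1) => // t.
rewrite mul1r (le_trans (f1 n t))// !indicE ler_nat; case: (boolP (t \in `]s, b[%classic)) => //.
rewrite inE/= in_itv/= => /andP[st tb]; rewrite mem_set//= in_itv/= tb andbT.
exact: le_lt_trans st.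
Unshelve. all: by end_near. Qed.

Lemma indic_bound (S : set R) (t : R) : `|\1_S t| <= 1 :> R.
Proof. by rewrite ger0_norm// indicE lern1 leq_b1. Qed.

(** Dynkin's theorem with the half-lines []x, +oo[] as generators: inside [I] a half-line is an
    interval []s, b[], and [coareaD] and [coarea_lim] give closure under complements and disjoint
    unions. *)
Lemma coarea_measurable (S : set R) : measurable S -> coarea (\1_S).
Proof.
have mE : @measurable _ R = <<s @RGenOInfty.G R >> := RGenOInfty.measurableE R.
rewrite mE; apply: (dynkin_induction mE (P := fun S => coarea (\1_S))).
- move=> _ _ [x ->] [y ->]; exists (Num.max x y).
  by apply/seteqP; split => t /=; rewrite !in_itv/= !andbT gt_max => /andP.
- apply: (coarea_eq _ (coarea_itv (lexx a))) => t tI.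
  by rewrite !indicE !mem_set//= in_itv.
- move=> _ [s ->]; apply: (coarea_eq _ (@coarea_itv (Num.max a s) _)); last by rewrite le_max lexx.
  move=> t /andP[ta tb]; rewrite !indicE; congr ((nat_of_bool _)%:R).
  by rewrite !mem_setE /= !in_itv/= tb gt_max ta andbT.
- move=> S' mS' cS'.
  have : coarea (fun t => 1 + -1 * \1_S' t).
    apply: (@coareaD (-1) 1 1 (fun=> 1) (\1_S')) => //.
    - exact: indic_bound.
    - apply: (coarea_eq _ (coarea_itv (lexx a))) => t tI.
      by rewrite !indicE !mem_set//= in_itv.
  by apply: coarea_eq => t _; rewrite !indicE in_setC; case: (_ \in _); rewrite /= ?mulr1 ?subrr ?mulr0 ?addr0.
move=> F mF tF cF.
pose U n := \bigcup_(k < n) F k.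
have mU n : measurable (U n) by apply: bigcup_measurable => k _; exact: mF.
apply: (@coarea_lim 1 (fun n => \1_(U n))).
- by move=> n; exact: measurable_indic.
- by apply: measurable_indic; exact: bigcup_measurable.
- by move=> n t; exact: indic_bound.
- move=> t; rewrite indicE; case: (boolP (t \in _)) => [|tI].
    rewrite inE => -[k _ Fk]; apply: cvg_near_cst; near=> n.
    by rewrite indicE mem_set//; exists k => //=; near: n; exact: nbhs_infty_gt.
  rewrite (_ : (fun n => _) = fun=> 0); first exact: cvg_cst.
  apply/funext => n; rewrite indicE memNset// => -[k _ Fk].
  by move: tI; rewrite notin_setE; apply; exists k.
elim=> [|n IHn].
  have -> : \1_(U 0) = (fun=> 0) :> (R -> R).
    by apply/funext => t; rewrite indicE memNset// => -[].
  rewrite /coarea; under eq_Rintegral do rewrite mul0r.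
  by under [RHS]eq_Rintegral do rewrite mul0r; rewrite !Rintegral_cst// !mul0r.
have : coarea (fun t => \1_(U n) t + 1 * \1_(F n) t).
  by apply: (@coareaD 1 1 1) => //; exact: indic_bound.
apply: coarea_eq => t _; rewrite mul1r !indicE.
have [Fn|nFn] := boolP (t \in F n).
  move: Fn; rewrite inE => Fn.
  have UN : ~ U n t.
    move=> [k /= kn Fk]; have E : k = n by apply: (tF k n) => //; exists t.
    by rewrite E ltnn in kn.
  have Un1 : U n.+1 t by exists n => //=.
  by rewrite (memNset UN) (mem_set Un1) add0r.
rewrite addr0; congr ((nat_of_bool _)%:R); apply/idP/idP; rewrite !inE => -[k /= kn Fk]; exists k => //=.
  exact: ltnW.
move: kn; rewrite ltnS leq_eqVlt => /orP[/eqP E|//].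
by move: nFn; rewrite notin_setE -E.
Unshelve. all: by end_near. Qed.

(** Linearity over the level sets of [h]. Finiteness is given as a list of values, so that the lemma
    serves both a simple function and its square. *)
Lemma coarea_finite_range (h : R -> R) (s : seq R) : measurable_fun setT h ->
  uniq s -> (forall t, h t \in s) -> coarea h.
Proof.
move=> mh us hs.
have mpre y : measurable (h @^-1` [set y]).
  by rewrite -[X in measurable X]setTI; apply: mh => //; exact: measurable_set1.
have key (l : seq R) : coarea (fun t => \sum_(y <- l) y * \1_(h @^-1` [set y]) t).
  elim: l => [|y l IH].
    under eq_fun do rewrite big_nil.
    rewrite /coarea; under eq_Rintegral do rewrite mul0r.
    by under [RHS]eq_Rintegral do rewrite mul0r; rewrite !Rintegral_cst// !mul0r.
  under eq_fun do rewrite big_cons addrC.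
  apply: (@coareaD y (\sum_(z <- l) `|z|) 1) => //.
  - by apply: measurable_sum => z; apply: measurable_funM.
  - move=> t; rewrite (le_trans (ler_norm_sum _ _ _))//; apply: ler_sum => z _.
    by rewrite normrM ler_piMr// indic_bound.
  - exact: indic_bound.
  - exact: coarea_measurable.
apply: (coarea_eq _ (key s)) => t _.
rewrite (bigD1_seq (h t))//= indicE mem_set//= mulr1 big1 ?addr0// => y yt.
by rewrite indicE memNset ?mulr0//= => E; rewrite E eqxx in yt.
Qed.

End LevelSets.

(** * Calibrating fields and the upper bound *)

Section MollifyC1.
Variables (R : realType) (d : nat).
Local Notation V := 'rV[R]_d.
Local Notation B := (borelRd R d).
Variable mu : {measure set B -> \bar R}.
Hypothesis hmu : is_lebesgue_Rd mu.

(** Dominated convergence is sequential, so the continuity of the integrals below is tested on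
    sequences. *)
Lemma seq_continuous (f : V -> R) (x : V) :
  (forall u : nat -> V, u n @[n --> \oo] --> x -> f (u n) @[n --> \oo] --> f x) ->
  {for x, continuous f}.
Proof.
move=> H; apply/(@cvgrPdist_le _ _ _ (nbhs (x : V)) _ f) => e e0; apply: contrapT => nearN.
have ex (n : nat) : exists y : V, `|x - y| <= n.+1%:R^-1 /\ e < `|f x - f y|.
  apply: contrapT => /forallNP h; apply: nearN.
  near=> y; rewrite leNgt; apply/negP => ey; apply: (h y); split => //; near: y.
have [u uP] := choice ex.
have cu : u n @[n --> \oo] --> x.
  apply/cvgrPdist_le => e' e'0; near=> n; apply: (le_trans (uP n).1).
  by near: n; apply: cvgr_le (@cvg_harmonic R) _ _.
have /cvgrPdist_le/(_ _ e0)[N _ hN] := H u cu.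
by have := hN N (leqnn N); rewrite /= leNgt (uP N).2.
Unshelve. all: by end_near. Qed.

Variables (e M r : R) (u : V -> R).
Hypotheses (e0 : 0 < e) (mu_ : measurable_fun [set: B] (u : B -> R))
  (bu : forall x, `|u x| <= M) (su : bsupp r u).
Local Notation moll := (moll mu e).

Definition dmoll (i : 'I_d) (y x : V) : R := (bumpcst mu e)^-1 *
   - (dramp (e / 2) e (sqd y x) * (2 * (x ord0 i - y ord0 i))).

Lemma dmoll_bounded : exists2 K, 0 <= K & forall i y x, `|dmoll i y x| <= K.
Proof.
have [_ [K [_ K0 _ hK]]] := test_fun_bounded (moll_test mu e0 0).
exists K => // i y x; have := hK i (x - y).
rewrite (C1grad_partial (moll_C1grad mu e 0)) -sqd_shift add0r.
by rewrite !mxE subr0.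
Qed.

Lemma kernel_section_measurable (k : V -> V -> R) (x : V) : continuous (k x) ->
  measurable_fun [set: B] ((fun y => u y * k x y) : B -> R).
Proof. by move=> ck; apply: measurable_funM => //; exact: continuous_measurableRd. Qed.

Lemma dmollC (i : 'I_d) (x y : V) : dmoll i y x = - dmoll i x y.
Proof. by rewrite /dmoll sqdC; ring. Qed.

Lemma dmoll_continuous (i : 'I_d) (y : V) : continuous (dmoll i y).
Proof. by have [_ _ cg] := moll_C1grad mu e y; exact: cg. Qed.

Lemma moll_u_measurable (x : V) : measurable_fun [set: B] ((fun y => u y * moll x y) : B -> R).
Proof.
apply: (@kernel_section_measurable moll).
by have [c _ _] := moll_C1grad mu e x.
Qed.

Lemma dmoll_u_measurable (i : 'I_d) (x : V) :
  measurable_fun [set: B] ((fun y => u y * dmoll i y x) : B -> R).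
Proof.
apply: measurable_funM => //.
rewrite (_ : (fun y => _) = (fun y => - dmoll i x y)); last by apply/funext => y; rewrite -dmollC.
by apply: measurableT_comp => //; apply: continuous_measurableRd; exact: dmoll_continuous.
Qed.

Lemma moll_u_integrable (x : V) : mu.-integrable [set: B] (fun y => (u y * moll x y)%:E).
Proof.
apply: (bsupp_integrable hmu (M := M * (bumpcst mu e)^-1) (r := r)).
- exact: moll_u_measurable.
- by move=> y /su ->; rewrite mul0r.
by move=> y _; rewrite normrM ler_pM// ger0_norm ?moll_ge0// moll_le.
Qed.

Definition dmollify (i : 'I_d) (x : V) : R := (\int[mu]_y (u y * dmoll i y x))%R.

(** Here [u] is bounded and measurable, with bounded support. Differentiation passes under the
    integral because the kernel is Lipschitz along the axes, uniformly in its centre. *)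
Lemma mollify_C1grad : C1grad (mollify mu e u) dmollify.
Proof.
have [K K0 hK] := dmoll_bounded.
have Cm y := moll_C1grad mu e y.
split=> [x|i x|i x].
- apply: seq_continuous => v cv.
  apply: (bsupp_dominated hmu (M := M * (bumpcst mu e)^-1) (r := r)).
  + by move=> n; exact: moll_u_measurable.
  + exact: moll_u_measurable.
  + by move=> n y /su ->; rewrite mul0r.
  + by move=> n y _; rewrite normrM ler_pM// ger0_norm ?moll_ge0// moll_le.
  apply: aeW => y; apply: cvgM; first exact: cvg_cst.
  under eq_fun do rewrite mollC; rewrite mollC.
  by have [c _ _] := Cm y; exact: (cvg_comp _ _ cv (c x)).
- have c : (fun h : R => h^-1 *: (mollify mu e u (h *: evec R i + x) - mollify mu e u x)) h
      @[h --> 0^'] --> dmollify i x.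
    apply/cvgr_dnbhsP => h [h0 ch].
    have E n : (h n)^-1 *: (mollify mu e u (h n *: evec R i + x) - mollify mu e u x) =
        (\int[mu]_y (u y * ((h n)^-1 * (moll y (x + h n *: evec R i) - moll y x))))%R.
      rewrite /mollify -RintegralB//; try exact: moll_u_integrable.
      rewrite -[(h n)^-1 *: _]/((h n)^-1 * _) -RintegralZl//.
        by apply: eq_Rintegral => y _; rewrite ![moll _ y]mollC [x + _]addrC; ring.
      have := integrableB measurableT (moll_u_integrable (h n *: evec R i + x)) (moll_u_integrable x).
      by apply: eq_integrable => // y _; rewrite EFinB.
    under eq_fun do rewrite E.
    apply: (bsupp_dominated hmu (M := M * K) (r := r)).
    + move=> n; have mq := measurable_funM (@measurable_cst _ _ _ _ _ (h n)^-1)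
        (measurable_funB (moll_u_measurable (x + h n *: evec R i)) (moll_u_measurable x)).
      rewrite (_ : (fun y => _) = cst (h n)^-1 \*
        ((fun y : B => u y * moll (x + h n *: evec R i) y) \- (fun y : B => u y * moll x y)))//.
      by apply/funext => y /=; rewrite ![moll _ y]mollC; ring.
    + exact: dmoll_u_measurable.
    + by move=> n y /su ->; rewrite mul0r.
    + move=> n y _; rewrite normrM ler_pM// normrM normfV mulrC ler_pdivrMr ?normr_gt0//.
      apply: line_lipschitz => [z|t _]; first by have [_ dm _] := Cm y; exact: ex_derive.
      by rewrite (C1grad_partial (Cm y)); exact: hK.
    apply: aeW => y; apply: cvgM; first exact: cvg_cst.
    have := @cvg_partial R d i (moll y) x h; rewrite (C1grad_partial (Cm y)).
    by apply => //; have [_ dm _] := Cm y; exact: ex_derive.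
  apply: DeriveDef; first by apply/cvg_ex; exists (dmollify i x).
  by apply: cvg_lim.
apply: seq_continuous => v cv.
apply: (bsupp_dominated hmu (M := M * K) (r := r)).
- by move=> n; exact: dmoll_u_measurable.
- exact: dmoll_u_measurable.
- by move=> n y /su ->; rewrite mul0r.
- by move=> n y _; rewrite normrM ler_pM.
by apply: aeW => y; apply: cvgM; [exact: cvg_cst|exact: (cvg_comp _ _ cv (@dmoll_continuous i y x))].
Qed.

Lemma mollify_bsupp : bsupp (r + (1 + e)) (mollify mu e u).
Proof.
move=> x xr; rewrite /mollify (_ : (fun y => _) = fun=> 0); first by rewrite Rintegral_cst// mul0r.
apply/funext => y.
have [yr|ry] := leP `|y| r; last by rewrite su// mul0r.
by rewrite mollC (moll_bsupp mu e0) ?mulr0// (le_lt_trans _ xr)// lerD2r.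
Qed.

Lemma mollify_test : test_fun (mollify mu e u).
Proof. by apply: (C1grad_test mollify_C1grad); exact: mollify_bsupp. Qed.

(** A weighted average of values within [t] of [c]. The bound is asked almost everywhere because it
    will come from the formula for [ddA] at [good] points. *)
Lemma mollify_near (x : V) (c t : R) : 0 <= t -> {ae mu, forall y : B, sqd x y <= e -> `|u y - c| <= t} ->
  `|mollify mu e u x - c| <= t.
Proof.
move=> t0 ae_; have im := moll_integrable hmu e0 x.
have icm : mu.-integrable [set: B] (fun y => (c * moll x y)%:E).
  by under eq_fun do rewrite EFinM; exact: integrableZl.
rewrite -[c in _ - c]mulr1 -(int_moll hmu e0 x) -RintegralZl// /mollify -RintegralB//; last exact: moll_u_integrable.
apply: le_trans (le_normr_Rintegral _ _) _ => //.
  have := integrableB measurableT (moll_u_integrable x) icm.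
  by apply: eq_integrable => // y _; rewrite EFinB.
rewrite -[leRHS]mulr1 -(int_moll hmu e0 x) -RintegralZl//.
have iB : mu.-integrable [set: B] (fun y => (u y * moll x y - c * moll x y)%:E).
  have := integrableB measurableT (moll_u_integrable x) icm.
  by apply: eq_integrable => // y _; rewrite EFinB.
have iN := integrable_abse iB.
have iT : mu.-integrable [set: B] (fun y => (t * moll x y)%:E).
  by under eq_fun do rewrite EFinM; exact: integrableZl.
rewrite -lee_fin /Rintegral !fineK; [|exact: integrable_fin_num iT|exact: integrable_fin_num iN].
have mB := measurable_int _ iN; have mT := measurable_int _ iT.
apply: ae_ge0_le_integral => //.
- by move=> y _; rewrite lee_fin mulr_ge0 ?moll_ge0.
apply: (@filterS _ _ (ae_filter_ringOfSetsType mu) _ _ _ ae_) => y h _.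
rewrite lee_fin -mulrBl normrM (ger0_norm (moll_ge0 hmu e0 x y)).
have [xy|xy] := leP (sqd x y) e; first by rewrite ler_wpM2r ?moll_ge0// h.
by rewrite moll_hi ?mulr0.
Qed.

End MollifyC1.

(** * Calibrating fields: the mollified gradient of the distance *)

Section Calibration.
Variables (R : realType) (d : nat).
Local Notation V := 'rV[R]_d.
Local Notation B := (borelRd R d).
Variable mu : {measure set B -> \bar R}.
Hypothesis hmu : is_lebesgue_Rd mu.
Variable A : set V.
Hypotheses (A0 : A !=set0) (cA : compact A).
Local Notation dA := (dA A0 cA).
Local Notation ddA := (ddA A0 cA).
Local Notation nearest := (nearest A0 cA).

(** By [good_isolates], any nearest point of a nearby [y] is close to that of [x], so the arbitrary
    selection is continuous at [x]. *)
Lemma nearest_continuous (i : 'I_d) (x : V) : good A0 cA x ->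
  {for x, continuous (fun y => nearest y ord0 i)}.
Proof.
move=> gx; apply/(@cvgrPdist_le _ _ _ (nbhs (x : V)) _ (fun y => nearest y ord0 i)) => e e0.
have [al al0 alP] := good_isolates gx (nearest_near_pt A0 cA x) e0.
have K0 : 0 < 4 * dA x + 4 by rewrite ltr_wpDl// mulr_ge0// dA_ge0.
have cs : {for x, continuous (fun y : V => enorm (y - x))} by exact: enorm_continuous.
have {}cs : enorm (y - x) @[y --> nbhs x] --> (0 : R).
  by move: cs; rewrite /prop_for /continuous_at subrr -(scale0r x) enormZ normr0 mul0r.
near=> y.
have s1 : enorm (y - x) <= 1 by near: y; apply: (@cvgr_le _ _ (nbhs (x : V)) _ (fun y => enorm (y - x)) 0 cs).
have s2 : enorm (y - x) <= al / (4 * dA x + 4).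
  near: y; apply: (@cvgr_le _ _ (nbhs (x : V)) _ (fun y => enorm (y - x)) 0 cs); exact: divr_gt0.
have {}s2 : enorm (y - x) * (4 * dA x + 4) <= al by rewrite -ler_pdivlMr.
have s0 := enorm_ge0 (y - x).
rewrite distrC; have -> : nearest y ord0 i - nearest x ord0 i = (nearest y - nearest x) ord0 i by rewrite !mxE.
apply: le_trans (coord_le _ _) _; apply: alP; first exact: nearest_in.
apply: (@le_trans _ _ ((dA x + 2 * enorm (y - x)) ^+ 2)).
  rewrite -enorm_le ?addr_ge0 ?dA_ge0 ?mulr_ge0//.
  rewrite -[x - _](subrKA y) (le_trans (enormD _ _))//.
  have := le_trans (ler_norm _) (dA_lipschitz A0 cA y x).
  rewrite -[enorm (x - y)]enormN opprB -/(dA y); lra.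
have H (s q : R) : s <= 1 -> s * (4 * q + 4) <= al -> 0 <= s -> (q + 2 * s) ^+ 2 <= q ^+ 2 + al.
  move=> h1 h2 h3; have := ler_wpM2l h3 h1; rewrite mulr1; lra.
exact: H.
Unshelve. all: by end_near. Qed.

Lemma dir_continuous (i : 'I_d) (x : V) : good A0 cA x -> 0 < dA x ->
  {for x, continuous (fun y : V => (y ord0 i - nearest y ord0 i) / dA y)}.
Proof.
move=> gx d0.
apply: (@continuousM _ _ (fun y : V => y ord0 i - nearest y ord0 i) (fun y => (dA y)^-1) x).
  apply: (@continuousB _ _ _ (fun y : V => y ord0 i) (fun y => nearest y ord0 i) x).
    exact: coord_continuous.
  exact: nearest_continuous.
apply: (@continuousV _ _ dA x); first by rewrite gt_eqF.
exact: dA_continuous.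
Qed.

Variable b : R.
Hypothesis b0 : 0 <= b.

(** The cut-off at [b] gives bounded support; the one at 0 keeps the region where the gradient is a
    unit vector almost everywhere. *)
Definition cutgrad (i : 'I_d) (y : V) : R := \1_(`]0, b[%classic) (dA y) * ddA i y.

Lemma cutgrad_le1 (i : 'I_d) (y : V) : `|cutgrad i y| <= 1.
Proof.
rewrite /cutgrad normrM -[leRHS]mul1r ler_pM// ?ddA_le1//.
exact: indic_bound.
Qed.

Lemma cutgrad_measurable (i : 'I_d) : measurable_fun [set: B] (cutgrad i : B -> R).
Proof.
apply: measurable_funM; last exact: ddA_measurable.
exact: indic_dA_measurable.
Qed.

Lemma cutgrad_bsupp : exists2 r, 0 <= r & forall i, bsupp r (cutgrad i).
Proof.
have [M M0 hM] := dA_bounded A0 cA; exists (M + b); first exact: addr_ge0.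
move=> i x xr; rewrite /cutgrad indicE memNset ?mul0r// => /=.
rewrite in_itv/= => /andP[_ xb].
by have := lt_le_trans xr (hM x); rewrite ltrD2l ltNge (ltW xb).
Qed.

Lemma cutgrad_unit (y : V) : good A0 cA y -> sqgrad cutgrad y <= 1.
Proof.
move=> gy; rewrite /sqgrad /cutgrad indicE; case: (boolP (_ \in _)) => [|_].
  rewrite inE/= in_itv/= => /andP[y0 _].
  by under eq_bigr do rewrite mul1r; rewrite ddA_unit.
by rewrite big1// => i _; rewrite mul0r expr0n.
Qed.

Definition calib (n : nat) (i : 'I_d) : V -> R := mollify mu n.+1%:R^-1 (cutgrad i).

Let e0 (n : nat) : 0 < n.+1%:R^-1 :> R. Proof. by rewrite invr_gt0. Qed.

Lemma calib_test (n : nat) (i : 'I_d) : test_fun (calib n i).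
Proof.
have [r _ sr] := cutgrad_bsupp.
exact: (mollify_test hmu (e0 n) (cutgrad_measurable i) (cutgrad_le1 i) (sr i)).
Qed.

Lemma cutgrad_integrable (i : 'I_d) : mu.-integrable [set: B] (fun x => (cutgrad i x)%:E).
Proof.
have [r _ sr] := cutgrad_bsupp.
by apply: (bsupp_integrable hmu (cutgrad_measurable i) (sr i)) => x _; exact: cutgrad_le1.
Qed.

(** Averaging keeps vectors in the unit ball, by [mollify_jensen]; this makes the field admissible
    for the perimeter. *)
Lemma calib_unit (n : nat) (x : V) : sqgrad (calib n) x <= 1.
Proof.
have li i : loc_integrable mu (cutgrad i).
  move=> C cC; apply: integrableS (cutgrad_integrable i) => //.
  by apply: closed_measurableRd; exact: compact_closed.
have [r _ sr] := cutgrad_bsupp.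
have ms : measurable_fun [set: B] (sqgrad cutgrad : B -> R).
  by apply: sqgrad_measurable => i; exact: cutgrad_measurable.
have bs y : `|sqgrad cutgrad y| <= d%:R.
  rewrite ger0_norm ?sqgrad_ge0// /sqgrad -[d in leRHS]card_ord -[leRHS]mulr_natl mulr1 -sumr_const.
  by apply: ler_sum => i _; rewrite -real_normK ?num_real// exprn_ile1// cutgrad_le1.
have ss : bsupp r (sqgrad cutgrad).
  by move=> y yr; rewrite /sqgrad big1// => i _; rewrite sr// expr0n.
have fin : (\int[mu]_x (sqgrad cutgrad x)%:E < +oo)%E.
  have is_ := bsupp_integrable hmu ms ss (fun x _ => bs x).
  by have /fin_numPlt/andP[] := integrable_fin_num measurableT is_.
rewrite -lee_fin; apply: le_trans (mollify_jensen hmu (e0 n) li cutgrad_measurable fin x) _.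
have <- : (\int[mu]_y (moll mu n.+1%:R^-1 x y)%:E = 1)%E.
  by under eq_integral do rewrite mollC; exact: integral_moll.
have mm := test_fun_measurable (moll_test mu (e0 n) x).
apply: ae_ge0_le_integral => //.
- by move=> y _; rewrite lee_fin mulr_ge0 ?sqgrad_ge0 ?moll_ge0.
- by apply/measurable_EFinP; exact: measurable_funM.
- by move=> y _; rewrite lee_fin moll_ge0.
- exact/measurable_EFinP.
apply: (@filterS _ _ (ae_filter_ringOfSetsType mu) _ _ _ (good_ae A0 cA hmu)) => y gy _.
by rewrite lee_fin ler_piMl ?moll_ge0// cutgrad_unit.
Qed.

(** At a [good] point the direction [(y - nearest y) / dA y] is continuous, so a kernel of small
    radius averages values close to the one at [x]. *)
Lemma calib_cvg (i : 'I_d) (x : V) : good A0 cA x -> 0 < dA x < b ->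
  calib n i x @[n --> \oo] --> ddA i x.
Proof.
move=> gx /andP[x0 xb]; apply/cvgrPdist_le => t t0.
have c1 := dir_continuous (i := i) gx x0.
have [r _ sr] := cutgrad_bsupp.
have N : \forall y \near nbhs (x : V), 0 < dA y < b /\
    `|(x ord0 i - nearest x ord0 i) / dA x - (y ord0 i - nearest y ord0 i) / dA y| <= t.
  have cd : {for x, continuous dA} by exact: dA_continuous.
  near=> y; split.
    apply/andP; split; near: y.
      exact: (@cvgr_gt _ _ (nbhs (x : V)) _ dA (dA x) cd).
    exact: (@cvgr_lt _ _ (nbhs (x : V)) _ dA (dA x) cd).
  near: y.
  by move/(@cvgrPdist_le _ _ _ (nbhs (x : V)) _ (fun y : V => (y ord0 i - nearest y ord0 i) / dA y)) : c1; exact.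
have [de de0 hde] : exists2 de, 0 < de & forall y, `|y - x| <= de -> 0 < dA y < b /\
    `|(x ord0 i - nearest x ord0 i) / dA x - (y ord0 i - nearest y ord0 i) / dA y| <= t.
  have /nbhs_ballP[de /= de0 hde] : nbhs x [set y | 0 < dA y < b /\
    `|(x ord0 i - nearest x ord0 i) / dA x - (y ord0 i - nearest y ord0 i) / dA y| <= t] by exact: N.
  exists (de / 2); first exact: divr_gt0.
  move=> y xy; apply: hde; rewrite -ball_normE /= distrC (le_lt_trans xy)//.
  by rewrite ltr_pdivrMr// ltr_pMr// ltr1n.
have ch : n.+1%:R^-1 @[n --> \oo] --> (0 : R) by exact: cvg_harmonic.
near=> n; rewrite distrC.
apply: (mollify_near hmu (e0 n) (cutgrad_measurable i) (cutgrad_le1 i) (sr i)); first exact: ltW.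
apply: (@filterS _ _ (ae_filter_ringOfSetsType mu) _ _ _ (good_ae A0 cA hmu)) => y gy xy.
have yx : `|y - x| <= de.
  apply: sqd_sup_le; first exact: ltW.
  apply: le_trans xy _; near: n; apply: cvgr_le ch _ _; exact: exprn_gt0.
have [yb yt] := hde y yx; have /andP[y0 _] := yb.
by rewrite /cutgrad indicE mem_set ?mul1r//= ?in_itv//= !ddA_nearest// distrC.
Unshelve. all: by end_near. Qed.

End Calibration.

(** * The competitor and its energy *)

Section Energy.
Variables (R : realType) (d : nat).
Local Notation V := 'rV[R]_d.
Local Notation B := (borelRd R d).
Local Notation leb := (@lebesgue_measure R).
Variable mu : {measure set B -> \bar R}.
Hypothesis hmu : is_lebesgue_Rd mu.
Variable A : set V.
Hypotheses (A0 : A !=set0) (cA : compact A).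
Local Notation dA := (dA A0 cA).
Local Notation ddA := (ddA A0 cA).
Variables (a b : R) (h : R -> R) (s : seq R).
Local Notation I := (`]a, b[%classic : set R).
Hypotheses (a0 : 0 < a) (b0 : 0 <= b) (mh : measurable_fun setT h) (us : uniq s)
  (hs : forall t, h t \in s) (h0 : forall t, 0 <= h t)
  (hP : forall t, a < t < b -> ((h t)%:E <= (perimeter mu (parallel A t))^-1)%E).
Local Notation calib := (calib mu A0 cA b).
Local Notation flux := (flux mu A0 cA a b).

Definition calib_field (n : nat) (x : V) : V := \row_i calib n i x.

Lemma calib_field_test (n : nat) : test_field (calib_field n).
Proof.
have E j : (fun x => calib_field n x ord0 j) = calib n j.
  by apply/funext => x; rewrite mxE.
split=> [j|]; first by rewrite E; have [] := calib_test hmu A0 cA b0 n j.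
have [r _ sr] := cutgrad_bsupp A0 cA b0.
exists (supball (r + (1 + n.+1%:R^-1))); split; first exact: supball_compact.
move=> x /negP; rewrite /supball /= -ltNge => xr; apply/rowP => j; rewrite !mxE.
have e0 : 0 < n.+1%:R^-1 :> R by rewrite invr_gt0.
exact: (mollify_bsupp mu e0 (sr j) xr).
Qed.

Lemma calib_field_le1 (n : nat) (x : V) : enorm (calib_field n x) <= 1.
Proof.
rewrite /enorm -[leRHS]sqrtr1 ler_wsqrtr// (le_trans _ (calib_unit hmu A0 cA b0 n x))//.
by apply: ler_sum => i _; rewrite mxE.
Qed.

Lemma sum_flux_perimeter (n : nat) (t : R) :
  ((\sum_(i < d) flux i (calib n i) t)%:E <=
   (\1_I t)%:E * perimeter mu (parallel A t))%E.
Proof.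
pose phi := calib_field n; have tphi := calib_field_test n.
have E0 i : (fun y => phi y ord0 i) = calib n i by apply/funext => x; rewrite mxE.
have E : \sum_(i < d) flux i (calib n i) t =
    \1_I t * (\int[mu]_x (below A0 cA t x * div phi x))%R.
  rewrite /flux -mulr_sumr -Rintegral_bigsum; last first.
    by move=> i; exact: (below_partial_integrable hmu A0 cA i (calib_test hmu A0 cA b0 n i) t).
  congr (_ * _); apply: eq_Rintegral => x _; rewrite /div mulr_sumr; apply: eq_bigr => i _.
  by rewrite E0.
rewrite E EFinM lee_wpmul2l ?lee_fin//.
apply: ereal_sup_ubound; exists phi; first by split => // x; exact: calib_field_le1.
rewrite indicE_Rintegral.
- congr (_%:E); apply: eq_Rintegral => x _; congr (_ * _); rewrite /below indicE.
  by congr ((nat_of_bool _)%:R); rewrite (parallel_dA A0 cA) mem_setE.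
- rewrite (parallel_dA A0 cA).
  rewrite (_ : [set x | _] = dA @^-1` `]-oo, t]%classic).
    by rewrite -[X in measurable X]setTI; apply: (dA_measurable A0 cA) => //; exact: measurable_itv.
  by apply/seteqP; split => x /=; rewrite in_itv.
exact: div_integrable.
Qed.

(** The total flux is at most [P] and [h <= 1/P]; a nonpositive flux is harmless because [h >= 0].
    One more factor [h] gives [h^2 flux <= h], the inequality behind the energy bound. *)
Lemma h_sum_flux_le (n : nat) (t : R) : h t * \sum_(i < d) flux i (calib n i) t <= \1_I t.
Proof.
have := sum_flux_perimeter n t; set S := \sum_(i < d) _; rewrite indicE.
case: (boolP (t \in I)) => [|_]; last by rewrite mul0e lee_fin => S0; rewrite mulr_ge0_le0.
rewrite inE/= in_itv/= mul1e => /hP hp SP.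
have [S0|S0] := leP S 0; first by rewrite (@le_trans _ _ 0)// mulr_ge0_le0.
rewrite -ler_pdivlMr// mul1r -lee_fin (le_trans hp)//.
rewrite (_ : (S^-1)%:E = (S%:E)^-1)%E; last by rewrite inver gt_eqF.
have S0' : (0 <= S%:E)%E by rewrite lee_fin ltW.
by rewrite lee_pV2// inE//; exact: le_trans S0' SP.
Qed.

Let N : R := \sum_(y <- s) `|y|.

Lemma h_le (t : R) : `|h t| <= N.
Proof.
rewrite /N (bigD1_seq (h t))//= lerDl; exact: sumr_ge0.
Qed.

Definition mass : R := (\int[leb]_t (h t * \1_I t))%R.

Lemma mass_integrable : leb.-integrable setT (fun t => (h t * \1_I t)%:E).
Proof.
apply: (@bounded_itv_integrable R N a b).
  by apply: measurable_funM => //; apply: measurable_indic; exact: measurable_itv.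
by move=> t; rewrite normrM [`|\1_I t|]ger0_norm// ler_wpM2r// h_le.
Qed.

(** Use [coarea] with [psi = h^2] and the fields [calib n]. The integral over levels is at most
    [mass] for every [n]; in the integral over points [D dA . calib n] tends to [|D dA|^2 = 1]
    almost everywhere where [dA x] lies in [I]. *)
Lemma calibrated_energy : (\int[mu]_x (h (dA x) ^+ 2 * \1_I (dA x)) <= mass)%R.
Proof.
have h2 t : `|h t ^+ 2| <= N ^+ 2 by rewrite normrX lerXn2r ?nnegrE ?h_le// (le_trans _ (h_le t)).
have mh2 : measurable_fun setT (fun t => h t ^+ 2) by exact: measurable_funX.
have co n i : coarea mu A0 cA a b i (calib n i) (fun t => h t ^+ 2).
  apply: (@coarea_finite_range _ _ _ hmu _ A0 cA _ b i _ a0 (calib_test hmu A0 cA b0 n i) _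
    (undup [seq y ^+ 2 | y <- s])) => //; first exact: undup_uniq.
  by move=> t; rewrite mem_undup; apply: map_f.
pose F n x := \sum_(i < d) h (dA x) ^+ 2 * gradA_phi A0 cA a b i (calib n i) x.
have iF n : forall i : 'I_d, mu.-integrable setT
    (fun x : B => (h (dA x) ^+ 2 * gradA_phi A0 cA a b i (calib n i) x)%:E).
  by move=> i; exact: (gradA_integrable hmu A0 cA a b i (calib_test hmu A0 cA b0 n i) mh2 h2).
have Fle n : (\int[mu]_x F n x <= mass)%R.
  rewrite /F Rintegral_bigsum//.
  rewrite (eq_bigr (fun i => \int[leb]_t (h t ^+ 2 * flux i (calib n i) t))%R); last by move=> i _; exact: co.
  rewrite -Rintegral_bigsum; last by move=> i; exact: (flux_integrable hmu A0 cA a b i (calib_test hmu A0 cA b0 n i) mh2 h2).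
  apply: le_Rintegral => [//|||t _].
  - apply: integrable_bigsum => i; exact: (flux_integrable hmu A0 cA a b i (calib_test hmu A0 cA b0 n i) mh2 h2).
  - exact: mass_integrable.
  rewrite -mulr_sumr expr2 -mulrA ler_wpM2l//; exact: h_sum_flux_le.
have cF : (\int[mu]_x F n x)%R @[n --> \oo] --> (\int[mu]_x (h (dA x) ^+ 2 * \1_I (dA x)))%R.
  have [M M0 hM] := dA_bounded A0 cA.
  apply: (bsupp_dominated hmu (M := N ^+ 2 * d%:R) (r := M + b)).
  - move=> n; apply: measurable_sum => i; apply: measurable_funM.
      exact: (measurableT_comp mh2 (dA_measurable A0 cA)).
    exact: (gradA_phi_measurable A0 cA a b i (calib_test hmu A0 cA b0 n i)).
  - apply: measurable_funM; first exact: (measurableT_comp mh2 (dA_measurable A0 cA)).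
    exact: indic_dA_measurable.
  - move=> n x xr; rewrite /F big1// => i _; rewrite /gradA_phi indicE memNset ?mul0r ?mulr0//=.
    rewrite in_itv/= => /andP[_ xb].
    by have := lt_le_trans xr (hM x); rewrite ltrD2l ltNge (ltW xb).
  - move=> n x _; rewrite /F (le_trans (ler_norm_sum _ _ _))// mulrC -[d in leRHS]card_ord mulr_natl -sumr_const.
    apply: ler_sum => i _; rewrite normrM -[leRHS]mulr1 ler_pM//.
    rewrite /gradA_phi !normrM -[leRHS]mul1r ler_pM// ?mulr_ge0// ?indic_bound//.
    rewrite -[leRHS]mul1r ler_pM// ?ddA_le1//.
    rewrite -(@expr_le1 _ 2)// real_normK ?num_real//.
    apply: le_trans (calib_unit hmu A0 cA b0 n x); rewrite /sqgrad (bigD1 i)//= lerDl.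
    by apply: sumr_ge0 => j _; exact: sqr_ge0.
  apply: (@filterS _ _ (ae_filter_ringOfSetsType mu) _ _ _ (good_ae A0 cA hmu)) => x gx.
  rewrite indicE /F /gradA_phi indicE; case: (boolP (dA x \in I)) => [|_]; last first.
    by rewrite mulr0; under eq_fun do (rewrite big1; last by move=> i _; rewrite mul0r mulr0); exact: cvg_cst.
  rewrite inE/= in_itv/= => /andP[xa xb].
  have x0 : 0 < dA x := lt_trans a0 xa.
  rewrite [h (dA x) ^+ 2 * _](_ : _ = \sum_(i < d) h (dA x) ^+ 2 * ddA i x ^+ 2); last first.
    by rewrite -mulr_sumr ddA_unit.
  apply: (cvg_big (op := +%R)); first exact: add_continuous.
  move=> i _; apply: cvgM; first exact: cvg_cst.
  under eq_fun do rewrite mul1r.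
  rewrite expr2; apply: cvgM; first exact: cvg_cst.
  by apply: calib_cvg => //; rewrite x0 xb.
have c1 : ((fun _ : nat => mass) n) @[n --> \oo] --> mass by exact: cvg_cst.
by apply: (ler_cvg_to cF c1); apply: nearW.
Qed.

Local Notation psi := (fun t => h t * \1_I t).

Lemma psi_measurable : measurable_fun setT psi.
Proof. by apply: measurable_funM => //; apply: measurable_indic; exact: measurable_itv. Qed.

Lemma tail_integrable (s' : R) : leb.-integrable setT (fun t => (psi t * (s' <= t :> R)%:R)%:E).
Proof.
apply: (@bounded_itv_integrable R N a b).
  by apply: measurable_funM; [exact: psi_measurable|exact: ge_indic_measurable].
move=> t; rewrite -mulrA normrM ler_pM ?h_le// normrM -[leRHS]mulr1.
by rewrite (@ger0_norm _ (\1_I t))// ler_wpM2l// ger0_norm// lern1 leq_b1.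
Qed.

(** [psi] may jump, so continuity of its tail comes from the bound [N] and not from
    [tail_is_derive]. *)
Lemma tail_lipschitz (s1 s2 : R) : `|tail psi s1 - tail psi s2| <= N * `|s1 - s2|.
Proof.
wlog s12 : s1 s2 / s1 < s2.
  move=> W; have [/W//|s21|->] := ltgtP s1 s2; last by rewrite !subrr normr0 mulr0.
  by rewrite distrC [`|s1 - s2|]distrC W.
have ii := indic_itv_integrable N s1 s2.
have i1 : leb.-integrable setT (fun t => (N * \1_(`[s1, s2[%classic) t)%:E).
  have := integrableZl measurableT N (integrable_indic_itv s1 s2 true true).
  by apply: eq_integrable => // t _; rewrite /= EFinM.
rewrite /tail -(RintegralB measurableT (tail_integrable s1) (tail_integrable s2)).
have iB : leb.-integrable setT (fun t => (psi t * (s1 <= t :> R)%:R - psi t * (s2 <= t :> R)%:R)%:E).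
  have := integrableB measurableT (tail_integrable s1) (tail_integrable s2).
  by apply: eq_integrable => // t _; rewrite EFinB.
apply: le_trans (le_normr_Rintegral measurableT iB) _.
apply: (@le_trans _ _ (\int[leb]_t (N * \1_(`[s1, s2[%classic) t))%R).
  apply: le_Rintegral => [//|||t _]; [exact: integrable_abse iB|exact: i1|].
  rewrite -mulrBr normrM ler_pM//.
    by rewrite normrM -[leRHS]mulr1 ler_pM// ?h_le// indic_bound.
  rewrite indicE; case: (leP s1 t) => s1t; case: (leP s2 t) => s2t.
  - by rewrite subrr normr0.
  - by rewrite subr0 normr1 mem_set//= in_itv/= s1t.
  - by have := lt_trans (le_lt_trans s2t s1t) s12; rewrite ltxx.
  - by rewrite subrr normr0.
rewrite RintegralZl//; last exact: (integrable_indic_itv s1 s2 true true).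
rewrite /Rintegral integral_indic//= setIT lebesgue_measure_itv/= lte_fin s12 /=.
by rewrite distrC [`|s2 - s1|]gtr0_norm// subr_gt0.
Qed.

Lemma tail_continuous : continuous (tail psi).
Proof.
move=> s1; apply/cvgrPdist_le => e e0.
have K0 : 0 < N + 1 by rewrite ltr_wpDl// (le_trans _ (h_le 0)).
near=> t; apply: le_trans (tail_lipschitz _ _) _.
apply: (@le_trans _ _ ((N + 1) * `|s1 - t|)); first by rewrite ler_wpM2r// lerDl.
rewrite -ler_pdivlMl//; near: t.
by apply: cvgr_dist_le; [exact: cvg_id|rewrite mulr_gt0 ?invr_gt0].
Unshelve. all: by end_near. Qed.

Lemma tail0 : tail psi 0 = mass.
Proof.
apply: eq_Rintegral => t _; rewrite -[RHS]mulr1 -!mulrA; congr (_ * _).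
rewrite indicE; case: (boolP (t \in I)); rewrite ?mul0r// inE/= in_itv/= => /andP[at_ _].
by rewrite (ltW (lt_trans a0 at_)).
Qed.

Lemma tail_ge0 (s1 : R) : 0 <= tail psi s1.
Proof. by apply: Rintegral_ge0 => t _; rewrite mulr_ge0// mulr_ge0. Qed.

Lemma tail_out (s1 : R) : b <= s1 -> tail psi s1 = 0.
Proof.
move=> bs; rewrite /tail (_ : (fun t => _) = fun=> 0); first by rewrite Rintegral_cst// mul0r.
apply/funext => t; rewrite indicE; case: (leP s1 t) => st; rewrite ?mulr0// mulr1.
rewrite memNset ?mulr0//= in_itv/= => /andP[_ tb].
by have := lt_le_trans tb (le_trans bs st); rewrite ltxx.
Qed.

(** Equal to 1 on [A], where [dA] vanishes and the tail is all of [mass], and to 0 once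
    [dA x >= b]. *)
Definition competitor (x : V) : R := mass^-1 * tail psi (dA x).
Definition competitor_grad (i : 'I_d) (x : V) : R :=
  - (mass^-1 * (h (dA x) * \1_I (dA x) * ddA i x)).

Lemma competitor_continuous : continuous competitor.
Proof.
move=> x; apply: (@continuousM _ _ (fun=> mass^-1) (fun x => tail psi (dA x)) x); first exact: cst_continuous.
by apply: (@continuous_comp _ _ _ dA (tail psi)); [exact: dA_continuous|exact: tail_continuous].
Qed.

Lemma competitor_bsupp : exists r, bsupp r competitor /\ forall i, bsupp r (competitor_grad i).
Proof.
have [M M0 hM] := dA_bounded A0 cA; exists (M + b).
have H x : M + b < `|x| -> b <= dA x.
  by move=> xr; have := lt_le_trans xr (hM x); rewrite ltrD2l => /ltW.
split=> [x /H bx|i x /H bx]; first by rewrite /competitor tail_out// mulr0.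
rewrite /competitor_grad indicE memNset ?mulr0 ?mul0r ?mulr0 ?oppr0//= in_itv/= => /andP[_ xb].
by have := lt_le_trans xb bx; rewrite ltxx.
Qed.

Lemma competitor_grad_measurable (i : 'I_d) : measurable_fun [set: B] (competitor_grad i : B -> R).
Proof.
apply: measurableT_comp => //; apply: measurable_funM => //; apply: measurable_funM; last exact: ddA_measurable.
exact: (measurableT_comp psi_measurable (dA_measurable A0 cA)).
Qed.

Lemma bsupp_loc_integrable (r M : R) (f : V -> R) : measurable_fun [set: B] (f : B -> R) ->
  bsupp r f -> (forall x, `|x| <= r -> `|f x| <= M) -> loc_integrable mu f.
Proof.
move=> mf sf bf C cC; apply: integrableS (bsupp_integrable hmu mf sf bf) => //.
by apply: closed_measurableRd; exact: compact_closed.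
Qed.

(** Up to the factor [mass^-1], both sides are the integral of [h t * flux t]: the left one by
    [tail_flux], the right one by [coarea] with [psi = h]. *)
Lemma competitor_weak (i : 'I_d) (phi : V -> R) : test_fun phi ->
  (\int[mu]_x (competitor x * partial i phi x)%:E = - \int[mu]_x (competitor_grad i x * phi x)%:E)%E.
Proof.
move=> tphi.
have mpsi := tail_flux hmu A0 cA a b i tphi mh h_le.
have co : coarea mu A0 cA a b i phi h := coarea_finite_range hmu A0 cA b i a0 tphi mh us hs.
rewrite /coarea -mpsi in co.
have ig := gradA_integrable hmu A0 cA a b i tphi mh h_le.
have [r [M [r0 M0 sphi bphi]]] := test_fun_sup tphi.
have it : mu.-integrable setT (fun x : B => (tail psi (dA x) * partial i phi x)%:E).
  apply: (continuous_bsupp_integrable hmu (r := r)).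
    move=> x; apply: (@continuousM _ _ (fun x => tail psi (dA x)) (partial i phi) x); last exact: tphi.1.2.
    by apply: (@continuous_comp _ _ _ dA (tail psi)); [exact: dA_continuous|exact: tail_continuous].
  by move=> x /(bsupp_partial i sphi) ->; rewrite mulr0.
transitivity ((mass^-1)%:E * (\int[mu]_x (tail psi (dA x) * partial i phi x)%:E))%E.
  rewrite -integralZl//; apply: eq_integral => x _; rewrite -EFinM /competitor; congr EFin; ring.
transitivity ((mass^-1)%:E * (\int[mu]_x (h (dA x) * gradA_phi A0 cA a b i phi x)%:E))%E.
  congr (_ * _)%E; rewrite -[LHS]fineK; last exact: integrable_fin_num it.
  rewrite -[RHS]fineK; last exact: integrable_fin_num ig.
  by congr EFin; exact: (esym co).
rewrite (_ : (\int[mu]_x (competitor_grad i x * phi x)%:E =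
  (- mass^-1)%:E * \int[mu]_x (h (dA x) * gradA_phi A0 cA a b i phi x)%:E)%E).
  by rewrite EFinN mulNe oppeK.
rewrite -integralZl//; apply: eq_integral => x _.
by rewrite -EFinM; congr EFin; rewrite /competitor_grad /gradA_phi; ring.
Qed.

Hypothesis mass0 : 0 < mass.

(** The energy is [mass^-2] times the integral in [calibrated_energy], which is at most [mass]. *)
Lemma competitor_energy :
  (\int[mu]_x (sqgrad competitor_grad x)%:E <= (mass^-1)%:E)%E.
Proof.
pose f x := mass^-1 ^+ 2 * (h (dA x) ^+ 2 * \1_I (dA x)).
have mf0 : measurable_fun [set: B] ((fun x => h (dA x) ^+ 2 * \1_I (dA x)) : B -> R).
  apply: measurable_funM; last first.
    exact: indic_dA_measurable.
  by apply: measurable_funX; exact: (measurableT_comp mh (dA_measurable A0 cA)).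
have if0 : mu.-integrable [set: B] (fun x => (h (dA x) ^+ 2 * \1_I (dA x))%:E).
  have [M M0 hM] := dA_bounded A0 cA.
  apply: (bsupp_integrable hmu (M := N ^+ 2) (r := M + b) mf0).
    move=> x xr; rewrite indicE memNset ?mulr0//= in_itv/= => /andP[_ xb].
    by have := lt_le_trans xr (hM x); rewrite ltrD2l ltNge (ltW xb).
  move=> x _; rewrite normrM -[leRHS]mulr1 ler_pM// ?indic_bound//.
  by rewrite normrX lerXn2r ?nnegrE ?h_le// (le_trans _ (h_le 0)).
apply: (@le_trans _ _ (\int[mu]_x (f x)%:E)%E).
  apply: ae_ge0_le_integral => //.
  - by move=> x _; rewrite lee_fin sqgrad_ge0.
  - by apply/measurable_EFinP; apply: sqgrad_measurable => i; exact: competitor_grad_measurable.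
  - by move=> x _; rewrite lee_fin mulr_ge0 ?sqr_ge0// mulr_ge0 ?sqr_ge0.
  - by apply/measurable_EFinP; exact: measurable_funM.
  apply: (@filterS _ _ (ae_filter_ringOfSetsType mu) _ _ _ (good_ae A0 cA hmu)) => x gx _.
  rewrite lee_fin /f /sqgrad /competitor_grad; case: (boolP (dA x \in I)) => xI; last first.
    have -> : \1_I (dA x) = 0 :> R by rewrite indicE (negbTE xI).
    by rewrite !mulr0 big1// => i _; rewrite mul0r mulr0 oppr0 expr0n.
  have -> : \1_I (dA x) = 1 :> R by rewrite indicE xI.
  move: xI; rewrite inE/= in_itv/= => /andP[ax _].
  rewrite !mulr1 -[leRHS]mulr1 -[X in _ <= _ * X](ddA_unit gx (lt_trans a0 ax)) mulr_sumr.
  by apply: ler_sum => i _; rewrite le_eqVlt; apply/orP; left; apply/eqP; rewrite /=; ring.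
rewrite /f; under eq_integral do rewrite EFinM.
rewrite integralZl// -[X in (_ * X)%E]fineK; last exact: integrable_fin_num if0.
rewrite -EFinM lee_fin expr2 -mulrA -[leRHS]mulr1.
apply: ler_wpM2l; first by rewrite invr_ge0 ltW.
by rewrite mulrC ler_pdivrMr// mul1r; exact: calibrated_energy.
Qed.

Lemma capacity_le_mass (K : set V) : K `<=` A -> (capacity mu K <= (mass^-1)%:E)%E.
Proof.
move=> KA; apply: le_trans competitor_energy.
apply: ereal_inf_lbound; exists (competitor, competitor_grad) => //=.
split; first exact: competitor_continuous.
split.
  move=> x; rewrite indicE; case: (boolP (x \in K)) => [|_]; last first.
    by rewrite mulr_ge0 ?tail_ge0// invr_ge0 ltW.
  by rewrite inE => /KA xA; rewrite /competitor dA_in// tail0 mulVf// gt_eqF.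
have [r [su sg]] := competitor_bsupp.
have [M M0 bu] := continuous_supball_bounded r competitor_continuous.
split.
- by apply: (bsupp_loc_integrable _ su bu); exact: continuous_measurableRd competitor_continuous.
- split; last by move=> phi i tphi; exact: competitor_weak.
  move=> i; apply: (@bsupp_loc_integrable r (mass^-1 * N) _ (competitor_grad_measurable i) (sg i)).
  move=> x _; have m0 : 0 <= mass^-1 by rewrite invr_ge0 ltW.
  rewrite normrN normrM (@ger0_norm _ mass^-1)// ler_wpM2l//.
  rewrite normrM -[leRHS]mulr1 ler_pM// ?ddA_le1// normrM -[leRHS]mulr1 ler_pM// ?h_le// indic_bound//.
- exact: competitor_grad_measurable.
- exact: le_lt_trans competitor_energy (ltry _).
move=> eps eps0; apply: le_lt_trans (supball_lty hmu r); apply: le_measure; rewrite ?inE.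
- rewrite (_ : [set x | _] = (fun x => `|competitor x|) @^-1` `]eps, +oo[%classic).
    rewrite -[X in measurable X]setTI.
    have mc : measurable_fun [set: B] ((fun x => `|competitor x|) : B -> R).
      by apply: measurableT_comp => //; exact: continuous_measurableRd competitor_continuous.
    by apply: mc => //; exact: measurable_itv.
  by apply/seteqP; split => x /=; rewrite in_itv/= andbT.
- exact: supball_measurable.
move=> x /= ex; rewrite /supball /= leNgt; apply/negP => /su ux.
by move: ex; rewrite ux normr0 ltNge ltW.
Qed.

End Energy.
Import HBNNSimple.

(** * From simple functions to the integral of the inverse perimeter *)

Section CapacityBound.
Variables (R : realType) (d : nat).
Local Notation V := 'rV[R]_d.
Local Notation B := (borelRd R d).
Local Notation leb := (@lebesgue_measure R).
Variable mu : {measure set B -> \bar R}.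
Hypothesis hmu : is_lebesgue_Rd mu.

Lemma perimeter_ge0 (E : set V) : (0 <= perimeter mu E)%E.
Proof.
apply: ereal_sup_ubound; exists (fun=> 0).
  split; last by move=> x; rewrite -(scale0r (0 : V)) enormZ normr0 mul0r.
  split; last by exists set0; split => //; exact: compact0.
  move=> j; have := C1grad_C1 (@C1grad_cst R d 0).
  by rewrite (_ : (fun x : V => _) = (fun=> 0 : R))//; apply/funext => x; rewrite mxE.
rewrite (_ : (fun x : V => _) = (fun=> 0%E)); first by rewrite integral0.
apply/funext => x; rewrite /div big1// => i _.
rewrite (_ : (fun y : V => _) = (fun=> 0 : R)); last by apply/funext => y; rewrite mxE.
by rewrite (C1grad_partial (@C1grad_cst R d 0)).
Qed.

Variable A : set V.
Hypotheses (A0 : A !=set0) (cA : compact A).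
Local Notation f := (fun t : R => (perimeter mu (parallel A t))^-1)%E.
Local Notation D := (`]0%R, +oo[%classic : set R).
Local Notation J := (\int[leb]_(t in D) f t)%E.

(* The integral is approached from below by simple functions, so [1/P] need not be measurable. *)
Lemma capacity_lt (K : set V) (c : R) : K `<=` A -> (J < +oo)%E -> 0 < c -> (c%:E < J)%E ->
  (capacity mu K <= (c^-1)%:E)%E.
Proof.
move=> KA Jfin c0 cJ.
have f0 t : (0 <= (f \_ D) t)%E.
  by rewrite patchE; case: ifP => // _; rewrite inve_ge0; exact: perimeter_ge0.
move: cJ; rewrite integral_mkcond (ge0_integralTE leb f0) => cJ.
have [_ [h hf <-] ch] := ereal_sup_gt cJ.
have hJ : (sintegral leb h <= J)%E.
  by rewrite integral_mkcond (ge0_integralTE leb f0); apply: ereal_sup_ubound; exists h.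
have mh : measurable_fun setT h by exact: measurable_funPT.
have h0 t : 0 <= h t by [].
have ih : leb.-integrable setT (EFin \o h).
  apply/integrableP; split; first exact/measurable_EFinP.
  under eq_integral do rewrite /= ger0_norm//.
  by rewrite integralT_nnsfun (le_lt_trans hJ).
have cih : c < (\int[leb]_t h t)%R.
  by rewrite -lte_fin /Rintegral fineK ?integralT_nnsfun//; have := integrable_fin_num measurableT ih; rewrite integralT_nnsfun.
pose a (k : nat) : R := k.+1%:R^-1.
pose b (k : nat) : R := k.+1%:R.
have ck : mass (a k) (b k) h @[k --> \oo] --> (\int[leb]_t h t)%R.
  apply: (@dominated_Rintegral R _ _ leb (fun k t => h t * \1_(`]a k, b k[%classic) t) h h) => //.
  - by move=> k; apply: measurable_funM => //; apply: measurable_indic; exact: measurable_itv.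
  - by move=> k t; rewrite normrM ger0_norm// ler_piMr// indic_bound.
  (* [h] lies below [1/P] cut off to positive [t], so it vanishes for [t <= 0], and the intervals
     []a k, b k[] exhaust the rest. *)
  move=> t; have [t0|t0] := ltP 0 t; last first.
    have -> : h t = 0.
      apply/eqP; rewrite eq_le h0 andbT -lee_fin (le_trans (hf t))//.
      rewrite patchE; case: ifPn => // ; rewrite inE/= in_itv/= andbT => t0'.
      by have := lt_le_trans t0' t0; rewrite ltxx.
    by under eq_fun do rewrite mul0r; exact: cvg_cst.
  have ch' : a k @[k --> \oo] --> (0 : R) by exact: cvg_harmonic.
  apply: cvg_near_cst; near=> k.
  rewrite indicE mem_set ?mulr1//= in_itv/=; apply/andP; split.
    by near: k; apply: cvgr_lt ch' _ _.
  have : (t < k%:R :> R) by near: k; exact: nbhs_infty_gtr.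
  by move=> tk; rewrite (lt_trans tk)// ltr_nat.
have [k _ hk] := cvgr_gt _ ck c cih.
have {}hk : c < mass (a k) (b k) h by exact: (hk k (leqnn k)).
have m0 : 0 < mass (a k) (b k) h := lt_trans c0 hk.
apply: (@le_trans _ _ ((mass (a k) (b k) h)^-1)%:E); last first.
  by rewrite lee_fin lef_pV2 ?posrE// ltW.
apply: (@capacity_le_mass _ _ _ hmu _ A0 cA (a k) (b k) h (finmap.enum_fset (fset_set (range h)))) => //.
- by rewrite invr_gt0.
- exact: finmap.fset_uniq.
- by move=> t; have := in_fset_set (@fimfunP _ _ h) (h t) => ->; rewrite inE; exists t.
move=> t /andP[at_ _]; apply: le_trans (hf t) _.
rewrite patchE mem_set//= in_itv/= andbT; apply: lt_trans at_; by rewrite invr_gt0.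
Unshelve. all: by end_near. Qed.

Lemma capacity_le_inv (K : set V) : K `<=` A -> (J < +oo)%E -> (capacity mu K <= J^-1)%E.
Proof.
move=> KA Jfin.
have J0 : (0 <= J)%E by apply: integral_ge0 => t _; rewrite inve_ge0; exact: perimeter_ge0.
have [j jE] : exists j : R, J = j%:E by exists (fine J); rewrite fineK// ge0_fin_numE.
have key := @capacity_lt K _ KA Jfin; rewrite jE in J0 key *.
(* For [J = 0] the right side is [+oo]. *)
rewrite lee_fin in J0; move: J0; rewrite le_eqVlt => /orP[/eqP<-|j0]; first by rewrite inve0 leey.
rewrite inver gt_eqF//; apply/lee_addgt0Pr => e e0.
pose c := (j^-1 + e)^-1.
have c0 : 0 < c by rewrite invr_gt0 addr_gt0// invr_gt0.
have cj : c < j by rewrite /c invf_plt ?posrE ?addr_gt0 ?invr_gt0// ltrDl.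
by have := key c c0; rewrite lte_fin => /(_ cj); rewrite /c invrK EFinD.
Qed.

End CapacityBound.

(** * Equality for balls *)

Section Ball.
Variables (R : realType) (d : nat).
Local Notation V := 'rV[R]_d.
Local Notation B := (borelRd R d).
Local Notation leb := (@lebesgue_measure R).
Variable mu : {measure set B -> \bar R}.
Hypothesis hmu : is_lebesgue_Rd mu.
Hypothesis hd : (3 <= d)%N.
Variables (c : V) (r : R).
Hypothesis r0 : 0 < r.

Lemma capacity_cball_ge :
  ((ballcst mu c * (d%:R - 2) * r ^+ d.-2)%:E <= capacity mu (cball c r))%E.
Proof.
apply: le_ereal_inf_tmp => _ [[u g] /= [cu [u1 ug]] <-].
have [_ _ _ gfin _] := ug.
rewrite -[leRHS]fineK; first by rewrite lee_fin; exact: cap_ball_ge.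
by rewrite ge0_fin_numE//; apply: integral_ge0 => x _; rewrite lee_fin sqgrad_ge0.
Qed.

(** Since the perimeter of the ball of radius [r + t] is at most [ballcst (r + t)^(d-1)], the
    integral of [1/P] is bounded below by the one in [integral_power]. *)
Lemma inv_perimeter_cball_le :
  ((\int[leb]_(t in `]0%R, +oo[) (perimeter mu (parallel (cball c r) t))^-1)^-1 <=
   (ballcst mu c * (d%:R - 2) * r ^+ d.-2)%:E)%E.
Proof.
set J := (\int[leb]_(t in _) _)%E.
have [n n0 dE] : exists2 n, (0 < n)%N & d = n.+2.
  by move: hd; case: (d) => [|[|[|n]]]// _; exists n.+1.
have -> : d%:R - 2 = n%:R :> R by rewrite dE -[n.+2]addn2 natrD addrK.
have -> : d.-2 = n by rewrite dE.
have J0 : (0 <= J)%E by apply: integral_ge0 => t _; rewrite inve_ge0; exact: perimeter_ge0.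
have nr : 0 < n%:R * r ^+ n by rewrite mulr_gt0 ?exprn_gt0 ?ltr0n.
(* [ballcst] is only known to be nonnegative, so the bound is proved for every positive [C] above
   it, and [C] then decreases to it. *)
have key C : ballcst mu c <= C -> 0 < C -> (J^-1 <= (C * n%:R * r ^+ n)%:E)%E.
  move=> cC C0.
  have X0 : 0 < C * n%:R * r ^+ n by rewrite -mulrA mulr_gt0.
  rewrite -[leRHS]inveK lee_pV2 ?inE//; last by rewrite inve_ge0 lee_fin ltW.
  rewrite inver gt_eqF//.
  have -> : (C * n%:R * r ^+ n)^-1 = r^-1 ^+ n / (C * n%:R) by rewrite invfM exprVn mulrC.
  rewrite -(integral_power n0 C0 r0); apply: le_integral_nomeas => t.
    rewrite /= in_itv/= andbT => t0.
    by rewrite lee_fin invr_ge0 mulr_ge0 ?exprn_ge0 ?addr_ge0 ?(ltW C0) ?(ltW r0) ?(ltW t0).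
  rewrite /= in_itv/= andbT => t0.
  have rt : 0 < r + t by rewrite addr_gt0.
  rewrite parallel_cball ?(ltW r0) ?(ltW t0)//.
  have P0 : 0 < C * (r + t) ^+ n.+1 by rewrite mulr_gt0 ?exprn_gt0.
  rewrite (_ : ((C * (r + t) ^+ n.+1)^-1)%:E = ((C * (r + t) ^+ n.+1)%:E)^-1)%E; last by rewrite inver gt_eqF.
  rewrite lee_pV2 ?inE ?perimeter_ge0 ?lee_fin ?(ltW P0)//.
  apply: le_trans (perimeter_cball_le hmu c hd rt) _.
  have -> : d.-1 = n.+1 by rewrite dE.
  by rewrite lee_fin ler_wpM2r ?exprn_ge0 ?(ltW rt).
apply/lee_addgt0Pr => e e0.
have c0 := ballcst_ge0 mu c.
have e1 : 0 < e / (n%:R * r ^+ n) by rewrite divr_gt0.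
have := key (ballcst mu c + e / (n%:R * r ^+ n)).
rewrite lerDl ltW// ltr_wpDl// => /(_ isT isT).
by rewrite -EFinD -!mulrA mulrDl divfK ?gt_eqF.
Qed.

End Ball.

Theorem theorem1 (R : realType) (d : nat) (hd : (3 <= d)%N)
  (mu : {measure set borelRd R d -> \bar R}) (hmu : is_lebesgue_Rd mu)
  (K : set 'rV[R]_d) (K0 : K !=set0) (Kc : compact K)
  (hfin : (\int[lebesgue_measure]_(t in `]0%R, +oo[)
             (perimeter mu (parallel (Ktilde K) t))^-1 < +oo)%E) :
  (capacity mu K <= (\int[lebesgue_measure]_(t in `]0%R, +oo[)
             (perimeter mu (parallel (Ktilde K) t))^-1)^-1)%E /\
  (forall (c : 'rV[R]_d) (r : R), 0 < r -> K = cball c r ->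
     capacity mu K = ((\int[lebesgue_measure]_(t in `]0%R, +oo[)
             (perimeter mu (parallel (Ktilde K) t))^-1)^-1)%E).
Proof.
have KA : K `<=` Ktilde K by exact: Ktilde_sub.
have A0 : Ktilde K !=set0 by case: K0 => x /KA; exists x.
have cA : compact (Ktilde K) by exact: Ktilde_compact.
have le1 := capacity_le_inv hmu A0 cA KA hfin.
split=> // c r r0 KE; apply/eqP; rewrite eq_le le1 /= KE (Ktilde_cball c (ltW r0)).
(* Both bounds contain the same [ballcst mu c], which closes the chain. *)
exact: le_trans (inv_perimeter_cball_le hmu hd c r0) (capacity_cball_ge hmu hd c r0).
Qed.
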